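(* Let $N\ge 2$, $0<\alpha<2$, $c\in\mathbb{R}$, $1<p<\infty$ and assume $\alpha<\frac Np+1$. Let $\phi$ be the function and $-S$ the operator in $L^p(\mathbb{R}^N)$ described in the context, with domain $$D(-S)=\Big\{u:\ u\in W^{2,p}(\mathbb{R}^N\setminus B_\epsilon)\ \text{for every }\epsilon>0,\ \frac{u}{\phi}\in W^{2,p}(\mathbb{R}^N)\Big\}.$$ Fix $\eta\in C_c^\infty(\mathbb{R}^N)$ with $\eta\equiv 1$ in the unit ball $B$. Then: (i) if $\alpha<\frac Np$, then $D(-S)=W^{2,p}(\mathbb{R}^N)$; (ii) if $\frac Np\le\alpha<\frac Np+1$, then $D(-S)\subset W^{1,p}(\mathbb{R}^N)$ and $$D(-S)=\{u=u(0)\,\eta\phi+u_1:\ u_1\in W^{2,p}(\mathbb{R}^N),\ u_1(0)=0\},$$ i.e. $D(-S)$ is the set of all functions $a\,\eta\phi+u_1$ with $a$ a scalar, $u_1\in W^{2,p}(\mathbb{R}^N)$, $u_1(0)=0$ (and then $a=u(0)$).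
   Context: Functions are complex valued; $B_r$ is the open ball of $\mathbb{R}^N$ centred at $0$ with radius $r$, $B=B_1$. In case (ii) one has $p>N/2$, so functions in $W^{2,p}(\mathbb{R}^N)$ are continuous and point values make sense; $\phi$ is extended continuously by $\phi(0)=1$. For $m\in\mathbb{N}_0$ let $$\psi_{\alpha,c,m}(x)=\sum_{k=0}^m\frac{c^k\,\Gamma(\frac{N-\alpha}{2-\alpha})}{(2-\alpha)^{2k}\,k!\,\Gamma(\frac{N-\alpha}{2-\alpha}+k)}|x|^{(2-\alpha)k}.$$ $\phi\in C^\infty(\mathbb{R}^N\setminus\{0\})$ is a fixed function such that: $\phi$ is radial and $\frac12\le\phi\le2$ on $\mathbb{R}^N$; $\phi=\psi_{\alpha,c,m}$ in a neighbourhood of the origin, where $m$ is the integer in $[\frac{\alpha}{2-\alpha},\frac{2}{2-\alpha})$; $\phi\equiv1$ in a neighbourhood of infinity. The operator $S$ acts as $Su=-\Delta u+c|x|^{-\alpha}u$, where $\Delta u$ is computed in $\mathbb{R}^N\setminus\{0\}$. *)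

(* Defs.v *)
From HB Require Import structures.
From mathcomp Require Import all_boot all_order all_algebra.
From mathcomp Require Import complex.
From mathcomp Require Import all_classical all_reals all_analysis.

Set Implicit Arguments.
Unset Strict Implicit.
Unset Printing Implicit Defensive.

Import Order.TTheory GRing.Theory Num.Theory.
Import numFieldNormedType.Exports.

Local Open Scope classical_set_scope.
Local Open Scope ring_scope.

(* The sigma-algebra generated by the coordinates is the Borel sigma-algebra. *)

Definition rV_display : measure_display. Proof. exact. Qed.

Section rV_measurable.
Context {R : realType} {n : nat}.

Definition rV_coord (i : 'I_n) (x : 'rV[R]_n) : R := x ord0 i.

Let rV_set0 : g_sigma_preimage rV_coord set0.
Proof. exact: sigma_algebra0. Qed.

Let rV_setC A : g_sigma_preimage rV_coord A -> g_sigma_preimage rV_coord (~` A).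
Proof. exact: sigma_algebraC. Qed.

Let rV_bigcup (F : (set 'rV[R]_n)^nat) :
  (forall i, g_sigma_preimage rV_coord (F i)) ->
  g_sigma_preimage rV_coord (\bigcup_i F i).
Proof. exact: sigma_algebra_bigcup. Qed.

HB.instance Definition _ := @isMeasurable.Build rV_display 'rV[R]_n
  (g_sigma_preimage rV_coord) rV_set0 rV_setC rV_bigcup.

End rV_measurable.

Lemma measurable_rV_coord (R : realType) n (i : 'I_n) :
  measurable_fun [set: 'rV[R]_n] (rV_coord i).
Proof.
move=> _ Y mY; rewrite setTI; apply: sub_sigma_algebra => /=.
rewrite -bigcup_seq/=; exists i => /=; first by rewrite mem_index_enum.
by exists Y => //; rewrite setTI.
Qed.

Lemma measurable_fun_rV (R : realType) d (T : measurableType d) n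
    (f : T -> 'rV[R]_n) :
  (forall i, measurable_fun [set: T] (rV_coord i \o f)) ->
  measurable_fun [set: T] f.
Proof.
move=> mf.
have H : g_sigma_preimage (fun i => rV_coord i \o f) `<=` measurable.
  apply: smallest_sub; first exact: sigma_algebra_measurable.
  case: n => [|n] in f mf *; first by rewrite big_ord0.
  rewrite -bigcup_mkord_ord; apply: bigcup_sub => i Ii.
  by move=> A [B mB <-]; exact: mf.
by move=> _ A mA; apply: H; rewrite g_sigma_preimage_comp; exists A.
Qed.

(* Lebesgue measure on [R^n] is built by induction on [n], as the product measure
   transported along [R * R^n ~ R^(1+n)]. The sigma-finiteness of the product is
   proved again in [step_sigma_finite]: the library instance is not found by
   unification. *)

Section lebesgue_rV.
Context {R : realType}.

Definition rV_cons n (x : measurableTypeR R * 'rV[R]_n) : 'rV[R]_n.+1 :=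
  row_mx (const_mx x.1 : 'rV[R]_1) x.2.

Definition rV_uncons n (x : 'rV[R]_n.+1) : measurableTypeR R * 'rV[R]_n :=
  (x ord0 ord0, \row_j x ord0 (lift ord0 j)).

Lemma rV_cons0 n (x : measurableTypeR R * 'rV[R]_n) : rV_cons x ord0 ord0 = x.1.
Proof.
rewrite /rV_cons; have -> : (ord0 : 'I_n.+1) = lshift n (ord0 : 'I_1) by exact: val_inj.
by rewrite (row_mxEl (const_mx x.1 : 'rV[R]_1)) mxE.
Qed.

Lemma rV_consS n (x : measurableTypeR R * 'rV[R]_n) (j : 'I_n) :
  rV_cons x ord0 (lift ord0 j) = x.2 ord0 j.
Proof.
rewrite /rV_cons; have -> : lift ord0 j = rshift 1 j by exact: val_inj.
by rewrite (row_mxEr (const_mx x.1 : 'rV[R]_1)).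
Qed.

Lemma rV_consK n : cancel (@rV_cons n) (@rV_uncons n).
Proof.
move=> [a y]; rewrite /rV_uncons rV_cons0; congr pair.
by apply/rowP => j; rewrite mxE rV_consS.
Qed.

Lemma measurable_rV_cons n : measurable_fun setT (@rV_cons n).
Proof.
apply: measurable_fun_rV => i.
have [j ->|->] := unliftP ord0 i.
  rewrite (_ : _ \o _ = rV_coord j \o snd); last first.
    by apply/funext => x /=; rewrite /rV_coord rV_consS.
  exact: measurableT_comp (measurable_rV_coord _) _.
rewrite (_ : _ \o _ = fst) //.
by apply/funext => x /=; rewrite /rV_coord rV_cons0.
Qed.

Lemma measurable_rV_uncons n : measurable_fun setT (@rV_uncons n).
Proof.
apply/measurable_fun_pairP; split; first exact: measurable_rV_coord.
apply: measurable_fun_rV => i.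
rewrite (_ : _ \o _ = rV_coord (lift ord0 i)); first exact: measurable_rV_coord.
by apply/funext => x /=; rewrite /rV_coord mxE.
Qed.

Section step.
Context n (mu : {sigma_finite_measure set 'rV[R]_n -> \bar R}).

Definition lebesgue_rV_step : set 'rV[R]_n.+1 -> \bar R :=
  pushforward (@lebesgue_measure R \x mu)%E (@rV_cons n).

Let step0 : lebesgue_rV_step set0 = 0%E.
Proof. by rewrite /lebesgue_rV_step /pushforward preimage_set0 measure0. Qed.

Let step_ge0 A : (0 <= lebesgue_rV_step A)%E.
Proof. by rewrite /lebesgue_rV_step /pushforward measure_ge0. Qed.

Let step_sigma_additive : semi_sigma_additive lebesgue_rV_step.
Proof.
have mf := @measurable_rV_cons n.
move=> F mF tF mUF; rewrite /lebesgue_rV_step /pushforward preimage_bigcup.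
apply: measure_semi_sigma_additive.
- by move=> k; rewrite -[X in measurable X]setTI; exact: mf.
- apply/trivIsetP => /= i j _ _ ij; rewrite -preimage_setI.
  by move/trivIsetP : tF => /(_ _ _ _ _ ij) ->//; rewrite preimage_set0.
- by rewrite -preimage_bigcup -[X in measurable X]setTI; exact: mf.
Qed.

HB.instance Definition _ := isMeasure.Build _ _ _ lebesgue_rV_step
  step0 step_ge0 step_sigma_additive.

Let step_sigma_finite : sigma_finite setT lebesgue_rV_step.
Proof.
have /sigma_finiteP[F [TF ndF Foo]] := sigma_finiteT (@lebesgue_measure R).
have /sigma_finiteP[G [TG ndG Goo]] := sigma_finiteT mu.
exists (fun k => @rV_uncons n @^-1` (F k `*` G k)).
  rewrite -preimage_bigcup (_ : \bigcup_i _ = setT) ?preimage_setT //.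
  apply/seteqP; split => // -[x y] _.
  have [i _ Fix] : (\bigcup_k F k) x by rewrite -TF.
  have [j _ Gjy] : (\bigcup_k G k) y by rewrite -TG.
  exists (maxn i j) => //; split => /=.
  - by move: x Fix; exact/subsetPset/ndF/leq_maxl.
  - by move: y Gjy; exact/subsetPset/ndG/leq_maxr.
move=> k; have [mF Fk] := Foo k; have [mG Gk] := Goo k; split.
  rewrite -[X in measurable X]setTI; apply: measurable_rV_uncons => //.
  exact: measurableX.
rewrite /lebesgue_rV_step /pushforward -comp_preimage.
rewrite (_ : _ \o _ = id); last by apply/funext => x /=; rewrite rV_consK.
by rewrite preimage_id product_measure1E// lte_mul_pinfty// ge0_fin_numE.
Qed.

HB.instance Definition _ :=
  Measure_isSigmaFinite.Build _ _ _ lebesgue_rV_step step_sigma_finite.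

End step.

Fixpoint lebesgue_rV n : {sigma_finite_measure set 'rV[R]_n -> \bar R} :=
  if n is n'.+1 then lebesgue_rV_step (lebesgue_rV n') else \d_(0 : 'rV[R]_0).

End lebesgue_rV.

Local Open Scope complex_scope.

Section euclidean.
Context {R : realType} {N : nat}.
Implicit Types (x : 'rV[R]_N) (Omega : set 'rV[R]_N).

(* [`|x|] is the sup norm on matrices, whence this Euclidean norm; both induce
   the same topology. *)
Definition enorm x : R := Num.sqrt (\sum_(i < N) x ord0 i ^+ 2).

Definition eball (r : R) : set 'rV[R]_N := [set x | enorm x < r].

Fixpoint dpart (s : seq 'I_N) (f : 'rV[R]_N -> R) : 'rV[R]_N -> R :=
  if s is i :: s' then fun x => 'D_(delta_mx ord0 i) (dpart s' f) x else f.

Definition smooth_on Omega (f : 'rV[R]_N -> R) : Prop :=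
  forall (s : seq 'I_N) x, Omega x ->
    {for x, continuous (dpart s f)} /\
    forall i : 'I_N, derivable (dpart s f) x (delta_mx ord0 i).

Definition cdpart (s : seq 'I_N) (f : 'rV[R]_N -> R[i]) (x : 'rV[R]_N) : R[i] :=
  dpart s (@complex.Re R \o f) x +i* dpart s (@complex.Im R \o f) x.

Definition csmooth (f : 'rV[R]_N -> R[i]) : Prop :=
  smooth_on setT (@complex.Re R \o f) /\ smooth_on setT (@complex.Im R \o f).

Definition ccontinuous (f : 'rV[R]_N -> R[i]) : Prop :=
  continuous (@complex.Re R \o f) /\ continuous (@complex.Im R \o f).

Definition csupport (f : 'rV[R]_N -> R[i]) : set 'rV[R]_N :=
  closure [set x | f x != 0].

(* [C_c^oo(Omega)], its elements being extended by zero to [R^N] *)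
Definition test_fun Omega : set ('rV[R]_N -> R[i]) :=
  [set f : 'rV[R]_N -> R[i] | csmooth f /\ compact (csupport f) /\ csupport f `<=` Omega].

Definition cintegral Omega (f : 'rV[R]_N -> R[i]) : R[i] :=
  (\int[lebesgue_rV N]_(x in Omega) complex.Re (f x))%R +i*
  (\int[lebesgue_rV N]_(x in Omega) complex.Im (f x))%R.

(* Elements of [L^p] are Borel functions, not classes: every class for a.e.
   equality has a Borel representative. *)
Definition Lp (p : R) Omega : set ('rV[R]_N -> R[i]) :=
  [set u : 'rV[R]_N -> R[i] | measurable_fun Omega (@complex.Re R \o u) /\
           measurable_fun Omega (@complex.Im R \o u) /\
           (\int[lebesgue_rV N]_(x in Omega) (Normc.normc (u x) `^ p)%:E
              < +oo)%E].

(* the derivatives are iterated in the order given by [s], so that [s] stands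
   for the multi-index counting the occurrences of each coordinate *)
Definition weak_deriv Omega (s : seq 'I_N) (u v : 'rV[R]_N -> R[i]) : Prop :=
  forall f, test_fun Omega f ->
    cintegral Omega (fun x => u x * cdpart s f x) =
    (-1) ^+ size s * cintegral Omega (fun x => v x * f x).

Definition sobolev (k : nat) (p : R) Omega : set ('rV[R]_N -> R[i]) :=
  [set u : 'rV[R]_N -> R[i] | Lp p Omega u /\
     forall s : seq 'I_N, (size s <= k)%N ->
       exists2 v, Lp p Omega v & weak_deriv Omega s u v].

(* [u] has a continuous representative, whose value at [x0] is [a]; this
   representative is unique since nonempty open sets have positive measure *)
Definition point_value (u : 'rV[R]_N -> R[i]) (x0 : 'rV[R]_N) (a : R[i]) : Prop :=
  exists v, ccontinuous v /\ {ae lebesgue_rV N, forall x, u x = v x} /\ v x0 = a.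

End euclidean.

Definition Gamma {R : realType} (a : R) : R :=
  (\int[lebesgue_measure]_(t in `]0%R, +oo[) (t `^ (a - 1) * expR (- t)))%R.

Section domain.
Context {R : realType} {N : nat}.
Implicit Types (alpha c p : R) (m : nat).

(* for [k = 0] and [x = 0] the power is [0 `^ 0 = 1], hence [psi 0 = 1] *)
Definition psi alpha c m (x : 'rV[R]_N) : R :=
  let g := (N%:R - alpha) / (2 - alpha) in
  \sum_(k < m.+1)
    c ^+ k * Gamma g / ((2 - alpha) ^+ (2 * k) * k`!%:R * Gamma (g + k%:R)) *
    enorm x `^ ((2 - alpha) * k%:R).

(* [phi x = psi x] on a full neighbourhood of the origin includes the value
   [phi 0 = 1] of the continuous extension *)
Definition is_phi alpha c m (phi : 'rV[R]_N -> R) : Prop :=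
  [/\ smooth_on [set x | x != 0] phi,
      forall x y, enorm x = enorm y -> phi x = phi y,
      forall x, 1 / 2 <= phi x <= 2,
      \forall x \near (0 : 'rV[R]_N), phi x = psi alpha c m x
    & exists M : R, forall x, M < enorm x -> phi x = 1].

(* [W^{2,p}(R^N \ B_eps)] is taken on the interior of [R^N \ B_eps], the sphere
   being a null set *)
Definition dom_S p (phi : 'rV[R]_N -> R) : set ('rV[R]_N -> R[i]) :=
  [set u : 'rV[R]_N -> R[i] | (forall eps : R, 0 < eps ->
              sobolev 2 p (~` eball eps)° u) /\
           sobolev 2 p setT (fun x => u x / (phi x)%:C)].

End domain.

(* Main.v *)
Require Import Defs.
From HB Require Import structures.
From mathcomp Require Import all_boot all_order all_algebra.
From mathcomp Require Import complex.
From mathcomp Require Import all_classical all_reals all_analysis.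
From mathcomp Require Import measurable_realfun.
From mathcomp Require Import ring lra.

Set Implicit Arguments.
Unset Strict Implicit.
Unset Printing Implicit Defensive.

Import Order.TTheory GRing.Theory Num.Theory.
Import numFieldNormedType.Exports.

Local Open Scope classical_set_scope.
Local Open Scope ring_scope.

(* Off the origin [phi] is smooth, it equals [psi] near 0 and 1 near infinity; hence
   its first and second derivatives, and those of [1/phi], are bounded by multiples
   of |x|^(1-alpha) and |x|^(-alpha) near 0. Multiplication by [phi] or [1/phi]
   therefore preserves [W^{2,p}] on those [w] for which |x|^(-alpha) w and
   |x|^(1-alpha) grad w are p-integrable near 0.
   These Hardy inequalities follow from w(2x) - w(x) = int_1^2 x.(grad w)(sx) ds:
   comparing the weighted norms of w(2.) and w gives a contraction, from outside
   when alpha < N/p, and from inside, for a continuous [w] with w(0) = 0, when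
   alpha > N/p; the exponent alpha = N/p is reached by enlarging alpha slightly.
   In case (ii) one has p > N/2, so that [w = u/phi] has a continuous representative
   and [w - w(0) eta] falls under the second Hardy inequality. The product rule is only
   tested against functions vanishing near 0; the origin is removable since N >= 2. *)

(** * Lebesgue measure on row vectors *)

(** No smooth cutoff is constructed: [eta], rescaled to be 1 on the sup-norm unit ball, is the only
    one, which is why a [plateau] hypothesis runs through the proof. Bumps, mollifiers and cutoffs
    near the origin or infinity all come from it by products and dilations. In the Hardy
    inequalities, returning from w(2x) to w(x) costs 2^(bp-N) for the weight |x|^(-bp). A triangle
    inequality whose first constant is close to 1 keeps the total factor below 1, but absorbing a
    term requires it to be finite. From outside this is secured by capping the weight; from inside
    the differences w - w(2^-n x) start from 0, so finiteness comes by induction. The condition N >=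
    2 enters through the Hardy inequality with p = 1 and exponent 1: cutting off near the origin
    creates a gradient of size 1/|x|, and w/|x| is locally integrable only because 1 < N. Continuity
    for p > N/2 uses no kernel or covering argument. The same dilation identity, centred at an
    arbitrary point, compares averages at the scales 2^-n; it is applied to the gradient and then to
    the function, so each of the two derivatives is used once. Everything is done for real
    functions; complex ones are split at the end. *)

Section row_vectors.
Context {R : realType} {n : nat}.
Implicit Types x y z : 'rV[R]_n.

Lemma eq_rV x y : (forall i, x ord0 i = y ord0 i) -> x = y.
Proof. by move=> xy; apply/rowP. Qed.

Lemma rV_normE x : `|x| = \big[Order.max/0]_i `|x ord0 i|.
Proof.
rewrite /Num.Def.normr /= mx_normrE.
apply/eqP; rewrite eq_le; apply/andP; split.
  apply/bigmax_leP; split=> [|[i j] _ /=]; first exact: bigmax_ge_id.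
  by rewrite (ord1 i); exact: (le_bigmax _ (fun i => `|x ord0 i|)).
apply/bigmax_leP; split=> [|j _ /=]; first exact: bigmax_ge_id.
exact: (le_bigmax _ (fun ij => `|x ij.1 ij.2|) (ord0, j)).
Qed.

Lemma le_coord_norm x i : `|x ord0 i| <= `|x|.
Proof. by rewrite rV_normE; exact: (le_bigmax _ (fun i => `|x ord0 i|)). Qed.

Lemma rV_norm_leP x r : 0 <= r -> (forall i, `|x ord0 i| <= r) -> `|x| <= r.
Proof. by move=> r0 xr; rewrite rV_normE; apply/bigmax_leP. Qed.

Lemma rV_norm_ltP x r : 0 < r -> (forall i, `|x ord0 i| < r) -> `|x| < r.
Proof. by move=> r0 xr; rewrite rV_normE; apply/bigmax_ltP. Qed.

Lemma measurable_affine (a : R) z :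
  measurable_fun setT (fun x : 'rV[R]_n => a *: x + z).
Proof.
apply: measurable_fun_rV => i.
rewrite (_ : _ \o _ = fun x => a * rV_coord i x + z ord0 i).
  apply: measurable_funD => //; apply: measurable_funM => //.
  exact: measurable_rV_coord.
by apply/funext => x /=; rewrite /rV_coord !mxE.
Qed.

(* Rational dilations and translations of any bounded neighbourhood of the origin
   form a countable base of the topology. *)
Lemma open_bigcup_base (U : set 'rV[R]_n) (L : R) (O : set 'rV[R]_n) :
  0 < L -> (forall x, `|x| < 1 -> U x) -> (forall x, U x -> `|x| < L) ->
  open O ->
  O = \bigcup_(k in [set k : 'rV[rat]_n * nat |
        (fun x => (k.2.+1%:R : R) *: (x - map_mx ratr k.1)) @^-1` U `<=` O])
      (fun x => (k.2.+1%:R : R) *: (x - map_mx ratr k.1)) @^-1` U.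
Proof.
move=> L0 U1 UL oO; apply/seteqP; split => [x Ox|x [k kO kx]]; last exact: kO.
have [e /= e0 eO] : nbhs_ball x O by apply/nbhs_ballP; exact: open_nbhs_nbhs.
pose k := Num.bound ((L + 1) / e).
have k0 : 0 < k.+1%:R :> R by rewrite ltr0n.
(* In the rescaled variable the set has radius [L] and the rational centre lies within 1 of the
   point, so a total displacement of [L + 1] has to fit into the ball of radius [e]. *)
have kP : (L + 1) / k.+1%:R < e.
  rewrite ltr_pdivrMr// mulrC -ltr_pdivrMr//.
  apply: (lt_trans (archi_boundP _)); first by rewrite divr_ge0 ?ltW// addr_gt0.
  by rewrite ltr_nat.
have /choice [q qP] : forall i, exists q : rat,
    `|x ord0 i - ratr q| < k.+1%:R^-1.
  move=> i; have [q] := @rat_in_itvoo R (x ord0 i) (x ord0 i + k.+1%:R^-1) ltac:(by rewrite ltrDl invr_gt0).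
  rewrite in_itv/= => /andP[q1 q2]; exists q.
  rewrite distrC ltr_distl (lt_trans _ q1)//= ?ltrBlDr ?ltrDl ?invr_gt0//.
have xq : `|x - map_mx ratr (\row_i q i)| < k.+1%:R^-1.
  apply: rV_norm_ltP => [|i]; first by rewrite invr_gt0.
  by rewrite !mxE.
exists (\row_i q i, k) => /=.
  move=> y /= /UL; rewrite normrZ (ger0_norm (ltW k0)) mulrC -ltr_pdivlMr// => yq.
  apply: eO; rewrite -ball_normE /=.
  rewrite (_ : x - y = (x - map_mx ratr (\row_i q i)) - (y - map_mx ratr (\row_i q i))); last first.
    by rewrite opprB addrA subrK.
  apply: le_lt_trans (ler_normB _ _) _.
  apply: lt_trans kP; rewrite mulrDl addrC mul1r; exact: ltrD.
apply: U1; rewrite normrZ (ger0_norm (ltW k0)) mulrC -ltr_pdivlMr// div1r.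
exact: xq.
Qed.

Lemma measurable_rV_ball r : measurable [set x : 'rV[R]_n | `|x| < r].
Proof.
have [r0|r0] := ltP 0 r; last first.
  rewrite (_ : mkset _ = set0)//; apply/seteqP; split => // x /= xr.
  by have := lt_le_trans xr r0; rewrite normr_lt0.
rewrite (_ : mkset _ = \bigcap_(i : 'I_n) (setT `&` rV_coord i @^-1` [set t | `|t| < r])); last first.
  apply/seteqP; split => x /=.
    by move=> xr i _; split => //=; apply: le_lt_trans xr; exact: le_coord_norm.
  by move=> xr; apply: rV_norm_ltP => // i; have [] := xr i I.
apply: fin_bigcap_measurable => // i _; apply: measurable_rV_coord => //.
rewrite (_ : mkset _ = `](- r), r[%classic) //.
by apply/seteqP; split => t /=; rewrite in_itv/= ltr_norml.
Qed.

(** The sigma-algebra is generated by the coordinates, so the countable base is essential. It is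
    taken from the sup-norm unit ball, a finite intersection of coordinate slabs. *)
Lemma open_measurable_rV (O : set 'rV[R]_n) : open O -> measurable O.
Proof.
move=> oO; rewrite (@open_bigcup_base [set x | `|x| < 1] 1 O)//.
rewrite bigcup_mkcond; apply: countable_bigcupT_measurable => // k.
case: ifPn => // _; rewrite -[X in measurable X]setTI.
have := @measurable_affine (k.2.+1%:R : R) (- (k.2.+1%:R *: map_mx ratr k.1)).
move=> /(_ measurableT _ (measurable_rV_ball 1)).
rewrite (_ : (fun x => _ + _) = (fun x => k.2.+1%:R *: (x - map_mx ratr k.1)))//.
by apply/funext => x; rewrite scalerBr.
Qed.

Lemma continuous_measurable_rV (f : 'rV[R]_n -> R) :
  continuous f -> measurable_fun setT f.
Proof.
move=> cf; apply: (measurability _ (RGenOpens.measurableE R)).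
move=> _ [_ [a [b ->] <-]]; rewrite setTI; apply: open_measurable_rV.
by apply: open_comp => // x _; exact: cf.
Qed.

Lemma measurable_rV_norm : measurable_fun setT (fun x : 'rV[R]_n => `|x|).
Proof. by apply: continuous_measurable_rV; exact: norm_continuous. Qed.

End row_vectors.

Section affine_change_of_variables.
Context {R : realType}.

(** Lebesgue measure is characterised by its values on half-open intervals, so the equality of the
    two measures only has to be checked there. *)
Lemma lebesgue_measure_affine (a z : R) (A : set (measurableTypeR R)) :
  0 < a -> measurable A ->
  lebesgue_measure A =
  (a%:E * pushforward lebesgue_measure (fun x : measurableTypeR R => a * x + z)%R A)%E.
Proof.
move=> a0 mA.
have mf : @measurable_fun _ _ (measurableTypeR R) (measurableTypeR R) setT
    (fun x : measurableTypeR R => a * x + z).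
  by apply: measurable_funD => //; apply: measurable_funM.
pose f := (fun x : measurableTypeR R => a * x + z : measurableTypeR R).
have a0' : 0 <= a by exact: ltW.
pose nu0 := mscale (NngNum a0') (pushforward (@lebesgue_measure R) f); pose nu := nu0 mf.
rewrite -[RHS]/(nu A); apply: lebesgue_measure_unique => // _ [[b c] _ <-].
transitivity (a%:E * lebesgue_measure (f @^-1` `]b, c]%classic))%E; last by [].
change (lebesgue_measure (`]b, c]%classic : set R) = (a%:E * lebesgue_measure (f @^-1` `]b, c]%classic))%E).
rewrite (_ : f @^-1` _ = `](b - z) / a, (c - z) / a]%classic); last first.
  apply/seteqP; split => x /=; rewrite !in_itv/= ltr_pdivrMr// ler_pdivlMr// mulrC;
  by rewrite ltrBlDr lerBrDr.
rewrite !lebesgue_measure_itv/= !lte_fin ltr_pM2r ?invr_gt0// ltrD2r.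
case: ifPn => _; last by rewrite mule0.
by rewrite -!EFinB -EFinM; congr EFin; field; rewrite gt_eqF.
Qed.

Lemma ge0_integral_affine (a z : R) (f : measurableTypeR R -> \bar R) : 0 < a ->
  measurable_fun setT f -> (forall x, 0 <= f x)%E ->
  (\int[lebesgue_measure]_x f x =
   a%:E * \int[lebesgue_measure]_x f ((a * x)%R + z)%R)%E.
Proof.
move=> a0 mf f0.
have mg : @measurable_fun _ _ (measurableTypeR R) (measurableTypeR R) setT
    (fun x : measurableTypeR R => a * x + z).
  by apply: measurable_funD => //; apply: measurable_funM.
pose g := (fun x : measurableTypeR R => a * x + z : measurableTypeR R).
have a0' : 0 <= a by exact: ltW.
pose nu0 := mscale (NngNum a0') (pushforward (@lebesgue_measure R) g); pose nu := nu0 mg.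
transitivity (\int[nu]_x f x)%E.
  apply: eq_measure_integral => A mA _; exact: lebesgue_measure_affine.
by rewrite ge0_integral_mscale// ge0_integral_pushforward.
Qed.

End affine_change_of_variables.

Section lebesgue_rV_theory.
Context {R : realType}.
Local Open Scope ereal_scope.

Lemma ge0_integral_rVS n (f : 'rV[R]_n.+1 -> \bar R) :
  measurable_fun setT f -> (forall x, 0 <= f x) ->
  \int[lebesgue_rV n.+1]_x f x =
  \int[lebesgue_measure]_t \int[lebesgue_rV n]_y f (rV_cons (t, y)).
Proof.
move=> mf f0.
have mc := @measurable_rV_cons R n.
rewrite [LHS](_ : _ = \int[pushforward (lebesgue_measure \x lebesgue_rV n) (@rV_cons R n)]_x f x)//.
rewrite ge0_integral_pushforward//.
rewrite preimage_setT fubini_tonelli1//.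
- exact: measurableT_comp.
- by move=> x /=.
Qed.

Lemma measurable_integral_rVS n (f : 'rV[R]_n.+1 -> \bar R) :
  measurable_fun setT f -> (forall x, 0 <= f x) ->
  measurable_fun setT (fun t : measurableTypeR R =>
    \int[lebesgue_rV n]_y f (rV_cons (t, y))).
Proof.
move=> mf f0.
apply: (@measurable_fun_fubini_tonelli_F _ _ (measurableTypeR R) 'rV[R]_n R
  (lebesgue_rV n) (fun z => f (rV_cons z))); last by [].
exact: measurableT_comp (@measurable_rV_cons R n).
Qed.

Lemma lebesgue_rVS_setX n (A : set R) (B : set 'rV[R]_n) :
  measurable A -> measurable B ->
  lebesgue_rV n.+1 (@rV_uncons R n @^-1` (A `*` B)) =
  lebesgue_measure A * lebesgue_rV n B.
Proof.
move=> mA mB; rewrite /= /lebesgue_rV_step /pushforward -comp_preimage.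
rewrite (_ : _ \o _ = id); last by apply/funext => x /=; rewrite rV_consK.
by rewrite preimage_id product_measure1E.
Qed.

(** Induction on the dimension, following the recursive construction of the measure: the first
    coordinate contributes a factor [a] by the one-dimensional formula, the others contribute
    [a ^+ n]. *)
Lemma ge0_integral_rV_affine n (a : R) (z : 'rV[R]_n) (f : 'rV[R]_n -> \bar R) :
  (0 < a)%R -> measurable_fun setT f -> (forall x, 0 <= f x) ->
  \int[lebesgue_rV n]_x f x =
  (a ^+ n)%:E * \int[lebesgue_rV n]_x f (a *: x + z)%R.
Proof.
move=> a0; elim: n => [|n IH] in z f *; move=> mf f0.
  rewrite /= !integral_dirac//; last first.
    apply: measurableT_comp => //; exact: measurable_affine.
  rewrite !diracE !in_setT ?expr0 !mul1e; congr f.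
  by apply/rowP => -[].
have maf m w := @measurable_affine R m a w.
rewrite ge0_integral_rVS// [in RHS]ge0_integral_rVS//; last exact: (measurableT_comp mf (maf _ z)).
pose w : 'rV[R]_n := \row_j z ord0 (lift ord0 j).
have E t y : (a *: rV_cons (t, y) + z = rV_cons (a * t + z ord0 ord0, a *: y + w))%R.
  apply: eq_rV => i; have [j ->|->] := unliftP ord0 i.
    by rewrite [RHS]rV_consS 2!mxE rV_consS /= !mxE.
  by rewrite [RHS]rV_cons0 2!mxE rV_cons0.
have mfc t : measurable_fun setT (fun y => f (rV_cons (t, y))).
  exact: measurableT_comp (measurableT_comp (@measurable_rV_cons R n) _).
have mF := measurable_integral_rVS mf f0.
rewrite (@ge0_integral_affine _ a (z ord0 ord0) _ a0 mF); last first.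
  by move=> t; apply: integral_ge0.
have E1 t : \int[lebesgue_rV n]_y f (rV_cons ((a * t + z ord0 ord0)%R, y)) =
    (a ^+ n)%:E * \int[lebesgue_rV n]_y f (a *: rV_cons (t, y) + z)%R.
  rewrite (IH w)//; congr (_ * _); apply: eq_integral => y _; congr f.
  by rewrite E.
under eq_integral do rewrite E1.
rewrite ge0_integralZl//; last 3 first.
- by apply: (@measurable_integral_rVS _ (fun x => f (a *: x + z)%R)) => //; exact: (measurableT_comp mf (maf _ z)).
- by move=> t _; apply: integral_ge0.
- by rewrite lee_fin exprn_ge0// ltW.
by rewrite muleA -EFinM exprS.
Qed.

Lemma lebesgue_rV_scale n (a : R) (A : set 'rV[R]_n) : (0 < a)%R -> measurable A ->
  lebesgue_rV n A = (a ^+ n)%:E * lebesgue_rV n ((fun x => a *: x)%R @^-1` A).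
Proof.
move=> a0 mA.
have ms : measurable_fun setT (fun x : 'rV[R]_n => a *: x)%R.
  have := @measurable_affine R n a 0%R.
  by apply: eq_measurable_fun => x _; rewrite addr0.
have mA' : measurable ((fun x : 'rV[R]_n => a *: x)%R @^-1` A).
  by rewrite -[X in measurable X]setTI; exact: ms.
have := @ge0_integral_rV_affine n a 0%R (EFin \o \1_A) a0.
rewrite integral_indic// setIT => ->//; last first.
- by move=> x; rewrite lee_fin.
- by apply/measurable_EFinP.
congr (_ * _).
rewrite (_ : (fun x => _) = (EFin \o \1_((fun x : 'rV[R]_n => a *: x)%R @^-1` A))).
  by rewrite integral_indic// setIT.
by apply/funext => x /=; rewrite addr0 !indicE.
Qed.

Lemma lebesgue_rV_ball_lty n (r : R) :
  lebesgue_rV n [set x : 'rV[R]_n | (`|x| < r)%R] < +oo.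
Proof.
have [r0|r0] := leP r 0%R.
  rewrite (_ : mkset _ = set0) ?measure0 ?ltry//.
  by apply/seteqP; split => // x /= /lt_le_trans/(_ r0); rewrite normr_lt0.
elim: n => [|n IH].
  by rewrite /= diracE; case: (_ \in _); rewrite ltry.
rewrite (@le_lt_trans _ _ (lebesgue_rV n.+1 (@rV_uncons R n @^-1` (`](-r)%R, r[%classic `*` [set x | (`|x| < r)%R]))))//.
  apply: le_measure; rewrite ?inE; first exact: measurable_rV_ball.
    rewrite -[X in measurable X]setTI; apply: measurable_rV_uncons => //.
    by apply: measurableX => //; exact: measurable_rV_ball.
  move=> x /= xr; split => /=.
    by rewrite in_itv/= -ltr_norml (le_lt_trans (le_coord_norm _ _)).
  apply: rV_norm_ltP => // i; rewrite mxE.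
  by rewrite (le_lt_trans (le_coord_norm _ _)).
rewrite lebesgue_rVS_setX//; last exact: measurable_rV_ball.
apply: lte_mul_pinfty => //.
  by rewrite lebesgue_measure_itv/=; case: ifPn => //; rewrite -EFinD.
Qed.

Lemma lebesgue_rV_ball1_gt0 n : 0 < lebesgue_rV n [set x : 'rV[R]_n | (`|x| < 1)%R].
Proof.
elim: n => [|n IH].
  rewrite /= diracE mem_set//=.
  by rewrite normr0.
rewrite (@lt_le_trans _ _ (lebesgue_rV n.+1 (@rV_uncons R n @^-1` (`](-1)%R, 1%R[%classic `*` [set x | (`|x| < 1)%R]))))//.
  rewrite lebesgue_rVS_setX//; last exact: measurable_rV_ball.
  apply: mule_gt0 => //.
  rewrite lebesgue_measure_itv/= lte_fin ifT; last by rewrite (lt_trans (_ : _ < 0)%R)// oppr_lt0.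
  by rewrite -EFinD lte_fin opprK addr_gt0.
apply: le_measure; rewrite ?inE; last 2 first.
- exact: measurable_rV_ball.
- move=> x /= []; rewrite in_itv/= -ltr_norml => x1 x2.
  apply: rV_norm_ltP => // i; have [j ->|->] := unliftP ord0 i => //.
  by apply: le_lt_trans x2; have := le_coord_norm (\row_j x ord0 (lift ord0 j)) j; rewrite mxE.
- rewrite -[X in measurable X]setTI; apply: measurable_rV_uncons => //.
  by apply: measurableX => //; exact: measurable_rV_ball.
Qed.

Lemma open_rV_neq0 n : open [set x : 'rV[R]_n | (x != 0 :> 'rV[R]_n)%R].
Proof.
rewrite (_ : mkset _ = ~` [set (0%R : 'rV[R]_n)]); last first.
  by apply/seteqP; split => x /= /eqP.
apply: closed_openC; apply: accessible_closed_set1.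
exact/hausdorff_accessible/norm_hausdorff.
Qed.

Lemma measurable_rV_set0 n : measurable [set (0%R : 'rV[R]_n)].
Proof.
rewrite (_ : [set _] = ~` [set x | (x != 0 :> 'rV[R]_n)%R]); last first.
  apply/seteqP; split => x /=; first by move=> ->; rewrite eqxx.
  by move/negP; rewrite negbK => /eqP.
by apply: measurableC; apply: open_measurable_rV; exact: open_rV_neq0.
Qed.

(** The set is invariant under doubling, which multiplies the measure by [2 ^+ n]; a finite number
    equal to [2 ^+ n] times itself is 0 when [n] is positive. *)
Lemma lebesgue_rV_set0 n : (0 < n)%N -> lebesgue_rV n [set (0%R : 'rV[R]_n)] = 0.
Proof.
move=> n0; have m0 := @measurable_rV_set0 n.
have := @lebesgue_rV_scale n 2%R [set (0%R : 'rV[R]_n)] (ltr0Sn _ _) m0.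
rewrite (_ : (fun x => _) @^-1` _ = [set 0%R]); last first.
  apply/seteqP; split => x /=; last by move=> ->; rewrite scaler0.
  by move/eqP; rewrite scaler_eq0 pnatr_eq0 /= => /eqP.
have fin : lebesgue_rV n [set (0%R : 'rV[R]_n)] \is a fin_num.
  rewrite ge0_fin_numE//; apply: le_lt_trans (@lebesgue_rV_ball_lty n 1).
  apply: le_measure; rewrite ?inE//; first exact: measurable_rV_ball.
  by move=> x /= ->; rewrite normr0.
rewrite -(fineK fin) -EFinM => /(congr1 fine) /=.
set m := fine _ => mE; congr EFin; apply/eqP.
have : ((2 ^+ n - 1) * m = 0)%R by rewrite mulrBl mul1r -mE subrr.
move/eqP; rewrite mulf_eq0 => /orP[|//].
rewrite subr_eq0 => /eqP e; have : (1 < 2 ^+ n :> R)%R by rewrite exprn_egt1// ?ltr1n -?lt0n.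
by rewrite e ltxx.
Qed.

Lemma ae_neq0 n : (0 < n)%N -> {ae lebesgue_rV n, forall x : 'rV[R]_n, (x != 0 :> 'rV[R]_n)%R}.
Proof.
move=> n0; exists [set (0%R : 'rV[R]_n)]; split.
- exact: measurable_rV_set0.
- exact: lebesgue_rV_set0.
- by move=> x /= /negP; rewrite negbK => /eqP.
Qed.

End lebesgue_rV_theory.

(** * Partial derivatives and test functions *)

Section smooth_functions.
Context {R : realType} {N : nat}.
Local Notation E := 'rV[R]_N.
Implicit Types (f g : E -> R) (x y v : E) (Omega : set E) (i : 'I_N).

Definition pd i f : E -> R := fun x => 'D_(delta_mx ord0 i) f x.

Definition C1_at x f :=
  {for x, continuous f} /\ forall i, derivable f x (delta_mx ord0 i).

(** [dpart] adds the next derivative on the outside, whereas this recursion takes off the innermost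
    one. In this form the sum, product and inverse rules propagate by induction on [k] from the
    formula for a single [pd i]. *)
Fixpoint Ck_on k Omega f : Prop :=
  (forall x, Omega x -> C1_at x f) /\
  if k is k'.+1 then forall i, Ck_on k' Omega (pd i f) else True.

Lemma Ck_onW k Omega f : Ck_on k.+1 Omega f -> Ck_on k Omega f.
Proof.
elim: k f => [|k IH] f; first by move=> [].
by move=> [f1 f2]; split => // i; apply: IH; exact: f2.
Qed.

Lemma dpart_rcons (s : seq 'I_N) i f : dpart (rcons s i) f = dpart s (pd i f).
Proof. by elim: s => //= j s ->. Qed.

Lemma smooth_onP Omega f : smooth_on Omega f <-> forall k, Ck_on k Omega f.
Proof.
split=> [sf k|Cf s].
  elim: k f sf => [|k IH] f sf; first by split; [move=> x Ox; exact: (sf [::] x Ox)|].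
  split; first by move=> x Ox; exact: (sf [::] x Ox).
  by move=> i; apply: IH => s x Ox; have := sf (rcons s i) x Ox; rewrite dpart_rcons.
elim/last_ind: s f Cf => [|s i IH] f Cf x Ox; first by have [/(_ x Ox)] := Cf 0%N.
by rewrite dpart_rcons; apply: IH => // k; have [_] := Cf k.+1; exact.
Qed.

Lemma near_eq_C1_at x f g : {near x, f =1 g} -> C1_at x f -> C1_at x g.
Proof.
move=> fg [cf df]; split.
  rewrite /prop_for /continuous_at -(nbhs_singleton fg).
  exact: cvg_trans (near_eq_cvg fg) cf.
by move=> i; apply: near_eq_derivable (df i).
Qed.

Lemma near_eq_pd x f g i : {near x, f =1 g} -> pd i f x = pd i g x.
Proof. exact: near_eq_derive. Qed.

Lemma eq_on_near Omega f g x : open Omega -> (forall x, Omega x -> f x = g x) ->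
  Omega x -> {near x, f =1 g}.
Proof.
move=> oO fg Ox; near=> y; apply: fg; near: y.
exact: open_nbhs_nbhs.
Unshelve. all: by end_near. Qed.

Lemma eq_Ck_on k Omega f g : open Omega -> (forall x, Omega x -> f x = g x) ->
  Ck_on k Omega f -> Ck_on k Omega g.
Proof.
move=> oO; elim: k f g => [|k IH] f g fg [f1 f2].
  by split; [move=> x Ox; apply: near_eq_C1_at (f1 x Ox); exact: eq_on_near fg Ox|].
split=> [x Ox|i].
  by apply: near_eq_C1_at (f1 x Ox); exact: eq_on_near fg Ox.
apply: IH (f2 i) => x Ox; apply: near_eq_pd; exact: eq_on_near fg Ox.
Qed.

Lemma eq_smooth_on Omega f g : open Omega -> (forall x, Omega x -> f x = g x) ->
  smooth_on Omega f -> smooth_on Omega g.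
Proof.
by move=> oO fg /smooth_onP sf; apply/smooth_onP => k; exact: eq_Ck_on (sf k).
Qed.

Lemma smooth_on_pd Omega f i : smooth_on Omega f -> smooth_on Omega (pd i f).
Proof. by move=> /smooth_onP sf; apply/smooth_onP => k; have [_] := sf k.+1; exact. Qed.

Lemma smooth_onS Omega Omega' f : Omega `<=` Omega' ->
  smooth_on Omega' f -> smooth_on Omega f.
Proof. by move=> OO sf s x /OO; exact: sf. Qed.

Lemma smooth_on_C1 Omega f x : smooth_on Omega f -> Omega x -> C1_at x f.
Proof. by move=> sf Ox; exact: (sf [::] x Ox). Qed.

Lemma smooth_continuous f : smooth_on setT f -> continuous f.
Proof. by move=> sf x; exact: (sf [::] x I).1. Qed.

Lemma C1_atD x f g : C1_at x f -> C1_at x g -> C1_at x (fun y => f y + g y).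
Proof.
move=> [cf df] [cg dg]; split; first exact: (continuousD cf cg).
by move=> i; exact: (@derivableD _ _ _ f g).
Qed.

Lemma pdD x f g i : C1_at x f -> C1_at x g ->
  pd i (fun y => f y + g y) x = pd i f x + pd i g x.
Proof. by move=> [cf df] [cg dg]; exact: (@deriveD _ _ _ f g). Qed.

Lemma C1_atM x f g : C1_at x f -> C1_at x g -> C1_at x (fun y => f y * g y).
Proof.
move=> [cf df] [cg dg]; split; first exact: (continuousM cf cg).
by move=> i; exact: (@derivableM _ _ f g).
Qed.

Lemma pdM x f g i : C1_at x f -> C1_at x g ->
  pd i (fun y => f y * g y) x = pd i f x * g x + f x * pd i g x.
Proof.
move=> [cf df] [cg dg]; rewrite /pd (@deriveM _ _ f g x _ (df i) (dg i)).
by rewrite addrC; congr (_ + _); rewrite /GRing.scale /= mulrC.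
Qed.

Lemma C1_atV x f : f x != 0 -> C1_at x f -> C1_at x (fun y => (f y)^-1).
Proof.
move=> fx0 [cf df]; split; first exact: (continuousV fx0 cf).
by move=> i; exact: (@derivableV _ _ f).
Qed.

Lemma pdV x f i : f x != 0 -> C1_at x f ->
  pd i (fun y => (f y)^-1) x = - pd i f x * ((f x)^-1 * (f x)^-1).
Proof.
move=> fx0 [cf df]; rewrite /pd (@deriveV _ _ f x _ fx0 (df i)).
by rewrite /GRing.scale /= -exprVn expr2 mulNr mulNr mulrC.
Qed.

Lemma pd_cst (c : R) i x : pd i (fun=> c) x = 0.
Proof. exact: derive_cst. Qed.

Lemma C1_at_cst (c : R) x : C1_at x (fun=> c).
Proof. by split; [exact: cst_continuous|move=> i; exact: derivable_cst]. Qed.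

Lemma Ck_on_cst k Omega (c : R) : Ck_on k Omega (fun=> c).
Proof.
elim: k c => [|k IH] c; first by split; [move=> x _; exact: C1_at_cst|].
split=> [x _|i]; first exact: C1_at_cst.
by rewrite (_ : pd _ _ = fun=> 0)//; apply/funext => x; exact: pd_cst.
Qed.

Lemma Ck_onD k Omega f g : open Omega ->
  Ck_on k Omega f -> Ck_on k Omega g -> Ck_on k Omega (fun y => f y + g y).
Proof.
move=> oO; elim: k f g => [|k IH] f g [f1 f2] [g1 g2].
  by split; [move=> x Ox; apply: C1_atD; [exact: f1|exact: g1]|].
split=> [x Ox|i]; first by apply: C1_atD; [exact: f1|exact: g1].
apply: (@eq_Ck_on _ _ (fun x => pd i f x + pd i g x)) ; first by [].
  by move=> x Ox; rewrite pdD//; [exact: f1|exact: g1].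
exact: IH (f2 i) (g2 i).
Qed.

Lemma Ck_onM k Omega f g : open Omega ->
  Ck_on k Omega f -> Ck_on k Omega g -> Ck_on k Omega (fun y => f y * g y).
Proof.
move=> oO; elim: k f g => [|k IH] f g [f1 f2] [g1 g2].
  by split; [move=> x Ox; apply: C1_atM; [exact: f1|exact: g1]|].
split=> [x Ox|i]; first by apply: C1_atM; [exact: f1|exact: g1].
apply: (@eq_Ck_on _ _ (fun x => pd i f x * g x + f x * pd i g x)) ; first by [].
  by move=> x Ox; rewrite pdM//; [exact: f1|exact: g1].
by apply: Ck_onD oO (IH _ _ (f2 i) (Ck_onW (conj g1 g2))) (IH _ _ (Ck_onW (conj f1 f2)) (g2 i)).
Qed.

Lemma Ck_onV k Omega f : open Omega -> (forall x, Omega x -> f x != 0) ->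
  Ck_on k Omega f -> Ck_on k Omega (fun y => (f y)^-1).
Proof.
move=> oO f0; elim: k f f0 => [|k IH] f f0 [f1 f2].
  by split; [move=> x Ox; apply: C1_atV; [exact: f0|exact: f1]|].
split=> [x Ox|i]; first by apply: C1_atV; [exact: f0|exact: f1].
apply: (@eq_Ck_on _ _ (fun x => -1 * pd i f x * ((f x)^-1 * (f x)^-1))) ; first by [].
  by move=> x Ox; rewrite pdV ?mulN1r//; [exact: f0|exact: f1].
have Vk : Ck_on k Omega (fun y => (f y)^-1) by exact: IH _ f0 (Ck_onW (conj f1 f2)).
exact: Ck_onM oO (Ck_onM oO (Ck_on_cst _ _ _) (f2 i)) (Ck_onM oO Vk Vk).
Qed.

Lemma smooth_on_cst Omega (c : R) : smooth_on Omega (fun=> c).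
Proof. by apply/smooth_onP => k; exact: Ck_on_cst. Qed.

Lemma smooth_onD Omega f g : open Omega -> smooth_on Omega f -> smooth_on Omega g ->
  smooth_on Omega (fun y => f y + g y).
Proof.
by move=> oO /smooth_onP sf /smooth_onP sg; apply/smooth_onP => k; exact: Ck_onD.
Qed.

Lemma smooth_onM Omega f g : open Omega -> smooth_on Omega f -> smooth_on Omega g ->
  smooth_on Omega (fun y => f y * g y).
Proof.
by move=> oO /smooth_onP sf /smooth_onP sg; apply/smooth_onP => k; exact: Ck_onM.
Qed.

Lemma smooth_onV Omega f : open Omega -> (forall x, Omega x -> f x != 0) ->
  smooth_on Omega f -> smooth_on Omega (fun y => (f y)^-1).
Proof. by move=> oO f0 /smooth_onP sf; apply/smooth_onP => k; exact: Ck_onV. Qed.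

Lemma smooth_onU Omega Omega' f : smooth_on Omega f -> smooth_on Omega' f ->
  smooth_on (Omega `|` Omega') f.
Proof. by move=> sf sf' s x [/sf|/sf']; exact. Qed.

(** Both difference quotients are the same function of the increment. This gives directional
    derivatives access to the one-variable tools: mean value theorem and chain rule. *)
Lemma is_derive_line f y v (t d : R) :
  is_derive (y + t *: v) v f d <-> is_derive t 1 (fun s => f (y + s *: v)) d.
Proof.
have E : (fun h => h^-1 *: ((f \o shift (y + t *: v)) (h *: v) - f (y + t *: v))) =
    (fun h => h^-1 *: (((fun s => f (y + s *: v)) \o shift t) (h *: (1 : R)) - f (y + t *: v))).
  apply/funext => h /=; congr (_ *: (f _ - _)).
  have -> : h *: (1 : R) = h by exact: mulr1.
  by rewrite scalerDl addrC -addrA [t *: v + _]addrC.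
split=> -[dv ev]; apply: DeriveDef.
- by move: dv; rewrite /derivable E.
- by move: ev; rewrite /derive E.
- by move: dv; rewrite /derivable E.
- by move: ev; rewrite /derive E.
Qed.

End smooth_functions.

Section directional_derivatives.
Context {R : realType} {N : nat}.
Local Notation E := 'rV[R]_N.
Implicit Types (f g : E -> R) (x y v : E) (i : 'I_N).
Local Notation e i := (delta_mx ord0 i : E).

Lemma norm_delta_mx i : `|e i| <= 1.
Proof.
by apply: rV_norm_leP => // j; rewrite mxE eqxx/=; case: eqP => _; rewrite ?normr1 ?normr0.
Qed.

Lemma is_derive_pd f x i : smooth_on setT f -> is_derive x (e i) f (pd i f x).
Proof. by move=> sf; apply: DeriveDef; [exact: (sf [::] x I).2|]. Qed.

Lemma smooth_mvt f y i (t : R) : smooth_on setT f ->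
  exists2 s : R, `|s| <= `|t| & f (y + t *: e i) - f y = t * pd i f (y + s *: e i).
Proof.
move=> sf.
have D (s : R) : is_derive s 1 (fun s => f (y + s *: e i)) (pd i f (y + s *: e i)).
  by apply/is_derive_line; exact: is_derive_pd.
have C a b : {within `[a, b], continuous (fun s : R => f (y + s *: e i))}.
  by apply: derivable_within_continuous => s _; exact: (@ex_derive _ _ _ _ _ _ _ (D s)).
have [t0|t0] := leP 0 t.
  have [c] := @MVT_segment _ _ (fun s => pd i f (y + s *: e i)) 0 t t0 (fun s _ => D s) (C _ _).
  rewrite in_itv/= => /andP[c0 ct]; rewrite scale0r addr0 subr0 mulrC => ->.
  by exists c => //; rewrite !ger0_norm.
have [c] := @MVT_segment _ _ (fun s => pd i f (y + s *: e i)) t 0 (ltW t0) (fun s _ => D s) (C _ _).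
rewrite in_itv/= => /andP[ct c0]; rewrite scale0r addr0 sub0r mulrN => fE.
exists c; first by rewrite ler0_norm// ltr0_norm// lerN2.
by rewrite -opprB fE opprK mulrC.
Qed.

(** Moving by [h *: v] and then by [h * c] along one coordinate splits the quotient in two: one part
    tends to the given derivative, the other is by the mean value theorem [c] times a partial
    derivative at a point tending to [x]. Adding coordinates one at a time gives [is_derive_dir]
    without Frechet differentiability. *)
Lemma is_derive_add_coord f x v (c d : R) i : smooth_on setT f ->
  is_derive x v f d -> is_derive x (c *: e i + v) f (c * pd i f x + d).
Proof.
move=> sf [dv ev].
have lim1 : (fun h => h^-1 *: ((f \o shift x) (h *: v) - f x)) @ 0^' --> d.
  by rewrite -ev; exact: dv.
have lim2 : (fun h => h^-1 *: (f (h *: v + x + (h * c) *: e i) - f (h *: v + x)))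
    @ 0^' --> c * pd i f x.
  apply/cvgrPdist_le => eps eps0.
  have cp : continuous (pd i f) by apply: smooth_continuous; exact: smooth_on_pd.
  have c1 : 0 < `|c| + 1 by rewrite ltr_wpDl.
  have [del /= del0 H] : nbhs_ball x [set y | `|pd i f x - pd i f y| <= eps / (`|c| + 1)].
    apply/nbhs_ballP; have /cvgrPdist_le := cp x; apply.
    by rewrite divr_gt0.
  have v1 : 0 < `|v| + `|c| + 1 by rewrite ltr_wpDl// addr_ge0.
  (* The intermediate point of the mean value theorem lies within |h| (|v| + |c|) of [x]; the added
     1 keeps the divisor positive. *)
  exists (del / (`|v| + `|c| + 1)) => /=; first by rewrite divr_gt0.
  move=> h /=; rewrite sub0r normrN => hdel h0.
  have [s sh ->] := smooth_mvt (h *: v + x) i (h * c) sf.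
  rewrite /GRing.scale /= -mulrA mulKf// -mulrBr normrM.
  have : `|pd i f x - pd i f (h *: v + x + s *: e i)| <= eps / (`|c| + 1).
    apply: H; rewrite -ball_normE /=.
    rewrite [h *: v + x]addrC -addrA opprD addNKr normrN.
    apply: le_lt_trans (ler_normD _ _) _; rewrite !normrZ.
    apply: (@le_lt_trans _ _ (`|h| * (`|v| + `|c| + 1))); last by rewrite -ltr_pdivlMr.
    rewrite mulrDr mulrDr mulr1 -addrA lerD2l.
    apply: le_trans (_ : `|h| * `|c| <= _); last by rewrite lerDl.
    rewrite -normrM; apply: le_trans sh.
    by rewrite ler_piMr// norm_delta_mx.
  move=> /(ler_wpM2l (normr_ge0 c)) /le_trans; apply.
  rewrite mulrCA ler_piMr// ?(ltW eps0)// ler_pdivrMr// mul1r lerDl//.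
have : (fun h => h^-1 *: ((f \o shift x) (h *: (c *: e i + v)) - f x)) @ 0^' --> c * pd i f x + d.
  rewrite (_ : (fun h => _) = (fun h => h^-1 *: (f (h *: v + x + (h * c) *: e i) - f (h *: v + x)) +
      h^-1 *: ((f \o shift x) (h *: v) - f x))); first exact: cvgD.
  apply/funext => h /=; rewrite -scalerDr addrA subrK; congr (_ *: (f _ - _)).
  by rewrite /shift /= scalerDr scalerA -addrA addrC.
move=> lim3; apply: DeriveDef.
- by apply/cvg_ex; exists (c * pd i f x + d).
- by rewrite /derive; apply/cvg_lim.
Qed.

Lemma row_sum_coord v : v = \sum_i v ord0 i *: e i.
Proof. exact: row_sum_delta. Qed.

Lemma is_derive_dir f x v : smooth_on setT f ->
  is_derive x v f (\sum_i v ord0 i * pd i f x).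
Proof.
move=> sf; rewrite {1}[v]row_sum_coord.
elim: (index_enum _) => [|i s IH]; first by rewrite !big_nil; exact: is_derive0.
by rewrite !big_cons; exact: is_derive_add_coord.
Qed.

Lemma is_derive_segment f y v (t : R) : smooth_on setT f ->
  is_derive t 1 (fun s => f (y + s *: v)) (\sum_i v ord0 i * pd i f (y + t *: v)).
Proof. by move=> sf; apply/is_derive_line; exact: is_derive_dir. Qed.

Lemma C1_at_comp_affine f (a : R) z x : smooth_on setT f ->
  C1_at x (fun y => f (a *: y + z)) /\
  forall i, pd i (fun y => f (a *: y + z)) x = a * pd i f (a *: x + z).
Proof.
move=> sf.
have D j : is_derive x (e j) (fun y => f (a *: y + z)) (a * pd j f (a *: x + z)).
  have := is_derive_segment (a *: x + z) (a *: e j) 0 sf.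
  rewrite scale0r addr0 (bigD1 j)//= big1 ?addr0; last first.
    by move=> k kj; rewrite !mxE eqxx /= (negbTE kj) mulr0 mul0r.
  rewrite !mxE !eqxx /= mulr1 => D0.
  have : is_derive (x + 0 *: e j) (e j) (fun y => f (a *: y + z)) (a * pd j f (a *: x + z)).
    apply/is_derive_line; move: D0; congr (is_derive _ _ _ _).
    by apply/funext => s /=; rewrite scalerDr addrAC !scalerA [s * a]mulrC.
  by rewrite scale0r addr0.
split; last by move=> i; have [_] := D i.
split; last by move=> j; have [] := D j.
apply: (@continuous_comp _ _ _ (fun y => a *: y + z) f); last exact: smooth_continuous sf _.
exact: continuousD (@scaler_continuous _ _ a x) (@cst_continuous _ _ z x).
Qed.

Lemma Ck_on_comp_affine k f (a : R) z : smooth_on setT f ->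
  Ck_on k setT (fun y => f (a *: y + z)).
Proof.
elim: k f => [|k IH] f sf.
  by split; [move=> x _; exact: (C1_at_comp_affine a z x sf).1|].
split=> [x _|i]; first exact: (C1_at_comp_affine a z x sf).1.
rewrite (_ : pd i _ = fun x => a * pd i f (a *: x + z)).
  apply: Ck_onM; [exact: openT|exact: Ck_on_cst|].
  by apply: IH; exact: smooth_on_pd.
by apply/funext => x; rewrite (C1_at_comp_affine a z x sf).2.
Qed.

Lemma smooth_comp_affine f (a : R) z : smooth_on setT f ->
  smooth_on setT (fun y => f (a *: y + z)).
Proof. by move=> sf; apply/smooth_onP => k; exact: Ck_on_comp_affine. Qed.

Lemma is_derive_coord x i j : is_derive x (e i) (fun y => y ord0 j) (i == j)%:R.
Proof.
have D : (fun h => h^-1 *: (((fun y : E => y ord0 j) \o shift x) (h *: e i) - x ord0 j)) @ 0^' --> ((i == j)%:R : R).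
  apply: cvg_near_cst; near=> h.
  rewrite /= /shift !mxE addrK eqxx /= [j == i]eq_sym.
  rewrite /GRing.scale /= mulKf//; near: h; exact: nbhs_dnbhs_neq.
by apply: DeriveDef; [apply/cvg_ex; exists (i == j)%:R|exact/cvg_lim].
Unshelve. all: by end_near. Qed.

Lemma C1_at_coord x j : C1_at x (fun y => y ord0 j).
Proof.
split; first exact: coord_continuous.
by move=> i; exact: (@ex_derive _ _ _ _ _ _ _ (is_derive_coord x i j)).
Qed.

Lemma pd_coord i j x : pd i (fun y => y ord0 j) x = (i == j)%:R.
Proof. exact: (@derive_val _ _ _ _ _ _ _ (is_derive_coord x i j)). Qed.

Lemma smooth_coord j : smooth_on setT (fun y : E => y ord0 j).
Proof.
apply/smooth_onP => -[|k]; first by split; [move=> x _; exact: C1_at_coord|].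
split=> [x _|i]; first exact: C1_at_coord.
rewrite (_ : pd i _ = fun=> (i == j)%:R); first exact: Ck_on_cst.
by apply/funext => x; rewrite pd_coord.
Qed.

End directional_derivatives.

Section test_functions.
Context {R : realType} {N : nat}.
Local Notation E := 'rV[R]_N.
Implicit Types (f g : E -> R) (x y v : E) (i : 'I_N).

Definition rtest f :=
  smooth_on setT f /\ exists r : R, forall x, r <= `|x| -> f x = 0.

(** Vanishing near the origin is what makes the product with a function smooth only off the origin a
    test function again. *)
Definition rtest0 f :=
  rtest f /\ exists2 e : R, 0 < e & forall x, `|x| < e -> f x = 0.

Lemma rtest_smooth f : rtest f -> smooth_on setT f. Proof. by case. Qed.

Lemma rtest_continuous f : rtest f -> continuous f.
Proof. by move=> /rtest_smooth; exact: smooth_continuous. Qed.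

Lemma rtestM f g : smooth_on setT f -> rtest g -> rtest (fun x => f x * g x).
Proof.
move=> sf [sg [r gr]]; split; first by apply: smooth_onM => //; exact: openT.
by exists r => x /gr ->; rewrite mulr0.
Qed.

Lemma rtest0M f g : smooth_on setT f -> rtest0 g -> rtest0 (fun x => f x * g x).
Proof.
move=> sf [tg [e e0 ge]]; split; first exact: rtestM.
by exists e => // x /ge ->; rewrite mulr0.
Qed.

Lemma rtestD f g : rtest f -> rtest g -> rtest (fun x => f x + g x).
Proof.
move=> [sf [r fr]] [sg [s gs]]; split; first by apply: smooth_onD => //; exact: openT.
exists (Num.max r s) => x; rewrite ge_max => /andP[/fr -> /gs ->].
by rewrite addr0.
Qed.

Lemma rtest_eq0_near f x : (exists2 e, 0 < e & forall y, `|x - y| < e -> f y = 0) ->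
  forall i, pd i f x = 0.
Proof.
move=> [e e0 fe] i; rewrite (@near_eq_pd _ _ x f (fun=> 0)) ?pd_cst//.
by apply/nbhs_ballP; exists e => // y /=; rewrite -ball_normE /= => /fe.
Qed.

Lemma rtest_pd f i : rtest f -> rtest (pd i f).
Proof.
move=> [sf [r fr]]; split; first exact: smooth_on_pd.
exists (r + 1) => x xr; apply: rtest_eq0_near; exists 1 => // y xy; apply: fr.
rewrite -(@lerD2r _ 1); apply: le_trans xr _.
by rewrite -lerBlDl (le_trans (lerB_dist _ _))// ltW.
Qed.

Lemma rtest0_pd f i : rtest0 f -> rtest0 (pd i f).
Proof.
move=> [tf [e e0 fe]]; split; first exact: rtest_pd.
exists (e / 2); first by rewrite divr_gt0.
move=> x xe; apply: rtest_eq0_near; exists (e / 2); first by rewrite divr_gt0.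
move=> y xy; apply: fe; rewrite -(subrK x y) (splitr e).
by apply: le_lt_trans (ler_normD _ _) _; apply: ltrD => //; rewrite distrC.
Qed.

Lemma rtest_affine f (a : R) z : 0 < a -> rtest f -> rtest (fun x => f (a *: x + z)).
Proof.
move=> a0 [sf [r fr]]; split; first exact: smooth_comp_affine.
exists ((r + `|z|) / a) => x; rewrite ler_pdivrMr// => xr; apply: fr.
rewrite -(@lerD2r _ `|z|) (le_trans xr)//.
rewrite mulrC -{1}(ger0_norm (ltW a0)) -normrZ -[X in `|X|](addrK z).
exact: ler_normB.
Qed.

Lemma rtest_scale f (a : R) : 0 < a -> rtest f -> rtest (fun x => f (a *: x)).
Proof.
move=> a0 tf; have := rtest_affine 0 a0 tf.
by congr rtest; apply/funext => x; rewrite addr0.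
Qed.

Lemma rtest0_scale f (a : R) : 0 < a -> rtest0 f -> rtest0 (fun x => f (a *: x)).
Proof.
move=> a0 [tf [e e0 fe]]; split.
  by have := rtest_affine 0 a0 tf; congr rtest; apply/funext => x; rewrite addr0.
exists (e / a); first by rewrite divr_gt0.
move=> x; rewrite ltr_pdivlMr// => xe; apply: fe.
by rewrite normrZ ger0_norm ?(ltW a0)// mulrC.
Qed.

(** Smoothness is checked on two open sets covering the space: on a ball around the origin the
    product is identically 0, off the origin both factors are smooth. *)
Lemma rtest0_mul_smooth f g : smooth_on [set x | x != 0] f -> rtest0 g ->
  rtest0 (fun x => f x * g x).
Proof.
move=> sf [[sg [r gr]] [e e0 ge]]; split; last by exists e => // x /ge ->; rewrite mulr0.
split; last by exists r => x /gr ->; rewrite mulr0.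
have op : open [set x : E | `|x| < e].
  rewrite (_ : mkset _ = [set x : E | ball 0 e x]); first exact: ball_open.
  by apply/seteqP; split => x; rewrite -ball_normE /= sub0r normrN.
have s1 : smooth_on [set x : E | `|x| < e] (fun x => f x * g x).
  apply: (@eq_smooth_on _ _ _ (fun=> 0)) => //; last exact: smooth_on_cst.
  by move=> x /= /ge ->; rewrite mulr0.
have s2 : smooth_on [set x : E | x != 0] (fun x => f x * g x).
  by apply: smooth_onM => //; [exact: open_rV_neq0|apply: smooth_onS sg].
apply: smooth_onS (smooth_onU s1 s2) => x _ /=.
by have [->|x0] := eqVneq x 0; [left; rewrite normr0|right].
Qed.

Lemma bounded_support_bounded f : continuous f ->
  (exists r : R, forall x, r <= `|x| -> f x = 0) ->
  exists2 C : R, 0 <= C & forall x, `|f x| <= C.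
Proof.
move=> cf [r fr].
pose K := [set x : E | `|x| <= Num.max r 0].
have cK : compact K.
  apply: bounded_closed_compact.
    exists (Num.max r 0); split; first exact: num_real.
    by move=> M rM x /= xK; apply: le_trans xK _; exact: ltW.
  apply: (@closed_comp _ _ (fun x : E => `|x|) [set t | t <= Num.max r 0]).
    by move=> x _; exact: norm_continuous.
  exact: closed_le.
have cF : {within K, continuous (fun x => `|f x|)}.
  apply: continuous_subspaceT => x.
  by apply: (@continuous_comp _ _ _ f); [exact: cf|exact: norm_continuous].
have [c Kc cM] := @EVT_max_rV R N (fun x => `|f x|) K ltac:(by exists 0; rewrite /K /= normr0 le_max lexx orbT) cK cF.
exists `|f c| => // x; have [xK|xK] := leP `|x| (Num.max r 0).
  by apply: cM; rewrite inE.
by rewrite fr ?normr0// (le_trans _ (ltW xK))// le_max lexx.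
Qed.

Lemma rtest_bounded f : rtest f -> exists2 C : R, 0 <= C & forall x, `|f x| <= C.
Proof. by move=> tf; apply: bounded_support_bounded; [exact: rtest_continuous|exact: tf.2]. Qed.

Lemma rtest_lipschitz f : rtest f ->
  exists2 C : R, 0 <= C & forall x h, `|f (x + h) - f x| <= C * `|h|.
Proof.
move=> tf; have /choice[c cP] : forall i, exists C : R, 0 <= C /\ forall x, `|pd i f x| <= C.
  by move=> i; have [C C0 CP] := rtest_bounded (rtest_pd i tf); exists C.
exists (\sum_i c i); first by apply: sumr_ge0 => i _; have [] := cP i.
move=> x h.
have D (s : R) := is_derive_segment x h s (rtest_smooth tf).
have C : {within `[(0:R), 1], continuous (fun s : R => f (x + s *: h))}.
  by apply: derivable_within_continuous => s _; exact: (@ex_derive _ _ _ _ _ _ _ (D s)).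
have [s _] := @MVT_segment _ _ _ 0 1 ler01 (fun s _ => D s) C.
rewrite scale1r scale0r addr0 subr0 mulr1 => ->.
apply: le_trans (ler_norm_sum _ _ _) _; rewrite mulr_suml; apply: ler_sum => i _.
rewrite normrM mulrC; apply: ler_pM => //; last exact: le_coord_norm.
by have [_] := cP i.
Qed.

End test_functions.

(** * Local integrability and the fundamental lemma *)

Section integrability.
Context {R : realType} {N : nat}.
Local Notation E := 'rV[R]_N.
Local Notation mu := (lebesgue_rV N : {sigma_finite_measure set E -> \bar R}).
Implicit Types (u v f g : E -> R) (x y z : E).

Definition locint u := measurable_fun setT u /\
  forall r : R, mu.-integrable [set x | `|x| < r] (EFin \o u).

Definition Lpr (p : R) u := measurable_fun setT u /\
  (\int[mu]_x (`|u x| `^ p)%:E < +oo)%E.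

Lemma integrable_abs_lty u : measurable_fun setT u ->
  mu.-integrable setT (EFin \o u) <-> (\int[mu]_x `|u x|%:E < +oo)%E.
Proof.
move=> mu_; split=> [/integrableP[]//|ui]; apply/integrableP; split => //.
exact/measurable_EFinP.
Qed.

Lemma integrable_measurable u : mu.-integrable setT (EFin \o u) -> measurable_fun setT u.
Proof. by move=> /integrableP[/measurable_EFinP]. Qed.

Lemma integrable_le u v : measurable_fun setT u -> mu.-integrable setT (EFin \o v) ->
  (forall x, `|u x| <= `|v x|) -> mu.-integrable setT (EFin \o u).
Proof.
move=> mu_ iv uv; apply: (le_integrable measurableT _ _ iv); first exact/measurable_EFinP.
by move=> x _ /=; rewrite lee_fin.
Qed.

Lemma locint_integrable u (g : E -> R) (C r : R) : locint u -> measurable_fun setT g ->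
  (forall x, `|g x| <= C) -> (forall x, r <= `|x| -> g x = 0) ->
  mu.-integrable setT (EFin \o (fun x => u x * g x)).
Proof.
move=> [mu_ iu] mg gC gr.
have mB := @measurable_rV_ball R N r.
have mug : measurable_fun setT (fun x => u x * g x) by exact: measurable_funM.
have i1 : mu.-integrable [set x | `|x| < r] (EFin \o (fun x => u x * g x)).
  apply: (@le_integrable _ _ _ _ _ mB _ (fun x => C%:E * (EFin \o u) x)%E).
  - by apply/measurable_EFinP; exact: measurable_funTS.
  - move=> x _ /=; rewrite lee_fin !normrM mulrC ler_wpM2r//.
    by rewrite (le_trans (gC x))// ler_norm.
  - exact: (integrableZl mB C (iu r)).
have /(integrable_mkcond _ mB) := i1.
congr (mu.-integrable _ _); apply/funext => x; rewrite /patch /=.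
case: ifPn => // /negP xr; rewrite gr ?mulr0// leNgt; apply/negP => xr'.
by apply: xr; rewrite inE.
Qed.

Lemma locint_mul_rtest u f : locint u -> rtest f ->
  mu.-integrable setT (EFin \o (fun x => u x * f x)).
Proof.
move=> lu tf; have [C C0 fC] := rtest_bounded tf; have [_ [r fr]] := tf.
apply: locint_integrable lu _ fC fr.
by apply: continuous_measurable_rV; exact: rtest_continuous.
Qed.

Lemma integrable_locint u : mu.-integrable setT (EFin \o u) -> locint u.
Proof.
move=> iu; split; first exact: integrable_measurable.
by move=> r; apply: integrableS iu => //; exact: measurable_rV_ball.
Qed.

Lemma locint_le u v : measurable_fun setT u -> locint v ->
  (forall x, `|u x| <= `|v x|) -> locint u.
Proof.
move=> mu_ [mv iv] uv; split=> // r.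
apply: (le_integrable (measurable_rV_ball r) _ _ (iv r)).
  by apply/measurable_EFinP; exact: measurable_funTS.
by move=> x _ /=; rewrite lee_fin.
Qed.

Lemma locintD u v : locint u -> locint v -> locint (fun x => u x + v x).
Proof.
move=> [mu_ iu] [mv iv]; split; first exact: measurable_funD.
move=> r; have := integrableD (measurable_rV_ball r) (iu r) (iv r).
by apply: eq_integrable => //; exact: measurable_rV_ball.
Qed.

Lemma locintZ (c : R) u : locint u -> locint (fun x => c * u x).
Proof.
move=> [mu_ iu]; split; first exact: measurable_funM.
move=> r; have := integrableZl (measurable_rV_ball r) c (iu r).
by apply: eq_integrable => //; exact: measurable_rV_ball.
Qed.

Lemma locintM_bounded u g : locint u -> measurable_fun setT g ->
  (forall r : R, exists C : R, forall x, `|x| < r -> `|g x| <= C) ->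
  locint (fun x => g x * u x).
Proof.
move=> [mu_ iu] mg gC; split; first exact: measurable_funM.
move=> r; have [C gCr] := gC r; have mB := @measurable_rV_ball R N r.
apply: (@le_integrable _ _ _ _ _ mB _ (fun x => C%:E * (EFin \o u) x)%E).
- by apply/measurable_EFinP/measurable_funTS; exact: measurable_funM.
- move=> x xr /=; rewrite lee_fin !normrM ler_wpM2r//.
  by rewrite (le_trans (gCr x xr))// ler_norm.
- exact: (integrableZl mB C (iu r)).
Qed.

Lemma locint_bounded u (C : R) : measurable_fun setT u -> (forall x, `|u x| <= C) -> locint u.
Proof.
move=> mu_ uC; split=> // r.
apply: measurable_bounded_integrable; first exact: measurable_rV_ball.
- exact: lebesgue_rV_ball_lty.
- exact: measurable_funTS.
- exists C; split; first exact: num_real.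
  by move=> M CM x _ /=; apply: le_trans (uC x) _; exact: ltW.
Qed.

(* Replaces Hoelder's inequality throughout: [A] is optimized afterwards. *)
Lemma young_powR (p a A : R) : 1 <= p -> 0 <= a -> 0 < A ->
  a <= A + A `^ (1 - p) * a `^ p.
Proof.
move=> p1 a0 A0; have [aA|Aa] := leP a A.
  by rewrite (le_trans aA)// lerDl mulr_ge0 ?powR_ge0.
have a0' : 0 < a by exact: lt_trans Aa.
rewrite (@le_trans _ _ (A `^ (1 - p) * a `^ p))//; last by rewrite lerDr ltW.
have p0 : 0 < p by exact: lt_le_trans p1.
rewrite -[X in _ * X](mulr_powRB1 a0 p0) mulrCA ler_peMr//.
rewrite -opprB powRN mulrC ler_pdivlMr ?powR_gt0// mul1r.
by apply: ge0_ler_powR; rewrite ?nnegrE ?subr_ge0 ?(ltW A0)// ltW.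
Qed.

(** Threshold 1 in [young_powR] bounds |u| by 1 + |u|^p, and constants are integrable on balls. *)
Lemma Lpr_locint p u : 1 <= p -> Lpr p u -> locint u.
Proof.
move=> p1 [mu_ iu].
have ip : mu.-integrable setT (EFin \o (fun x => `|u x| `^ p)).
  apply/integrableP; split.
    apply/measurable_EFinP; apply: (measurableT_comp (measurable_powR _)).
    exact: measurableT_comp.
  by under eq_integral do rewrite /= (ger0_norm (powR_ge0 _ _)).
apply: (@locint_le _ (fun x => 1 + `|u x| `^ p)) => //.
  apply: locintD; last exact: integrable_locint.
  by apply: (@locint_bounded _ 1) => // x; rewrite normr1.
move=> x; rewrite [leRHS]ger0_norm ?addr_ge0 ?powR_ge0//.
by have := @young_powR p `|u x| 1 p1 (normr_ge0 _) ltr01; rewrite powR1 mul1r.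
Qed.

Lemma integrable_affine (a : R) z g : 0 < a -> mu.-integrable setT (EFin \o g) ->
  mu.-integrable setT (EFin \o (fun x => g (a *: x + z))).
Proof.
move=> a0 ig; have mg := integrable_measurable ig.
have mga : measurable_fun setT (fun x => g (a *: x + z)).
  exact: (measurableT_comp mg (measurable_affine a z)).
apply/integrable_abs_lty => //; move/integrable_abs_lty : ig => /(_ mg).
rewrite (@ge0_integral_rV_affine R N a z)//; last first.
  by apply/measurable_EFinP; exact: measurableT_comp.
move=> H; rewrite ltey; apply/eqP => oo; move: H; rewrite oo.
by rewrite gt0_muley ?ltxx// lte_fin exprn_gt0.
Qed.

Lemma Rintegral_affine (a : R) z g : 0 < a -> mu.-integrable setT (EFin \o g) ->
  \int[mu]_x g x = a ^+ N * \int[mu]_x g (a *: x + z).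
Proof.
move=> a0 ig; have mg := integrable_measurable ig.
have iga := integrable_affine z a0 ig.
have mp : measurable_fun setT (EFin \o g)^\+%E.
  by apply: measurable_funepos; exact/measurable_EFinP.
have mn : measurable_fun setT (EFin \o g)^\-%E.
  by apply: measurable_funeneg; exact/measurable_EFinP.
pose ga x := g (a *: x + z).
have EP : (\int[mu]_x (EFin \o g)^\+ x = (a ^+ N)%:E * \int[mu]_x (EFin \o ga)^\+ x)%E.
  rewrite (@ge0_integral_rV_affine R N a z (EFin \o g)^\+%E a0 mp (funepos_ge0 _)).
  by congr (_ * _)%E; apply: eq_integral => x _; rewrite !funeposE.
have EN : (\int[mu]_x (EFin \o g)^\- x = (a ^+ N)%:E * \int[mu]_x (EFin \o ga)^\- x)%E.
  rewrite (@ge0_integral_rV_affine R N a z (EFin \o g)^\-%E a0 mn (funeneg_ge0 _)).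
  by congr (_ * _)%E; apply: eq_integral => x _; rewrite !funenegE.
rewrite /Rintegral [in LHS]integralE [in RHS]integralE EP EN.
have F1 := integrable_pos_fin_num measurableT iga.
have F2 := integrable_neg_fin_num measurableT iga.
by rewrite -(fineK F1) -(fineK F2) /= -mulrBr.
Qed.

Lemma locint_affine (a : R) z u : 0 < a -> locint u -> locint (fun x => u (a *: x + z)).
Proof.
move=> a0 [mu_ iu].
have mua : measurable_fun setT (fun x => u (a *: x + z)).
  exact: (measurableT_comp mu_ (measurable_affine a z)).
split=> // r; have mB := @measurable_rV_ball R N.
pose s := a * r + `|z|.
have /(integrable_mkcond _ (mB s)) i1 := iu s.
have : mu.-integrable setT (EFin \o (u \_ [set x | `|x| < s])).
  by apply: eq_integrable i1 => // x _; rewrite /patch /=; case: ifP.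
move=> /(integrable_affine z a0) /(@integrableS _ _ _ _ _ _ _ measurableT (mB r) (@subsetT _ _)).
apply: eq_integrable => // x; rewrite inE /= => xr; rewrite /patch mem_set//=.
apply: le_lt_trans (ler_normD _ _) _; rewrite ltrD2r normrZ (ger0_norm (ltW a0)).
by rewrite ltr_pM2l.
Qed.

End integrability.

Section Rintegral_dominated_convergence.
Context d (T : measurableType d) (R : realType) (mu : {measure set T -> \bar R}).

Lemma Rintegral_dominated_cvg (f_ : nat -> T -> R) (f g : T -> R) :
  (forall n, measurable_fun setT (f_ n)) -> measurable_fun setT f ->
  {ae mu, forall x, f_ ^~ x @ \oo --> f x} ->
  mu.-integrable setT (EFin \o g) -> (forall n x, `|f_ n x| <= g x) ->
  mu.-integrable setT (EFin \o f) /\ (fun n => \int[mu]_x f_ n x) @ \oo --> \int[mu]_x f x.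
Proof.
move=> mf_ mf ff ig fg.
have [] := @dominated_convergence _ T R mu setT measurableT (fun n => EFin \o f_ n)
  (EFin \o f) (EFin \o g).
- by move=> n; exact/measurable_EFinP.
- exact/measurable_EFinP.
- by apply: filterS ff => x fx _; apply: cvg_EFin fx; exact: nearW.
- exact: ig.
- by apply: aeW => x n _ /=; rewrite lee_fin.
move=> iF _ cv; split => //; apply: fine_cvg.
by rewrite fineK; [exact: cv|exact: integrable_fin_num].
Qed.

Lemma Rintegral_cvg_eq0 (f_ : nat -> T -> R) (f g : T -> R) :
  (forall n, measurable_fun setT (f_ n)) -> measurable_fun setT f ->
  {ae mu, forall x, f_ ^~ x @ \oo --> f x} ->
  mu.-integrable setT (EFin \o g) -> (forall n x, `|f_ n x| <= g x) ->
  (forall n, \int[mu]_x f_ n x = 0) -> \int[mu]_x f x = 0.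
Proof.
move=> mf_ mf ff ig fg f0; have [_] := Rintegral_dominated_cvg mf_ mf ff ig fg.
move=> cv; have : (fun n => \int[mu]_x f_ n x) @ \oo --> (0 : R).
  by rewrite (_ : (fun n => _) = (fun=> 0)); [exact: cvg_cst|apply/funext].
by move=> cv0; apply: (cvg_unique _ cv cv0); exact: norm_hausdorff.
Qed.

End Rintegral_dominated_convergence.

(** * The fundamental lemma of the calculus of variations *)

Section fundamental_lemma.
Context {R : realType} {N : nat}.
Local Notation E := 'rV[R]_N.
Local Notation mu := (lebesgue_rV N : {sigma_finite_measure set E -> \bar R}).
Implicit Types (u v f g h : E -> R) (x y z : E).

Definition bump_fun (q : E -> R) :=
  [/\ rtest q, forall x, 0 <= q x <= 1 & forall x, `|x| < 1 -> 0 < q x].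

(** For [f] with values in [0, 1] this tends to the indicator of the set where [f] is positive;
    being a polynomial in [f] without constant term, it is again a test function. *)
Let pospart f (n : nat) x := 1 - (1 - f x) ^+ n.

Lemma rtest_pospart f n : rtest f -> rtest (pospart f n).
Proof.
move=> tf; elim: n => [|n IH].
  rewrite (_ : pospart f 0 = fun x => 0 * f x); last first.
    by apply/funext => x; rewrite /pospart expr0 subrr mul0r.
  by apply: rtestM tf; exact: smooth_on_cst.
rewrite (_ : pospart f n.+1 = fun x => pospart f n x + (1 + -1 * pospart f n x) * f x).
  apply: rtestD => //; apply: rtestM => //.
  apply: smooth_onD; [exact: openT|exact: smooth_on_cst|].
  apply: smooth_onM; [exact: openT|exact: smooth_on_cst|exact: rtest_smooth].
by apply/funext => x; rewrite /pospart exprS; ring.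
Qed.

Lemma pospart_cvg f x : 0 <= f x <= 1 ->
  (fun n => pospart f n x) @ \oo --> ((0 < f x)%R%:R : R).
Proof.
move=> /andP[f0 f1]; have [fx|] := ltP 0 (f x); last first.
  move=> fx; have -> : (fun n => pospart f n x) = fun=> 0; last exact: cvg_cst.
  by apply/funext => n; rewrite /pospart (@le_anti _ _ (f x) 0) ?fx// subr0 expr1n subrr.
rewrite -[X in _ --> X]subr0; apply: cvgB; first exact: cvg_cst.
apply: cvg_expr; rewrite ger0_norm ?subr_ge0//.
by rewrite ltrBlDr ltrDl.
Qed.

Lemma integral_positivity_set h f : mu.-integrable setT (EFin \o h) ->
  (forall g, rtest g -> \int[mu]_x (h x * g x) = 0) ->
  rtest f -> (forall x, 0 <= f x <= 1) ->
  \int[mu]_x (h x * \1_[set x | 0 < f x] x) = 0.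
Proof.
move=> ih h0 tf f01; have mh := integrable_measurable ih.
have mf : measurable_fun setT f by apply: continuous_measurable_rV; exact: rtest_continuous.
have mU : measurable [set x | 0 < f x].
  apply: open_measurable_rV; rewrite (_ : mkset _ = f @^-1` [set t | 0 < t])//.
  by apply: open_comp => [x _|]; [exact: rtest_continuous|exact: open_gt].
apply: (@Rintegral_cvg_eq0 _ _ R mu (fun n x => h x * pospart f n x) _ (fun x => `|h x|)).
- move=> n; apply: measurable_funM => //; apply: continuous_measurable_rV.
  by apply: rtest_continuous; exact: rtest_pospart.
- by apply: measurable_funM.
- apply: aeW => x; apply: cvgM; first exact: cvg_cst.
  rewrite indicE (_ : (x \in _) = (0 < f x)); first exact: pospart_cvg.
  by apply/idP/idP; rewrite inE.
- exact: integrable_norm.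
- move=> n x; rewrite normrM ler_piMr//; have /andP[f0 f1] := f01 x.
  have e0 : 0 <= (1 - f x) ^+ n by rewrite exprn_ge0// subr_ge0.
  have e1 : (1 - f x) ^+ n <= 1 by rewrite exprn_ile1// ?subr_ge0// lerBlDr lerDl.
  by rewrite /pospart ger0_norm ?subr_ge0// lerBlDr lerDl.
- by move=> n; apply: h0; exact: rtest_pospart.
Qed.

(** The positivity set of [q] contains the unit ball and is bounded, so its rational dilates and
    translates are a countable base; they are themselves positivity sets of test functions. *)
Lemma measurable_positivity_sets q : bump_fun q ->
  rV_display.-measurable `<=`
    <<s [set [set x : E | 0 < f x] | f in [set f | rtest f /\ forall x, 0 <= f x <= 1]] >>.
Proof.
move=> [tq q01 q0]; set G := [set _ | _ in _].
have openG (O : set E) : open O -> <<s G >> O.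
  move=> oO; have [r qr] := tq.2.
  have L0 : 0 < Num.max r 1 by rewrite lt_max ltr01 orbT.
  rewrite (@open_bigcup_base R N [set x | 0 < q x] (Num.max r 1) O)//; last first.
    by move=> x /=; apply: contraTT; rewrite -!leNgt ge_max => /andP[/qr -> _].
  rewrite bigcup_mkcond.
  apply: (@countable_bigcupT_measurable _ (g_sigma_algebraType G)) => // k.
  case: ifPn => _; last exact: measurable0.
  apply: sub_sigma_algebra => /=.
  exists (fun x => q ((k.2.+1%:R : R) *: x + - ((k.2.+1%:R : R) *: map_mx ratr k.1))).
    by split=> [|x]; [apply: rtest_affine|exact: q01].
  by apply/seteqP; split => x /=; rewrite scalerBr.
apply: smallest_sub; first exact: smallest_sigma_algebra.
case: N G openG => [|n] G openG; first by rewrite big_ord0.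
rewrite -bigcup_mkord_ord; apply: bigcup_sub => i _ A [B mB <-].
rewrite setTI.
have : @measurable_fun _ _ (g_sigma_algebraType G) (measurableTypeR R) setT (rV_coord (inord i)).
  apply: (measurability _ (RGenOpens.measurableE R)).
  move=> _ [_ [a [b ->] <-]]; rewrite setTI; apply: openG.
  by apply: open_comp => // x _; exact: coord_continuous.
by move=> /(_ measurableT B mB); rewrite setTI.
Qed.

Let rtest_dilate q (n : nat) : rtest q -> rtest (fun x => q (n.+1%:R^-1 *: x)).
Proof.
move=> tq; have := @rtest_affine _ _ q n.+1%:R^-1 0 ltac:(by rewrite invr_gt0) tq.
by congr rtest; apply/funext => x; rewrite addr0.
Qed.

(** The constant 1 is not a test function. The dilates of [q] converge pointwise to the constant
    [q 0], which is positive, and dominated convergence applies. *)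
Lemma integral_test_eq0 q h : bump_fun q -> mu.-integrable setT (EFin \o h) ->
  (forall g, rtest g -> \int[mu]_x (h x * g x) = 0) ->
  \int[mu]_x h x = 0.
Proof.
move=> [tq q01 q0] ih h0; have mh := integrable_measurable ih.
have cv : forall x, (fun n => h x * q (n.+1%:R^-1 *: x)) @ \oo --> h x * q 0.
  move=> x; apply: cvgM; first exact: cvg_cst.
  have c0 : (fun n => n.+1%:R^-1 *: x) @ \oo --> (0 : E).
    by rewrite -[X in _ --> X](scale0r x); apply: cvgZr_tmp; exact: cvg_harmonic.
  have cq : q @ (0 : E) --> q 0 by exact: rtest_continuous.
  exact: (@cvg_comp _ _ _ _ q _ _ _ c0 cq).
have : \int[mu]_x (h x * q 0) = 0.
  apply: (@Rintegral_cvg_eq0 _ _ R mu (fun n x => h x * q (n.+1%:R^-1 *: x)) _ (fun x => `|h x|)).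
  - move=> n; apply: measurable_funM => //; apply: continuous_measurable_rV.
    by apply: rtest_continuous; exact: rtest_dilate.
  - by apply: measurable_funM.
  - exact: aeW.
  - exact: integrable_norm.
  - move=> n x; rewrite normrM ler_piMr//.
    by have /andP[f0 f1] := q01 (n.+1%:R^-1 *: x); rewrite ger0_norm.
  - by move=> n; apply: h0; exact: rtest_dilate.
rewrite RintegralZr// => /eqP; rewrite mulf_eq0 => /orP[/eqP//|/eqP q00].
by have := q0 0; rewrite q00 normr0 ltxx => /(_ ltr01).
Qed.

(** A lambda-system argument. The Borel sets over which [h] integrates to 0 form a lambda-system;
    the positivity sets of nonnegative test functions are stable under intersection, by taking
    products, and generate the Borel sets. *)
Lemma integrable_test_eq0 q h : bump_fun q -> mu.-integrable setT (EFin \o h) ->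
  (forall g, rtest g -> \int[mu]_x (h x * g x) = 0) ->
  {ae mu, forall x, h x = 0}.
Proof.
move=> bq ih h0; have mh := integrable_measurable ih.
have ihA A : measurable A -> mu.-integrable setT (EFin \o (fun x => h x * \1_A x)).
  move=> mA; apply: (@integrable_le _ _ _ h) => //; first exact: measurable_funM.
  by move=> x; rewrite normrM ler_piMr// indicE; case: (_ \in _); rewrite ?normr0 ?normr1.
pose H A := measurable A /\ \int[mu]_x (h x * \1_A x) = 0.
have HA A : measurable A -> H A.
  pose G := [set [set x : E | 0 < f x] | f in [set f | rtest f /\ forall x, 0 <= f x <= 1]].
  move=> mA; apply: (@lambda_system_subset _ G _ setT H).
  - move=> _ _ [f [tf f01] <-] [g [tg g01] <-].
    exists (fun x => f x * g x).
      split; first exact: rtestM (rtest_smooth tf) tg.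
      move=> x; have /andP[f0 f1] := f01 x; have /andP[g0 g1] := g01 x.
      by rewrite mulr_ge0//= mulr_ile1.
    apply/seteqP; split => x /=; last by move=> [? ?]; exact: mulr_gt0.
    have /andP[f0 _] := f01 x; have /andP[g0 _] := g01 x.
    move=> fg; split; rewrite lt_neqAle ?f0 ?g0 andbT; apply/negP => /eqP e0;
    by move: fg; rewrite -e0 ?mul0r ?mulr0 ltxx.
  - split=> //.
    + split=> //; under eq_Rintegral do rewrite indicT mulr1.
      exact: integral_test_eq0 bq ih h0.
    + move=> A' B' BA [mA' iA] [mB iB]; split; first exact: measurableD.
      rewrite -[RHS]subr0 -{1}iA -{1}iB -RintegralB; [|by []|exact: ihA|exact: ihA].
      apply: eq_Rintegral => x _; rewrite -mulrBr; congr (_ * _).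
      rewrite !indicE in_setD; have [xB|xB] := boolP (x \in B').
        by rewrite (mem_set (BA _ (set_mem xB))) /= subrr.
      by rewrite /= ?andbT subr0.
    + move=> F ndF HF; have mU : measurable (\bigcup_i F i).
        by apply: bigcupT_measurable => i; have [] := HF i.
      split=> //; apply: (@Rintegral_cvg_eq0 _ _ R mu (fun n x => h x * \1_(F n) x) _ (fun x => `|h x|)).
      * move=> n; apply: measurable_funM => //; apply: measurable_indic.
        by have [] := HF n.
      * by apply: measurable_funM => //; exact: measurable_indic.
      * apply: aeW => x; apply: cvgM; first exact: cvg_cst.
        apply: cvg_near_cst; rewrite indicE.
        have [/set_mem[k _ Fk]|xU] := boolP (x \in _).
          near=> n; rewrite indicE mem_set//; apply: (subsetPset _ _ (ndF k n _)) Fk.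
          by near: n; exact: nbhs_infty_ge.
        near=> n; rewrite indicE memNset// => Fn; move/negP: xU; apply.
        by rewrite inE; exists n.
      * exact: integrable_norm.
      * move=> n x; rewrite normrM ler_piMr// indicE.
        by case: (_ \in _); rewrite ?normr0 ?normr1.
      * by move=> n; have [] := HF n.
  - move=> _ [f [tf f01] <-]; split; last exact: integral_positivity_set.
    apply: open_measurable_rV; rewrite (_ : mkset _ = f @^-1` [set t | 0 < t])//.
    by apply: open_comp => [x _|]; [exact: rtest_continuous|exact: open_gt].
  - by [].
  - exact: (measurable_positivity_sets bq mA).
have := @integral_ae_eq _ _ R mu setT measurableT (cst 0%E) (EFin \o h) ih.
case; first exact: measurable_cst.
  move=> A _ mA; rewrite integral0.
  have [_] := HA A mA; rewrite /Rintegral => iA.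
  rewrite integral_mkcond.
  transitivity (\int[mu]_x (h x * \1_A x)%:E)%E.
    apply: eq_integral => x _; rewrite patchE indicE; case: ifPn => xA /=.
      by rewrite mulr1.
    by rewrite mulr0.
  have := integrable_fin_num measurableT (ihA A mA).
  by move=> /fineK <-; rewrite iA.
move=> Z [mZ Z0 ZP]; exists Z; split => // x /= hx; apply: ZP => /= xx.
by apply: hx; have [] := xx I.
Unshelve. all: by end_near. Qed.

(** Multiplication by a dilate of [q] makes [h] integrable; at a given point the dilate is positive
    as soon as the dilation factor exceeds the norm of the point. *)
Lemma locint_test_eq0 q h : bump_fun q -> locint h ->
  (forall g, rtest g -> \int[mu]_x (h x * g x) = 0) ->
  {ae mu, forall x, h x = 0}.
Proof.
move=> bq lh h0; have [tq q01 q0] := bq.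
have : {ae mu, forall x, forall n : nat, h x * q (n.+1%:R^-1 *: x) = 0}.
  apply: ae_foralln => n; apply: (integrable_test_eq0 bq).
    by apply: locint_mul_rtest => //; exact: rtest_dilate.
  move=> g tg; under eq_Rintegral do rewrite -mulrA.
  by apply: h0; apply: rtestM tg; exact: rtest_smooth (rtest_dilate n tq).
apply: filterS => x hx; have := hx (Num.bound `|x|).
move=> /eqP; rewrite mulf_eq0 => /orP[/eqP//|/eqP qx].
have := q0 ((Num.bound `|x|).+1%:R^-1 *: x); rewrite qx ltxx => H.
have {}H : false; last by [].
apply: H; rewrite normrZ ger0_norm ?invr_ge0// mulrC ltr_pdivrMr// mul1r.
apply: (lt_trans (archi_boundP (normr_ge0 _))).
by rewrite ltr_nat.
Qed.

End fundamental_lemma.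

(** * Weak derivatives along dilations *)

Section Rintegral_fubini.
Context d1 d2 (T1 : measurableType d1) (T2 : measurableType d2) (R : realType).
Variables (m1 : {sigma_finite_measure set T1 -> \bar R}).
Variables (m2 : {sigma_finite_measure set T2 -> \bar R}).

Lemma integrable_prod_le (F : T1 * T2 -> R) (f : T1 -> R) (g : T2 -> R) :
  measurable_fun setT F -> m1.-integrable setT (EFin \o f) ->
  m2.-integrable setT (EFin \o g) -> (forall x y, `|F (x, y)| <= `|f x| * `|g y|) ->
  (m1 \x m2)%E.-integrable setT (EFin \o F).
Proof.
move=> mF if_ ig FG; apply/integrable12ltyP; first exact/measurable_EFinP.
have [mf ifoo] := integrableP _ _ _ if_; have [mg igoo] := integrableP _ _ _ ig.
pose c := (\int[m2]_y `|(g y)%:E|)%E.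
have mFx x : measurable_fun setT (fun y => F (x, y)).
  by apply: (measurableT_comp mF); apply: measurable_fun_pair.
have c0 : (0 <= c)%E by apply: integral_ge0.
have cfin : c \is a fin_num by rewrite ge0_fin_numE.
apply: (@le_lt_trans _ _ (\int[m1]_x (`|(f x)%:E| * c))%E); last first.
  rewrite ge0_integralZr//; last exact: measurableT_comp.
  have f0 : (0 <= \int[m1]_x `|(f x)%:E|)%E by exact: integral_ge0.
  by apply: lte_mul_pinfty => //; rewrite ge0_fin_numE.
apply: ge0_le_integral => //.
- by move=> x _; exact: integral_ge0.
- have := @measurable_fun_fubini_tonelli_F _ _ T1 T2 R m2 (fun z => `|(F z)%:E|%E).
  by apply => //; apply: measurableT_comp => //; exact/measurable_EFinP.
- by apply: emeasurable_funM => //; exact: measurableT_comp.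
- move=> x _; rewrite -ge0_integralZl//; last exact: measurableT_comp.
  apply: ge0_le_integral => //.
  + by apply: measurableT_comp => //; apply/measurable_EFinP.
  + by apply: emeasurable_funM => //; exact: measurableT_comp.
  + by move=> y _; rewrite /= lee_fin.
Qed.

(** The inner integrals are extended reals, finite only almost everywhere. Taking [fine] changes
    them on a null set and never increases the absolute value, so integrability and the exchange
    survive. *)
Lemma Rintegral_fubini (F : T1 * T2 -> R) : (m1 \x m2)%E.-integrable setT (EFin \o F) ->
  [/\ m1.-integrable setT (EFin \o (fun x => \int[m2]_y F (x, y))),
      m2.-integrable setT (EFin \o (fun y => \int[m1]_x F (x, y))) &
      \int[m1]_x \int[m2]_y F (x, y) = \int[m2]_y \int[m1]_x F (x, y)].
Proof.
move=> iF; pose f1 := fubini_F m2 (EFin \o F); pose f2 := fubini_G m1 (EFin \o F).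
have m_f1 : measurable_fun setT f1 by exact: (measurable_fubini_F iF).
have m_f2 : measurable_fun setT f2 by exact: (measurable_fubini_G iF).
have le_fine (x : \bar R) : (`|(fine x)%:E| <= `|x|)%E.
  by case: x => //=; rewrite normr0 ?leey.
have mfine d (T : measurableType d) (f : T -> \bar R) : measurable_fun setT f ->
    measurable_fun setT (EFin \o (fine \o f)).
  by move=> mf; apply/measurable_EFinP; apply: measurableT_comp.
have i1 : m1.-integrable setT (EFin \o (fun x => \int[m2]_y F (x, y))).
  apply: (le_integrable measurableT _ _ (integrable_fubini_F iF)).
    exact: mfine _ _ _ m_f1.
  by move=> x _; exact: le_fine.
have i2 : m2.-integrable setT (EFin \o (fun y => \int[m1]_x F (x, y))).
  have if2 : m2.-integrable setT f2.
    have iF' : (m2 \x m1)%E.-integrable setT (EFin \o (fun z => F (z.2, z.1))).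
      apply/integrable12ltyP.
        apply/measurable_EFinP; apply: (measurableT_comp (f := F)).
          by apply/measurable_EFinP; exact: measurable_int iF.
        by apply: measurable_fun_pair.
      by apply/(@integrable21ltyP _ _ T1 T2 R m1 m2 (EFin \o F)) => //; exact: measurable_int iF.
    exact: integrable_fubini_F iF'.
  apply: (le_integrable measurableT _ _ if2); first exact: mfine _ _ _ m_f2.
  by move=> x _; exact: le_fine.
split => //; congr fine.
transitivity (\int[m1]_x f1 x)%E.
  apply: ae_eq_integral => //; first exact: mfine _ _ _ m_f1.
  apply: filterS (ae_integrable1 iF) => x ix _ /=.
  by rewrite fineK//; exact: integrable_fin_num ix.
transitivity (\int[m2]_y f2 y)%E; first exact: (Fubini iF).
apply: ae_eq_integral => //; first exact: mfine _ _ _ m_f2.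
apply: filterS (ae_integrable2 iF) => x ix _ /=.
by rewrite fineK//; exact: integrable_fin_num ix.
Qed.

End Rintegral_fubini.

Lemma Rintegral_sum d (T : measurableType d) (R : realType)
    (mu : {measure set T -> \bar R}) (I : Type) (r : seq I) (F : I -> T -> R) :
  (forall i, mu.-integrable setT (EFin \o F i)) ->
  mu.-integrable setT (EFin \o (fun x => \sum_(i <- r) F i x)) /\
  \int[mu]_x (\sum_(i <- r) F i x) = \sum_(i <- r) \int[mu]_x F i x.
Proof.
move=> iF; elim: r => [|i r [IH1 IH2]].
  split; first by under eq_fun do rewrite big_nil; exact: integrable0.
  by under eq_Rintegral do rewrite big_nil; rewrite Rintegral_cst// mul0r big_nil.
split.
  have := integrableD measurableT (iF i) IH1.
  by apply: eq_integrable => // x _ /=; rewrite big_cons.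
under eq_Rintegral do rewrite big_cons.
by rewrite RintegralD// IH2 big_cons.
Qed.

Section dilation_flow.
Context {R : realType} {N : nat}.
Local Notation E := 'rV[R]_N.
Local Notation mu := (lebesgue_rV N : {sigma_finite_measure set E -> \bar R}).
Local Notation leb := (lebesgue_measure : {sigma_finite_measure set (measurableTypeR R) -> \bar R}).
Implicit Types (u v f g h : E -> R) (x y z : E) (i : 'I_N).

Definition wderiv i u v :=
  forall f, rtest f -> \int[mu]_x (u x * pd i f x) = - \int[mu]_x (v x * f x).

Definition wderiv0 i u v :=
  forall f, rtest0 f -> \int[mu]_x (u x * pd i f x) = - \int[mu]_x (v x * f x).

Lemma wderiv_wderiv0 i u v : wderiv i u v -> wderiv0 i u v.
Proof. by move=> uv f [tf _]; exact: uv. Qed.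

Lemma rtest_sum (I : Type) (r : seq I) (F : I -> E -> R) :
  (forall k, rtest (F k)) -> rtest (fun x => \sum_(k <- r) F k x).
Proof.
move=> tF; elim: r => [|k r IH].
  under eq_fun do rewrite big_nil.
  by split; [exact: smooth_on_cst|exists 0].
by under eq_fun do rewrite big_cons; exact: rtestD.
Qed.

Definition coordM i f : E -> R := fun x => x ord0 i * f x.

Lemma rtest_coordM i f : rtest f -> rtest (coordM i f).
Proof. by move=> tf; apply: rtestM tf; exact: smooth_coord. Qed.

(** The divergence of the vector field x f(x), which differentiating a dilated test function in the
    scale produces. *)
Definition eulerf f : E -> R := fun x => \sum_i pd i (coordM i f) x.

Lemma rtest_eulerf f : rtest f -> rtest (eulerf f).
Proof. by move=> tf; apply: rtest_sum => i; apply: rtest_pd; exact: rtest_coordM. Qed.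

Lemma eulerfE f x : smooth_on setT f ->
  eulerf f x = N%:R * f x + \sum_i x ord0 i * pd i f x.
Proof.
move=> sf; rewrite /eulerf; under eq_bigr => i _.
  rewrite (pdM _ (C1_at_coord x i) (smooth_on_C1 sf I)) pd_coord eqxx mul1r; over.
by rewrite big_split /= sumr_const card_ord mulr_natl.
Qed.

Lemma is_derive_dilate f y (s : R) : smooth_on setT f -> s != 0 ->
  is_derive s 1 (fun s => s^-1 ^+ N * f (s^-1 *: y))
    (- (s^-1 ^+ N.+1 * eulerf f (s^-1 *: y))).
Proof.
move=> sf s0; set t := s^-1.
have D1 : is_derive t 1 (fun t : R => t ^+ N) (N%:R * t ^+ N.-1).
  apply: DeriveDef; first exact: exprn_derivable.
  by rewrite exp_derive; exact: mulr1.
have D2 : is_derive t 1 (fun t : R => f (t *: y)) (\sum_i y ord0 i * pd i f (t *: y)).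
  have := is_derive_segment 0 y t sf; rewrite add0r.
  by congr is_derive; apply/funext => r; rewrite add0r.
have D3 := is_deriveM D1 D2.
have D4 : is_derive s 1 (fun s : R => s^-1) (- (t ^+ 2)).
  have := @is_deriveV _ id s 1 1 s0 (is_derive_id _ _).
  by rewrite /GRing.scale /= mulr1 exprVn.
have := is_derive1_comp D3 D4; congr is_derive.
rewrite /GRing.scale /= eulerfE// mulrN; congr (- _).
have E1 : \sum_i (t *: y) ord0 i * pd i f (t *: y) = t * \sum_i y ord0 i * pd i f (t *: y).
  by rewrite mulr_sumr; apply: eq_bigr => i _; rewrite mxE mulrA.
rewrite E1; set S := \sum_i _; set F := f _.
(* The predecessor is truncated; for [N] equal to 0 both sides vanish. *)
have E2 : N%:R * t ^+ N.-1 * t = N%:R * t ^+ N.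
  by case: N => [|n]; rewrite ?mul0r// -mulrA -exprSr.
transitivity (t ^+ N * S * t ^+ 2 + F * (N%:R * t ^+ N.-1 * t) * t); first by ring.
by rewrite E2 [t ^+ N.+1]exprS; ring.
Qed.

Lemma continuous_dilate_inv (w : E -> R) y (n : nat) (s : R) : continuous w -> s != 0 ->
  {for s, continuous (fun s : R => s^-1 ^+ n * w (s^-1 *: y))}.
Proof.
move=> cw s0.
have c1 : {for s, continuous (fun t : R => t^-1 ^+ n)}.
  apply: (@continuous_comp _ _ _ (fun t : R => t^-1) (fun t => t ^+ n)).
    exact: inv_continuous.
  exact: exprn_continuous.
have c2 : {for s, continuous (fun t : R => w (t^-1 *: y))}.
  apply: (@continuous_comp _ _ _ (fun t : R => t^-1 *: y) w); last exact: cw.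
  apply: (@continuous_comp _ _ _ (fun t : R => t^-1) (fun t => t *: y)).
    exact: inv_continuous.
  exact: scalel_continuous.
exact: continuousM c1 c2.
Qed.

Lemma dilate_ftc f y (a b : R) : smooth_on setT f -> 0 < a < b ->
  \int[leb]_(s in `[a, b]) (s^-1 ^+ N.+1 * eulerf f (s^-1 *: y)) =
  a^-1 ^+ N * f (a^-1 *: y) - b^-1 ^+ N * f (b^-1 *: y).
Proof.
move=> sf /andP[a0 ab].
have ceu : continuous (eulerf f).
  have : smooth_on setT (eulerf f).
    rewrite /eulerf; elim: (index_enum _) => [|i r IH].
      by under eq_fun do rewrite big_nil; exact: smooth_on_cst.
    under eq_fun do rewrite big_cons.
    apply: smooth_onD; [exact: openT| |exact: IH].
    exact: smooth_on_pd i (smooth_onM openT (smooth_coord i) sf).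
  exact: smooth_continuous.
have D (s : R) : 0 < s -> is_derive s 1 (fun s => - (s^-1 ^+ N * f (s^-1 *: y)))
    (s^-1 ^+ N.+1 * eulerf f (s^-1 *: y)).
  move=> s0; have := is_deriveN (@is_derive_dilate f y s sf (lt0r_neq0 s0)).
  by rewrite opprK.
have C (s : R) : 0 < s -> {for s, continuous (fun s : R => - (s^-1 ^+ N * f (s^-1 *: y)))}.
  by move=> s0; apply: differentiable_continuous; apply/derivable1_diffP;
    exact: (@ex_derive _ _ _ _ _ _ _ (D s s0)).
rewrite /Rintegral (@continuous_FTC2 _ _ (fun s => - (s^-1 ^+ N * f (s^-1 *: y))))//.
- by rewrite /= opprK addrC.
- apply: continuous_in_subspaceT => s; rewrite inE /= in_itv/= => /andP[sa _].
  by apply: continuous_dilate_inv => //; rewrite gt_eqF// (lt_le_trans a0).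
- split.
  + move=> s; rewrite in_itv/= => /andP[sa _].
    exact: (@ex_derive _ _ _ _ _ _ _ (D s (lt_trans a0 sa))).
  + by apply: cvg_at_right_filter; exact: C.
  + by apply: cvg_at_left_filter; apply: C; exact: lt_trans ab.
- move=> s; rewrite in_itv/= => /andP[sa _]; rewrite derive1E.
  exact: (@derive_val _ _ _ _ _ _ _ (D s (lt_trans a0 sa))).
Qed.

(** Measurability comes from [powR], which represents the inverse for a nonnegative base only; hence
    the detour through the square, which also respects the convention that the inverse of 0 is 0. *)
Lemma measurable_inv : measurable_fun setT (fun t : R => t^-1).
Proof.
rewrite (_ : (fun t : R => _) = (fun t : R => t * ((t * t) `^ (-1)))); last first.
  apply/funext => t; rewrite powR_inv1; last by rewrite -expr2 sqr_ge0.
  have [->|t0] := eqVneq t 0; first by rewrite invr0 mul0r.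
  by rewrite invfM mulrA divff// mul1r.
apply: measurable_funM => //; apply: (measurableT_comp (measurable_powR _)).
exact: measurable_funM.
Qed.

Lemma measurable_scale_pair :
  measurable_fun setT (fun z : measurableTypeR R * E => (z.1 : R) *: z.2).
Proof.
apply: measurable_fun_rV => i.
rewrite (_ : _ \o _ = fun z : measurableTypeR R * E => (z.1 : R) * rV_coord i z.2).
  by apply: measurable_funM => //; apply: measurableT_comp => //; exact: measurable_rV_coord.
by apply/funext => x /=; rewrite /rV_coord !mxE.
Qed.

Lemma measurable_invscale_pair :
  measurable_fun setT (fun z : measurableTypeR R * E => (z.1 : R)^-1 *: z.2).
Proof.
have m1 : measurable_fun setT (fun z : measurableTypeR R * E =>
    (((z.1 : R)^-1 : measurableTypeR R), z.2)).
  by apply: measurable_fun_pair => //; exact: (measurableT_comp measurable_inv).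
exact: (measurableT_comp measurable_scale_pair m1).
Qed.

Lemma Rintegral_itv_indic (a b : R) (g : R -> R) :
  \int[leb]_(s in `[a, b]) g s = \int[leb]_s (\1_(`[a, b]%classic : set R) s * g s).
Proof.
rewrite Rintegral_mkcond; apply: eq_Rintegral => s _.
by rewrite patchE indicE; case: ifPn; rewrite ?mul1r ?mul0r.
Qed.

Lemma integrable_itv_indic (a b : R) :
  leb.-integrable setT (EFin \o \1_(`[a, b]%classic : set R)).
Proof. exact: integrable_indic_itv. Qed.

Lemma Rintegral_dilate u f (s : R) : 0 < s ->
  mu.-integrable setT (EFin \o (fun y => u y * f (s^-1 *: y))) ->
  \int[mu]_y (u y * (s^-1 ^+ N * f (s^-1 *: y))) = \int[mu]_x (u (s *: x) * f x).
Proof.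
move=> s0 iu.
have i2 := integrable_affine 0 s0 iu; rewrite /= in i2.
under eq_Rintegral do rewrite mulrCA.
rewrite RintegralZl// (Rintegral_affine 0 s0 iu) mulrA -exprMn mulVf ?gt_eqF// expr1n mul1r.
apply: eq_Rintegral => x _; rewrite addr0 scalerA mulVf ?gt_eqF//.
by rewrite scale1r.
Qed.

(** The [i]-th component of a vector field whose divergence is
    [s^-1 ^+ N.+1 * eulerf f (s^-1 *: y)], that is, minus the derivative in [s] of the dilated test
    function [s^-1 ^+ N * f (s^-1 *: y)]. *)
Definition dil_coordM i f (s : R) : E -> R := fun y => s^-1 ^+ N * coordM i f (s^-1 *: y).

Lemma rtest_dilV f (s : R) : 0 < s -> rtest f -> rtest (fun y => f (s^-1 *: y)).
Proof.
move=> s0 tf; have := @rtest_affine _ _ f s^-1 0 ltac:(by rewrite invr_gt0) tf.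
by congr rtest; apply/funext => x; rewrite addr0.
Qed.

Lemma rtest_dil_coordM i f (s : R) : 0 < s -> rtest f -> rtest (dil_coordM i f s).
Proof.
move=> s0 tf; apply: rtestM; first exact: smooth_on_cst.
by apply: (@rtest_dilV (coordM i f)) => //; exact: rtest_coordM.
Qed.

Lemma pd_dil_coordM i f (s : R) y : rtest f ->
  pd i (dil_coordM i f s) y = s^-1 ^+ N.+1 * pd i (coordM i f) (s^-1 *: y).
Proof.
move=> tf; have sf := rtest_smooth (rtest_coordM i tf).
have [C P] := C1_at_comp_affine s^-1 0 y sf.
rewrite /dil_coordM (_ : (fun y => _) = fun y => s^-1 ^+ N * coordM i f (s^-1 *: y + 0)); last first.
  by apply/funext => x; rewrite addr0.
rewrite (pdM i (C1_at_cst _ _) C) pd_cst mul0r add0r P addr0 mulrA exprSr//.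
Qed.

(** A change of variables moves the dilation from [u] onto [f], where the dependence on the scale is
    smooth and [dilate_ftc] applies; Fubini and the weak derivative do the rest. The integration by
    parts is assumed only for the functions [dil_coordM i f s], so that the lemma serves [wderiv]
    and [wderiv0] alike. *)
Lemma dilation_flow f u (us : 'I_N -> E -> R) (a b : R) : 0 < a < b -> rtest f ->
  locint u -> (forall i, locint (us i)) ->
  (forall i s, 0 < s -> \int[mu]_x (u x * pd i (dil_coordM i f s) x) =
     - \int[mu]_x (us i x * dil_coordM i f s x)) ->
  \int[mu]_x (u (b *: x) * f x) - \int[mu]_x (u (a *: x) * f x) =
  \int[leb]_(s in `[a, b]) \sum_i \int[mu]_x (us i (s *: x) * (x ord0 i * f x)).
Proof.
move=> /andP[a0 ab] tf lu lus H; have b0 : 0 < b by exact: lt_trans ab.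
have E1 s : 0 < s -> \int[mu]_y (u y * (s^-1 ^+ N * f (s^-1 *: y))) = \int[mu]_x (u (s *: x) * f x).
  by move=> s0; apply: Rintegral_dilate => //; apply: locint_mul_rtest => //; exact: rtest_dilV.
rewrite -(E1 a a0) -(E1 b b0).
have iE s : 0 < s -> mu.-integrable setT (EFin \o (fun y => u y * (s^-1 ^+ N * f (s^-1 *: y)))).
  move=> s0; apply: locint_mul_rtest => //; apply: rtestM; last exact: rtest_dilV.
  exact: smooth_on_cst.
rewrite -RintegralB//; [|exact: iE|exact: iE].
pose chi : R -> R := \1_(`[a, b]%classic : set R).
pose F (z : measurableTypeR R * E) : R :=
  chi z.1 * (u z.2 * (z.1^-1 ^+ N.+1 * eulerf f (z.1^-1 *: z.2))).
have teu := rtest_eulerf tf.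
have [C C0 eC] := rtest_bounded teu; have [_ [r er]] := teu.
have iF : (leb \x mu)%E.-integrable setT (EFin \o F).
  (* For [s] in [a, b] the prefactor is at most [a^-1 ^+ N.+1], and [s^-1 *: y] within radius [r]
     forces [y] into the ball of radius [b * r]. *)
  pose g x : R := u x * (a^-1 ^+ N.+1 * C * \1_[set x | `|x| < b * r] x).
  apply: (@integrable_prod_le _ _ (measurableTypeR R) E R leb mu F chi g).
  - apply: measurable_funM; first by apply: (measurableT_comp (f := chi)) => //; exact: measurable_indic.
    apply: measurable_funM; first by apply: (measurableT_comp (f := u)) => //; exact: lu.1.
    apply: measurable_funM.
      apply: (measurableT_comp (f := fun t : R => t ^+ N.+1)) => //.
      exact: measurableT_comp measurable_inv _.
    apply: (measurableT_comp (f := eulerf f)); last exact: measurable_invscale_pair.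
    by apply: continuous_measurable_rV; exact: rtest_continuous.
  - exact: integrable_itv_indic.
  - apply: (@locint_integrable _ _ u _ (a^-1 ^+ N.+1 * C) (b * r)) => //.
    + apply: measurable_funM => //; apply: measurable_indic; exact: measurable_rV_ball.
    + move=> x; rewrite indicE normrM [leLHS](_ : _ = a^-1 ^+ N.+1 * C * `|(x \in [set x | `|x| < b * r])%:R|).
        by apply: ler_piMr; [rewrite mulr_ge0// exprn_ge0// invr_ge0 ltW|case: (_ \in _); rewrite ?normr0 ?normr1].
      by rewrite ger0_norm// mulr_ge0// exprn_ge0// invr_ge0 ltW.
    + move=> x xr; rewrite indicE memNset ?mulr0//= => xr'.
      by have := lt_le_trans xr' xr; rewrite ltxx.
  - move=> s y; rewrite /F /g /= normrM; have [sab|sab] := boolP (s \in (`[a, b]%classic : set R)); last first.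
      by rewrite /chi indicE (negbTE sab) normr0 mul0r mul0r.
    rewrite ler_wpM2l// !normrM ler_wpM2l//.
    move: sab; rewrite inE /= in_itv/= => /andP[sa sb]; have s0 : 0 < s by exact: lt_le_trans sa.
    have [yr|yr] := ltP `|y| (b * r); last first.
      rewrite er ?normr0 ?mulr0 ?mulr_ge0//.
      rewrite normrZ ger0_norm ?invr_ge0 ?(ltW s0)// mulrC ler_pdivlMr// mulrC.
      have [r0|r0] := leP 0 r; first by apply: le_trans yr; exact: ler_wpM2r.
      by rewrite (le_trans _ (normr_ge0 y))// mulr_ge0_le0 ?ltW.
    rewrite indicE mem_set// normr1 mulr1 (ger0_norm C0).
    apply: ler_pM => //; rewrite !ger0_norm ?exprn_ge0 ?invr_ge0 ?(ltW s0) ?(ltW a0)//.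
    by rewrite lerXn2r ?nnegrE ?invr_ge0 ?(ltW s0) ?(ltW a0)// lef_pV2.
have [_ _ fub] := Rintegral_fubini iF.
transitivity (- \int[mu]_y \int[leb]_s F (s, y)).
  have -> : \int[mu]_y \int[leb]_s F (s, y) = \int[mu]_y (u y * (a^-1 ^+ N * f (a^-1 *: y)) -
      u y * (b^-1 ^+ N * f (b^-1 *: y))).
    apply: eq_Rintegral => y _; rewrite -mulrBr -(dilate_ftc y (rtest_smooth tf)) ?a0//.
    rewrite Rintegral_itv_indic -RintegralZl//; last first.
      have : leb.-integrable `[a, b] (EFin \o (fun s => s^-1 ^+ N.+1 * eulerf f (s^-1 *: y))).
        apply: continuous_compact_integrable; first exact: segment_compact.
        apply: continuous_in_subspaceT => s; rewrite inE /= in_itv/= => /andP[sa _].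
        by apply: continuous_dilate_inv; [exact: rtest_continuous|rewrite gt_eqF// (lt_le_trans a0)].
      have [H1 _] := @integrable_mkcond _ (measurableTypeR R) R leb `[a, b]%classic
        (EFin \o (fun s : R => s^-1 ^+ N.+1 * eulerf f (s^-1 *: y))) (measurable_itv _).
      move=> /H1; apply: eq_integrable => // s _; rewrite /= patchE indicE.
      by case: ifPn; rewrite ?mul1r ?mul0r.
    apply: eq_Rintegral => s _; rewrite /F /=; ring.
  rewrite !RintegralB//; [|exact: iE|exact: iE|exact: iE|exact: iE].
  by rewrite opprB.
rewrite -fub Rintegral_itv_indic.
have P s : \int[mu]_y F (s, y) = -1 * (chi s * \sum_i \int[mu]_x (us i (s *: x) * (x ord0 i * f x))).
  rewrite /F /=.
  have [sab|sab] := boolP (s \in (`[a, b]%classic : set R)); last first.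
    rewrite /chi indicE (negbTE sab) mul0r mulr0.
    by under eq_Rintegral do rewrite mul0r; rewrite Rintegral_cst// mul0r.
  rewrite /chi indicE sab mul1r; under eq_Rintegral do rewrite mul1r.
  move: sab; rewrite inE /= in_itv/= => /andP[sa sb]; have s0 : 0 < s by exact: lt_le_trans sa.
  have iT i : mu.-integrable setT (EFin \o (fun y => u y * pd i (dil_coordM i f s) y)).
    by apply: locint_mul_rtest => //; apply: rtest_pd; exact: rtest_dil_coordM.
  transitivity (\int[mu]_y \sum_i (u y * pd i (dil_coordM i f s) y)).
    apply: eq_Rintegral => y _; rewrite -mulr_sumr; congr (_ * _).
    by rewrite /eulerf mulr_sumr; apply: eq_bigr => i _; rewrite pd_dil_coordM.
  rewrite (Rintegral_sum _ iT).2.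
  rewrite mulN1r -sumrN; apply: eq_bigr => i _; rewrite H//; congr (- _).
  rewrite -(@Rintegral_dilate (us i) (coordM i f))//.
  by apply: locint_mul_rtest => //; apply: rtest_dilV => //; exact: rtest_coordM.
have -> : \int[leb]_s \int[mu]_y F (s, y) = \int[leb]_s (-1 * (chi s * \sum_i \int[mu]_x (us i (s *: x) * (x ord0 i * f x)))).
  by apply: eq_Rintegral => s _; exact: P.
rewrite RintegralZl ?mulN1r ?opprK//.
have [ii _ _] := Rintegral_fubini iF.
have := integrableZl measurableT (-1) ii.
by apply: eq_integrable => // s _ /=; rewrite P -EFinM mulrA mulrNN !mul1r.
Qed.

Lemma rtest0_dil_coordM i f (s : R) : 0 < s -> rtest0 f -> rtest0 (dil_coordM i f s).
Proof.
move=> s0 tf; apply: rtest0M; first exact: smooth_on_cst.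
apply: (@rtest0_scale _ _ (coordM i f)); first by rewrite invr_gt0.
by apply: rtest0M tf; exact: smooth_coord.
Qed.

Lemma wderiv_flow f u (us : 'I_N -> E -> R) (a b : R) : 0 < a < b -> rtest f ->
  locint u -> (forall i, locint (us i)) -> (forall i, wderiv i u (us i)) ->
  \int[mu]_x (u (b *: x) * f x) - \int[mu]_x (u (a *: x) * f x) =
  \int[leb]_(s in `[a, b]) \sum_i \int[mu]_x (us i (s *: x) * (x ord0 i * f x)).
Proof.
move=> ab tf lu lus uus; apply: dilation_flow => // i s s0.
by apply: uus; exact: rtest_dil_coordM.
Qed.

Lemma wderiv0_flow f u (us : 'I_N -> E -> R) (a b : R) : 0 < a < b -> rtest0 f ->
  locint u -> (forall i, locint (us i)) -> (forall i, wderiv0 i u (us i)) ->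
  \int[mu]_x (u (b *: x) * f x) - \int[mu]_x (u (a *: x) * f x) =
  \int[leb]_(s in `[a, b]) \sum_i \int[mu]_x (us i (s *: x) * (x ord0 i * f x)).
Proof.
move=> ab tf lu lus uus; apply: dilation_flow => //; first by have [] := tf.
by move=> i s s0; apply: uus; exact: rtest0_dil_coordM.
Qed.

End dilation_flow.

Section Rintegral_scale.
Context d (T : measurableType d) (R : realType) (mu : {measure set T -> \bar R}).

(** The positive or the negative part has infinite integral, so the extended integral is infinite,
    and [fine] sends infinite values to 0. *)
Lemma Rintegral_not_integrable (f : T -> R) : measurable_fun setT f ->
  ~ mu.-integrable setT (EFin \o f) -> \int[mu]_x f x = 0.
Proof.
move=> mf nf; rewrite /Rintegral integralE.
have p0 : (0 <= \int[mu]_x (EFin \o f)^\+ x)%E by exact: integral_ge0.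
have n0 : (0 <= \int[mu]_x (EFin \o f)^\- x)%E by exact: integral_ge0.
have : (\int[mu]_x (EFin \o f)^\+ x + \int[mu]_x (EFin \o f)^\- x = +oo)%E.
  rewrite -ge0_integralD//; last 2 first.
  - by apply: measurable_funepos; exact/measurable_EFinP.
  - by apply: measurable_funeneg; exact/measurable_EFinP.
  apply/eqP; rewrite -leye_eq leNgt; apply/negP => foo; apply: nf.
  apply/integrableP; split; first exact/measurable_EFinP.
  by move: foo; congr (_ < _)%E; apply: eq_integral => x _; rewrite -/((abse \o (EFin \o f)) x) fune_abse.
rewrite /= in p0 n0 *.
case: (X in (X + _)%E) p0 => [x| |] // p0; case: (X in (_ + X)%E) n0 => [y| |] //.
Qed.

(** Holds without integrability because a nonintegrable function has integral 0 by default. It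
    spares a proof of integrability at each individual point. *)
Lemma RintegralZl_measurable (f : T -> R) (c : R) : measurable_fun setT f ->
  \int[mu]_x (c * f x) = c * \int[mu]_x f x.
Proof.
move=> mf; have [->|c0] := eqVneq c 0.
  by under eq_Rintegral do rewrite mul0r; rewrite Rintegral_cst// !mul0r.
have [if_|nif] := pselect (mu.-integrable setT (EFin \o f)); first by rewrite RintegralZl.
rewrite [X in _ = _ * X]Rintegral_not_integrable// mulr0.
apply: Rintegral_not_integrable; first exact: measurable_funM.
move=> /(integrableZl measurableT c^-1) icf; apply: nif; apply: eq_integrable icf => //.
by move=> x _ /=; rewrite -EFinM mulKf.
Qed.

End Rintegral_scale.

Section dilation_difference.
Context {R : realType} {N : nat}.
Local Notation E := 'rV[R]_N.
Local Notation mu := (lebesgue_rV N : {sigma_finite_measure set E -> \bar R}).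
Local Notation leb := (lebesgue_measure : {sigma_finite_measure set (measurableTypeR R) -> \bar R}).
Implicit Types (u v f g h : E -> R) (x y z : E) (i : 'I_N).

(** The only source of cutoffs. The unit ball is that of the sup norm, in which all supports and
    weights are measured. *)
Definition plateau (k : E -> R) := rtest k /\ forall x, `|x| < 1 -> k x = 1.

(** The sign of [k] is unknown, so it is squared after division by a bound; [C + 1] is a divisor
    that is surely positive. *)
Lemma plateau_bump k : plateau k -> exists q : E -> R, bump_fun q.
Proof.
move=> [tk k1]; have [C C0 kC] := rtest_bounded tk.
have C1 : 0 < C + 1 by rewrite ltr_wpDl.
exists (fun x => ((C + 1)^-1 * k x) * ((C + 1)^-1 * k x)); split.
- apply: rtestM; last by apply: rtestM => //; exact: smooth_on_cst.
  by apply: smooth_onM; [exact: openT|exact: smooth_on_cst|exact: rtest_smooth].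
- move=> x; rewrite -expr2 sqr_ge0/= -[leLHS]ger0_norm ?sqr_ge0// normrX exprn_ile1// normrM.
  rewrite ger0_norm ?invr_ge0 ?(ltW C1)// mulrC ler_pdivrMr// mul1r.
  by rewrite (le_trans (kC x))// lerDl.
- by move=> x /k1 ->; rewrite !mulr1 mulr_gt0// invr_gt0.
Qed.

(** The factor 1 - k(nx) vanishes near 0 and equals 1 at any fixed nonzero point once [n] is large;
    the origin is a null set. *)
Lemma locint_test0_eq0 k h : (0 < N)%N -> plateau k -> locint h ->
  (forall g, rtest0 g -> \int[mu]_x (h x * g x) = 0) ->
  {ae mu, forall x, h x = 0}.
Proof.
move=> N0 pk lh h0; have [q bq] := plateau_bump pk; have [tk k1] := pk.
pose c (n : nat) x := 1 + -1 * k (n.+1%:R *: x).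
have n0 n : 0 < n.+1%:R :> R by rewrite ltr0n.
have tkn n : rtest (fun x => k (n.+1%:R *: x)) by exact: rtest_scale (n0 n) tk.
have sc n : smooth_on setT (c n).
  apply: smooth_onD; [exact: openT|exact: smooth_on_cst|].
  by apply: smooth_onM; [exact: openT|exact: smooth_on_cst|exact: rtest_smooth].
have : {ae mu, forall x, forall n : nat, h x * c n x = 0}.
  apply: ae_foralln => n; apply: (locint_test_eq0 bq).
    have [C C0 kC] := rtest_bounded (tkn n).
    under eq_fun do rewrite mulrC.
    apply: locintM_bounded => //.
      by apply: continuous_measurable_rV; exact: smooth_continuous.
    move=> r; exists (1 + C) => x _; rewrite /c.
    by rewrite (le_trans (ler_normD _ _))// normr1 lerD2l mulN1r normrN.
  move=> g tg; under eq_Rintegral do rewrite -mulrA.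
  apply: h0; split; first exact: rtestM.
  exists (n.+1%:R^-1); first by rewrite invr_gt0.
  move=> x xn; rewrite /c k1 ?mulr1 ?subrr ?mul0r//.
  by rewrite normrZ ger0_norm// mulrC -ltr_pdivlMr// div1r.
move=> ae1; move: ae1 (@ae_neq0 R N N0); apply: filterS2 => x hx x0.
have [r kr] := tk.2; have nx0 : 0 < `|x| by rewrite normr_gt0.
have := hx (Num.bound `|r / `|x| |); rewrite /c kr ?mulr0 ?addr0 ?mulr1//.
rewrite normrZ ger0_norm// -ler_pdivrMr//.
apply: le_trans (_ : `|r / `|x| | <= _); first exact: ler_norm.
by apply: ltW; apply: lt_trans (archi_boundP (normr_ge0 _)) _; rewrite ltr_nat.
Qed.

(** [v (s *: x)] mixes the variables, so domination by a product of functions of [s] and [x] is out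
    of reach. For each fixed [s] the inner integral is bounded by a change of variables instead,
    whose factor s^-N is at most a^-N. *)
Lemma integrable_dilate_prod v g (a b C r : R) : 0 < a -> locint v ->
  measurable_fun setT g -> (forall x, `|g x| <= C) -> (forall x, r <= `|x| -> g x = 0) ->
  (leb \x mu)%E.-integrable setT
    (EFin \o (fun z : measurableTypeR R * E =>
      (\1_(`[a, b]%classic : set R) (z.1 : R)) * (v ((z.1 : R) *: z.2) * g z.2))).
Proof.
move=> a0 lv mg gC gr; set chi := (\1_(`[a, b]%classic : set R) : R -> R).
have C0 : 0 <= C by exact: le_trans (gC 0).
have mF : measurable_fun setT (fun z : measurableTypeR R * E =>
      chi (z.1 : R) * (v ((z.1 : R) *: z.2) * g z.2)).
  apply: measurable_funM; first by apply: (measurableT_comp (f := chi)) => //; exact: measurable_indic.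
  apply: measurable_funM; last exact: (measurableT_comp mg).
  by apply: (measurableT_comp lv.1); exact: measurable_scale_pair.
apply/(integrable12ltyP leb mu); first exact/measurable_EFinP.
pose B : set E := [set y | `|y| < b * Num.max r 0].
have iB : mu.-integrable setT (EFin \o (fun y => v y * (C * \1_B y))).
  apply: (@locint_integrable _ _ v _ C (b * Num.max r 0)) => //.
  - by apply: measurable_funM => //; apply: measurable_indic; exact: measurable_rV_ball.
  - move=> x; rewrite indicE normrM (ger0_norm C0) ler_piMr//.
    by case: (_ \in _); rewrite ?normr0 ?normr1.
  - move=> x xr; rewrite indicE memNset ?mulr0// /B /= => xr'.
    by have := lt_le_trans xr' xr; rewrite ltxx.
pose M := (\int[mu]_y `|v y * (C * \1_B y)|%:E)%E.
have Moo : (M < +oo)%E by move: iB => /integrableP[].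
have M0 : (0 <= M)%E by apply: integral_ge0.
pose c := (a^-1 ^+ N)%:E; have c0 : (0 <= c)%E by rewrite lee_fin exprn_ge0// invr_ge0 ltW.
apply: (@le_lt_trans _ _ (\int[leb]_s (`|(chi s)%:E| * (c * M)))%E); last first.
  rewrite ge0_integralZr//; last 2 first.
  - by apply: measurableT_comp => //; apply/measurable_EFinP; exact: measurable_indic.
  - by rewrite mule_ge0.
  have /integrableP[_ ch] := @integrable_itv_indic R a b.
  apply: lte_mul_pinfty => //; first by apply: integral_ge0.
    by rewrite ge0_fin_numE//; apply: integral_ge0.
  by rewrite lte_mul_pinfty// ge0_fin_numE// ltry.
apply: ge0_le_integral => //.
- by move=> s _; apply: integral_ge0.
- have := @measurable_fun_fubini_tonelli_F _ _ (measurableTypeR R) E R mu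
    (fun z : measurableTypeR R * E => `|(chi (z.1 : R) * (v ((z.1 : R) *: z.2) * g z.2))%:E|%E).
  by apply => //; apply: measurableT_comp => //; exact/measurable_EFinP.
- apply: emeasurable_funM => //; apply: measurableT_comp => //.
  by apply/measurable_EFinP; exact: measurable_indic.
move=> s _ /=; have [sab|sab] := boolP (s \in (`[a, b]%classic : set R)); last first.
  rewrite /chi indicE (negbTE sab) normr0 mul0e.
  by under eq_integral do rewrite mul0r normr0; rewrite integral0.
have -> : chi s = 1 by rewrite /chi indicE sab.
rewrite normr1 mul1e; under eq_integral do rewrite mul1r.
move: sab; rewrite inE /= in_itv/= => /andP[sa sb]; have s0 : 0 < s by exact: lt_le_trans sa.
have ms : measurable_fun setT (fun y : E => v y * (C * \1_B y)).
  exact: integrable_measurable iB.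
rewrite /M (@ge0_integral_rV_affine R N s 0)//; last first.
  by apply/measurable_EFinP; exact: measurableT_comp.
have mss : measurable_fun setT (fun x : E => `|v (s *: x + 0) * (C * \1_B (s *: x + 0))|%:E).
  apply/measurable_EFinP; apply: measurableT_comp => //.
  exact: (measurableT_comp ms (measurable_affine s 0)).
rewrite muleA -EFinM -exprMn -ge0_integralZl//; last first.
  by rewrite lee_fin exprn_ge0// mulr_ge0// ?invr_ge0 ltW.
apply: ge0_le_integral => //.
- apply/measurable_EFinP; apply: measurableT_comp => //; apply: measurable_funM => //.
  have := measurableT_comp lv.1 (measurable_affine s (0 : E)).
  by apply: eq_measurable_fun => x _ /=; rewrite addr0.
- by apply: emeasurable_funM.
move=> x _; rewrite addr0 -EFinM lee_fin !normrM (ger0_norm C0).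
have as1 : 1 <= (a^-1 * s) ^+ N.
  by rewrite exprn_ege1// mulrC ler_pdivlMr// mul1r.
have [xr|xr] := ltP `|x| r; last first.
  rewrite gr// normr0 mulr0; apply: mulr_ge0; first exact: le_trans as1.
  by apply: mulr_ge0 => //; exact: mulr_ge0.
rewrite indicE mem_set; last first.
  rewrite /B /= normrZ ger0_norm ?(ltW s0)//.
  apply: le_lt_trans (_ : b * `|x| < _); first exact: ler_wpM2r.
  by rewrite ltr_pM2l ?(lt_le_trans s0)// lt_max xr.
rewrite normr1 mulr1 -[leLHS]mul1r; apply: ler_pM => //.
exact: ler_wpM2l.
Qed.

Lemma locint_local v : (forall r : R, mu.-integrable setT
    (EFin \o (fun x => v x * \1_[set y : E | `|y| < r] x))) -> locint v.
Proof.
move=> iv.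
have onB r : mu.-integrable [set y : E | `|y| < r] (EFin \o v).
  apply/(integrable_mkcond _ (measurable_rV_ball r)).
  apply: eq_integrable (iv r) => // x _ /=; rewrite patchE indicE.
  by case: (_ \in _); rewrite ?mulr1 ?mulr0.
split=> //; rewrite (_ : setT = \bigcup_n [set y : E | `|y| < n%:R]).
  apply/measurable_fun_bigcup => n; first exact: measurable_rV_ball.
  by have /integrableP[/measurable_EFinP] := onB n%:R.
apply/seteqP; split => // x _; exists (Num.bound `|x|) => //=.
exact: archi_boundP.
Qed.

(** Both sides agree when tested against functions vanishing near 0, by [wderiv0_flow] and Fubini;
    [locint_test0_eq0] turns this into a pointwise identity. *)
Lemma wderiv0_dilate_ae k u (us : 'I_N -> E -> R) (a b : R) : (0 < N)%N -> plateau k ->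
  0 < a < b -> locint u -> (forall i, locint (us i)) -> (forall i, wderiv0 i u (us i)) ->
  {ae mu, forall x, u (b *: x) - u (a *: x) =
    \int[leb]_(s in `[a, b]) \sum_i us i (s *: x) * x ord0 i}.
Proof.
move=> N0 pk /[dup] ab /andP[a0 ab'] lu lus uus; have b0 : 0 < b by exact: lt_trans ab'.
pose chi : R -> R := \1_(`[a, b]%classic : set R).
pose I x := \int[leb]_(s in `[a, b]) \sum_i us i (s *: x) * x ord0 i.
have ldil w (s : R) : 0 < s -> locint w -> locint (fun x => w (s *: x)).
  by move=> s0 lw; have := locint_affine 0 s0 lw; under eq_fun do rewrite addr0.
(* Fubini for the weight [g], which is an indicator function for the local
   integrability of [I] and a test function for the weak formulation. *)
have key (g : E -> R) (C r : R) : measurable_fun setT g -> (forall x, `|g x| <= C) ->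
    (forall x, r <= `|x| -> g x = 0) ->
    mu.-integrable setT (EFin \o (fun x => I x * g x)) /\
    \int[mu]_x (I x * g x) =
      \int[leb]_(s in `[a, b]) \sum_i \int[mu]_x (us i (s *: x) * (x ord0 i * g x)).
  move=> mg gC gr.
  have gi0 i x : r <= `|x| -> x ord0 i * g x = 0 by move=> /gr ->; rewrite mulr0.
  have mgi i : measurable_fun setT (fun x => x ord0 i * g x).
    by apply: measurable_funM => //; exact: measurable_rV_coord.
  have giC i x : `|x ord0 i * g x| <= `|r| * C.
    have C0 : 0 <= C by exact: le_trans (gC 0).
    have [xr|/gi0 ->] := ltP `|x| r; last by rewrite normr0 mulr_ge0.
    rewrite normrM ler_pM// (le_trans (le_coord_norm _ _))//.
    by rewrite (le_trans (ltW xr))// ler_norm.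
  pose Fi i (z : measurableTypeR R * E) : R :=
    chi z.1 * (us i ((z.1 : R) *: z.2) * (z.2 ord0 i * g z.2)).
  have iFi i : (leb \x mu)%E.-integrable setT (EFin \o Fi i).
    exact: integrable_dilate_prod a0 (lus i) (mgi i) (giC i) (gi0 i).
  have [iF _] := Rintegral_sum (index_enum 'I_N) iFi.
  have [_ i2 fub] := Rintegral_fubini iF.
  have E2 x : \int[leb]_s (\sum_i Fi i (s, x)) = I x * g x.
    rewrite /I mulrC Rintegral_itv_indic.
    have [gx0|gx0] := eqVneq (g x) 0.
      rewrite gx0 mul0r; under eq_Rintegral => s _.
        under eq_bigr do rewrite /Fi /= gx0 !mulr0; rewrite big1//; over.
      by rewrite Rintegral_cst// mul0r.
    rewrite -RintegralZl_measurable; last first.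
      apply: measurable_funM; first exact: measurable_indic.
      apply: measurable_sum => i; apply: measurable_funM => //.
      have mp : measurable_fun setT (fun s : measurableTypeR R => (s, x)).
        exact: measurable_fun_pair.
      exact: (measurableT_comp (lus i).1 (measurableT_comp measurable_scale_pair mp)).
    apply: eq_Rintegral => s _; rewrite mulrCA !mulr_sumr; apply: eq_bigr => i _.
    by rewrite /Fi /=; ring.
  split.
    by apply: eq_integrable i2 => // x _; rewrite /= E2.
  under eq_Rintegral do rewrite -E2.
  rewrite -fub [RHS]Rintegral_itv_indic; apply: eq_Rintegral => s _.
  have [sab|sab] := boolP (s \in (`[a, b]%classic : set R)); last first.
    rewrite indicE (negbTE sab) mul0r; under eq_Rintegral => x _.
      by under eq_bigr do rewrite /Fi /= /chi indicE (negbTE sab) mul0r; rewrite big1//; over.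
    by rewrite Rintegral_cst// mul0r.
  rewrite indicE sab mul1r.
  move: (sab); rewrite inE /= in_itv/= => /andP[sa sb]; have s0 : 0 < s by exact: lt_le_trans sa.
  have iG i : mu.-integrable setT (EFin \o (fun x => us i (s *: x) * (x ord0 i * g x))).
    exact: locint_integrable (ldil _ _ s0 (lus i)) (mgi i) (giC i) (gi0 i).
  rewrite -(Rintegral_sum _ iG).2; apply: eq_Rintegral => x _; apply: eq_bigr => i _.
  by rewrite /Fi /= /chi indicE sab mul1r.
have lI : locint I.
  apply: locint_local => r.
  apply: (key _ 1 r _ _ _).1.
  - by apply: measurable_indic; exact: measurable_rV_ball.
  - by move=> x; rewrite indicE; case: (_ \in _); rewrite ?normr0 ?normr1.
  - by move=> x xr; rewrite indicE memNset//= => /lt_le_trans /(_ xr); rewrite ltxx.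
have : {ae mu, forall x, (u (b *: x) + -1 * u (a *: x)) + -1 * I x = 0}.
  apply: (locint_test0_eq0 N0 pk).
    by apply: locintD; [apply: locintD; [|apply: locintZ]; exact: ldil|exact: locintZ].
  move=> g tg; have tg1 := tg.1; have [C C0 gC] := rtest_bounded tg1; have [_ [r gr]] := tg1.
  have mg : measurable_fun setT g by apply: continuous_measurable_rV; exact: rtest_continuous.
  have [iIg Ig] := key g C r mg gC gr.
  have i1 := locint_mul_rtest (ldil _ _ b0 lu) tg1.
  have i2 := locint_mul_rtest (ldil _ _ a0 lu) tg1.
  have i12 : mu.-integrable setT (EFin \o (fun x => u (b *: x) * g x - u (a *: x) * g x)).
    by have := integrableB measurableT i1 i2; apply: eq_integrable.
  transitivity (\int[mu]_x ((u (b *: x) * g x - u (a *: x) * g x) - I x * g x)).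
    by apply: eq_Rintegral => x _; ring.
  by rewrite RintegralB// RintegralB// (wderiv0_flow ab tg lu lus uus) Ig subrr.
apply: filterS => x /eqP; rewrite !mulN1r subr_eq0 => /eqP.
by [].
Qed.

End dilation_difference.

(** * Elementary inequalities for real powers *)

Section powR_inequalities.
Context {R : realType}.
Implicit Types (a b p d : R).

(** The point is the first constant, as close to 1 as desired at the expense of the second; the
    contractions below depend on it. Either b <= d a and the first term suffices, or a < b/d and the
    second one does. *)
Lemma powR_add_le p d a b : 0 <= p -> 0 < d -> 0 <= a -> 0 <= b ->
  (a + b) `^ p <= (1 + d) `^ p * a `^ p + (1 + d^-1) `^ p * b `^ p.
Proof.
move=> p0 d0 a0 b0; have d1 : 0 <= 1 + d by rewrite addr_ge0// ltW.
have d2 : 0 <= 1 + d^-1 by rewrite addr_ge0// invr_ge0 ltW.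
rewrite -!powRM//; have [bd|bd] := leP b (d * a).
  apply: (@le_trans _ _ (((1 + d) * a) `^ p)); last by rewrite lerDl powR_ge0.
  apply: ge0_ler_powR; rewrite ?nnegrE ?addr_ge0 ?mulr_ge0//.
  by rewrite mulrDl mul1r lerD2l.
apply: (@le_trans _ _ (((1 + d^-1) * b) `^ p)); last by rewrite lerDr powR_ge0.
apply: ge0_ler_powR; rewrite ?nnegrE ?addr_ge0 ?mulr_ge0//.
by rewrite mulrDl mul1r addrC lerD2l mulrC ler_pdivlMr// mulrC ltW.
Qed.

Lemma powR_sum_le (I : Type) (r : seq I) p : 0 < p ->
  exists2 C : R, 0 <= C & forall a : I -> R, (forall i, 0 <= a i) ->
    (\sum_(i <- r) a i) `^ p <= C * \sum_(i <- r) (a i) `^ p.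
Proof.
move=> p0; elim: r => [|i r [C C0 IH]].
  by exists 0 => // a _; rewrite !big_nil mul0r powR0 ?gt_eqF.
pose c : R := (1 + 1) `^ p; have c0 : 0 <= c by exact: powR_ge0.
exists (c + c * C) => [|a a0]; first by rewrite !addr_ge0 ?mulr_ge0.
rewrite !big_cons; apply: le_trans.
  by apply: (@powR_add_le p 1) => //; [exact: ltW|exact: sumr_ge0].
rewrite invr1 -/c mulrDr.
have S0 : 0 <= \sum_(j <- r) a j `^ p by apply: sumr_ge0 => j _; exact: powR_ge0.
have := ler_wpM2l c0 (IH a a0); have := powR_ge0 (a i) p.
set x := a i `^ p; set y := (\sum_(j <- r) a j) `^ p; set z := \sum_(j <- r) _ in S0 *.
move=> x0 yz; apply: lerD; first by rewrite ler_wpM2r// lerDl mulr_ge0.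
by apply: le_trans yz _; rewrite mulrA ler_wpM2r// lerDr.
Qed.

(** Jensen's inequality on an interval of length 1, up to a factor. With half the mean [A] of |k| as
    threshold, [young_powR] integrates to A <= A/2 + (A/2)^(1-p) X, that is (A/2)^p <= X. If [k] is
    not integrable, the left side is 0 by default. *)
Lemma powR_Rintegral_itv12_le (k : R -> R) p : (1 <= p)%R -> measurable_fun setT k ->
  ((`|\int[lebesgue_measure]_(s in `[(1%R : R), 2%R]) k s| `^ p)%R%:E <=
   (2 `^ p)%R%:E * \int[lebesgue_measure]_(s in `[(1%R : R), 2%R]) (`|k s| `^ p)%R%:E)%E.
Proof.
move=> p1 mk; have p0 : 0 < p by exact: lt_le_trans p1.
set J := `[(1 : R), 2]%classic.
have mJ : measurable (J : set (measurableTypeR R)) by exact: measurable_itv.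
have muJ : lebesgue_measure (J : set (measurableTypeR R)) = 1%E.
  rewrite /J lebesgue_measure_itv/= lte_fin ltr1n -EFinB; congr EFin.
  by rewrite addrK.
set X := (\int[lebesgue_measure]_(s in J) (`|k s| `^ p)%:E)%E.
have X0 : (0 <= X)%E by apply: integral_ge0 => s _; rewrite lee_fin powR_ge0.
have mkJ : measurable_fun (J : set (measurableTypeR R)) k by exact: measurable_funTS.
have [ik|nik] := pselect (lebesgue_measure.-integrable (J : set (measurableTypeR R)) (EFin \o k)); last first.
  have -> : \int[lebesgue_measure]_(s in J) k s = 0.
    rewrite Rintegral_mkcond; apply: Rintegral_not_integrable.
      by apply/(measurable_restrictT _ mJ).
    move=> H; apply: nik; apply/(integrable_mkcond _ mJ).
    by apply: eq_integrable H => // s _; rewrite /= /patch; case: ifP.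
  by rewrite normr0 powR0 ?gt_eqF// mule_ge0// lee_fin powR_ge0.
pose A := \int[lebesgue_measure]_(s in J) `|k s|.
have A0 : 0 <= A by exact: Rintegral_ge0.
have AE : A%:E = (\int[lebesgue_measure]_(s in J) `|k s|%:E)%E.
  rewrite /A /Rintegral fineK// ge0_fin_numE; last exact: integral_ge0.
  by move/integrableP: ik => [].
have kA : `|\int[lebesgue_measure]_(s in J) k s| <= A by exact: le_normr_Rintegral.
have [A00|Apos] := eqVneq A 0.
  have -> : `|\int[lebesgue_measure]_(s in J) k s| = 0.
    by apply/eqP; rewrite eq_le normr_ge0 andbT -A00.
  by rewrite powR0 ?gt_eqF// mule_ge0// lee_fin powR_ge0.
have {}Apos : 0 < A by rewrite lt_neqAle eq_sym Apos.
pose t := A / 2; have t0 : 0 < t by rewrite divr_gt0.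
have mkp : measurable_fun (J : set (measurableTypeR R)) (fun s => `|k s| `^ p).
  apply: (measurableT_comp (measurable_powR _)); exact: measurableT_comp.
have : (A%:E <= t%:E + (t `^ (1 - p))%:E * X)%E.
  rewrite AE; apply: (@le_trans _ _ (\int[lebesgue_measure]_(s in J) (t%:E + (t `^ (1 - p))%:E * (`|k s| `^ p)%:E))%E).
    apply: ge0_le_integral => //.
    - by apply/measurable_EFinP; exact: measurableT_comp.
    - apply: emeasurable_funD => //; apply: emeasurable_funM => //.
      exact/measurable_EFinP.
    - by move=> s _; rewrite -EFinM -EFinD lee_fin; exact: young_powR.
  rewrite ge0_integralD//; last 3 first.
  - by move=> s _; rewrite lee_fin ltW.
  - by move=> s _; rewrite -EFinM lee_fin mulr_ge0 ?powR_ge0.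
  - by apply: emeasurable_funM => //; exact/measurable_EFinP.
  rewrite integral_cst// (_ : (_ * _)%E = t%:E); last first.
    by rewrite -[RHS]mule1; congr (_ * _)%E; exact: muJ.
  rewrite leeD2l// ge0_integralZl//.
  - exact/measurable_EFinP.
  - by rewrite lee_fin powR_ge0.
have At : A = t + t by rewrite /t -splitr.
have [->|Xfin] := eqVneq X +oo%E.
  by move=> _; rewrite gt0_muley ?leey// ?lte_fin ?powR_gt0.
have {}Xfin : X \is a fin_num by rewrite ge0_fin_numE// ltey.
rewrite -(fineK Xfin) -!EFinM -EFinD !lee_fin At lerD2l => tX.
apply: (@le_trans _ _ (A `^ p)).
  by apply: ge0_ler_powR; rewrite ?nnegrE ?(ltW p0).
have -> : A `^ p = 2 `^ p * t `^ p by rewrite -powRM ?(ltW t0)// mulr_natl mulr2n -At.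
apply: ler_wpM2l; first exact: powR_ge0.
have t1p : 0 < t `^ (1 - p) by exact: powR_gt0.
rewrite -(ler_pM2l t1p) (le_trans _ tX)// -powRD; last by rewrite (gt_eqF t0) implybT.
by rewrite subrK powRr1// ltW.
Qed.

End powR_inequalities.

(** * Hardy inequalities *)

Lemma measurable_powR_norm d (T : measurableType d) (R : realType) (p : R)
    (D : set T) (v : T -> R) : measurable_fun D v ->
  measurable_fun D (fun x => `|v x| `^ p).
Proof.
by move=> mv; apply: (measurableT_comp (measurable_powR _)); exact: measurableT_comp.
Qed.

Section hardy.
Context {R : realType} {N : nat}.
Local Notation E := 'rV[R]_N.
Local Notation mu := (lebesgue_rV N : {sigma_finite_measure set E -> \bar R}).
Local Notation leb := (lebesgue_measure : {sigma_finite_measure set (measurableTypeR R) -> \bar R}).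
Implicit Types (x y : E) (u v w W : E -> R) (us : 'I_N -> E -> R) (p b M : R).

Definition wint p W v := (\int[mu]_x (W x * `|v x| `^ p)%:E)%E.

Lemma measurable_wint p W v : measurable_fun setT W -> measurable_fun setT v ->
  measurable_fun setT (fun x => (W x * `|v x| `^ p)%:E).
Proof.
by move=> mW mv; apply/measurable_EFinP/measurable_funM => //; exact: measurable_powR_norm.
Qed.

Lemma wint_ge0 p W v : (forall x, 0 <= W x) -> (0 <= wint p W v)%E.
Proof. by move=> W0; apply: integral_ge0 => x _; rewrite lee_fin mulr_ge0 ?powR_ge0. Qed.

Lemma le_wint p W W' v v' : measurable_fun setT W -> measurable_fun setT v ->
  measurable_fun setT W' -> measurable_fun setT v' -> (forall x, 0 <= W x) ->
  (forall x, W x * `|v x| `^ p <= W' x * `|v' x| `^ p) -> (wint p W v <= wint p W' v')%E.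
Proof.
move=> mW mv mW' mv' W0 H; apply: ge0_le_integral => //.
- by move=> x _; rewrite lee_fin mulr_ge0 ?powR_ge0.
- exact: measurable_wint.
- exact: measurable_wint.
- by move=> x _; rewrite lee_fin.
Qed.

Lemma wintZ p W v (c : R) : 0 <= c -> measurable_fun setT W -> measurable_fun setT v ->
  (forall x, 0 <= W x) -> wint p (fun x => c * W x) v = (c%:E * wint p W v)%E.
Proof.
move=> c0 mW mv W0; rewrite /wint; under eq_integral do rewrite -mulrA EFinM.
rewrite ge0_integralZl//; first exact: measurable_wint.
by move=> x _; rewrite lee_fin mulr_ge0 ?powR_ge0.
Qed.

Lemma wintD p W W' v : measurable_fun setT W -> measurable_fun setT W' ->
  measurable_fun setT v -> (forall x, 0 <= W x) -> (forall x, 0 <= W' x) ->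
  wint p (fun x => W x + W' x) v = (wint p W v + wint p W' v)%E.
Proof.
move=> mW mW' mv W0 W0'; rewrite /wint; under eq_integral do rewrite mulrDl EFinD.
by rewrite ge0_integralD//; try (exact: measurable_wint); move=> x _;
  rewrite lee_fin mulr_ge0 ?powR_ge0.
Qed.

Lemma wint_dilate p W v (s : R) : 0 < s -> measurable_fun setT W -> measurable_fun setT v ->
  (forall x, 0 <= W x) ->
  wint p (fun x => W (s *: x)) (fun x => v (s *: x)) = ((s^-1 ^+ N)%:E * wint p W v)%E.
Proof.
move=> s0 mW mv W0; rewrite /wint (@ge0_integral_rV_affine R N s 0 (fun x => (W x * `|v x| `^ p)%:E))//.
- rewrite muleA -EFinM -exprMn mulVf ?gt_eqF// expr1n mul1e.
  by under [RHS]eq_integral do rewrite addr0.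
- exact: measurable_wint.
- by move=> x; rewrite lee_fin mulr_ge0 ?powR_ge0.
Qed.

Lemma measurable_dilate v (s : R) : measurable_fun setT v ->
  measurable_fun setT (fun x => v (s *: x)).
Proof.
move=> mv; have := measurableT_comp mv (measurable_affine s (0 : E)).
by apply: eq_measurable_fun => x _ /=; rewrite addr0.
Qed.

Lemma wint_tri p W u v w (d : R) : 1 <= p -> 0 < d -> measurable_fun setT W ->
  measurable_fun setT u -> measurable_fun setT v -> measurable_fun setT w ->
  (forall x, 0 <= W x) -> (forall x, `|u x| <= `|v x| + `|w x|) ->
  (wint p W u <= ((1 + d) `^ p)%:E * wint p W v + ((1 + d^-1) `^ p)%:E * wint p W w)%E.
Proof.
move=> p1 d0 mW mu_ mv mw W0 uvw.
have mcW (c : R) : measurable_fun setT (fun x => c * W x) by exact: measurable_funM.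
rewrite -!wintZ ?powR_ge0// /wint -ge0_integralD//;
  try (exact: measurable_wint); try (by move=> x _; rewrite lee_fin !mulr_ge0 ?powR_ge0).
apply: ge0_le_integral => //.
- by move=> x _; rewrite lee_fin mulr_ge0 ?powR_ge0.
- exact: measurable_wint.
- by apply: emeasurable_funD; apply: measurable_wint => //; exact: measurable_funM.
move=> x _; rewrite -EFinD lee_fin [_ * W x]mulrC [X in _ <= _ + X * _]mulrC -!mulrA -mulrDr.
apply: ler_wpM2l => //; apply: le_trans (powR_add_le _ d0 _ _) => //.
  apply: ge0_ler_powR; rewrite ?nnegrE ?addr_ge0 ?(le_trans _ p1)//.
by rewrite (le_trans _ p1).
Qed.

(** The p-th power is taken inside the integral over [s] in [1, 2], the hypothesis on the weights
    absorbs |x|^p, and for each [s] the substitution y = s x contributes s^-N <= 1. The constant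
    depends neither on [u] nor on the weights. *)
Lemma dilation_estimate (k : E -> R) p : (0 < N)%N -> plateau k -> 1 <= p ->
  exists2 C : R, 0 <= C & forall u us W W2, locint u -> (forall i, locint (us i)) ->
    (forall i, wderiv0 i u (us i)) -> measurable_fun setT W -> measurable_fun setT W2 ->
    (forall x, 0 <= W x) -> (forall x, 0 <= W2 x) ->
    (forall x (s : R), 1 <= s <= 2 -> W x * `|x| `^ p <= W2 (s *: x)) ->
    (wint p W (fun x => u (2 *: x) - u x)%R <= C%:E * \sum_i wint p W2 (us i))%E.
Proof.
move=> N0 pk p1; have p0 : 0 < p by exact: lt_le_trans p1.
have [C1 C10 HC1] := @powR_sum_le R _ (index_enum 'I_N) p p0.
exists (2 `^ p * C1) => [|u us W W2 lu lus uus mW mW2 W0 W20 WW2].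
  by rewrite mulr_ge0 ?powR_ge0.
have ae1 := wderiv0_dilate_ae N0 pk (a := 1) (b := 2) ltac:(by rewrite ltr01 ltr1n) lu lus uus.
pose J : set (measurableTypeR R) := `[(1 : R), 2]%classic.
have mJ : measurable J by exact: measurable_itv.
pose chi : R -> R := \1_(`[(1 : R), 2]%classic : set R).
have chi0 s : 0 <= chi s by rewrite /chi.
have mchi : measurable_fun setT (fun z : measurableTypeR R * E => chi z.1).
  by apply: (measurableT_comp (f := chi)) => //; exact: measurable_indic.
pose G i (z : measurableTypeR R * E) : \bar R :=
  (chi z.1 * (W2 ((z.1 : R) *: z.2) * `|us i ((z.1 : R) *: z.2)| `^ p))%:E.
have mG i : measurable_fun setT (G i).
  apply/measurable_EFinP; apply: measurable_funM => //.
  apply: measurable_funM; first exact: (measurableT_comp mW2 measurable_scale_pair).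
  apply: (measurableT_comp (f := fun x => `|us i x| `^ p)); last exact: measurable_scale_pair.
  apply: measurable_powR_norm; exact: (lus i).1.
have G0 i z : (0 <= G i z)%E by rewrite lee_fin !mulr_ge0 ?powR_ge0.
have mGx i x : measurable_fun setT (fun s : measurableTypeR R => G i (s, x)).
  by apply: (measurableT_comp (mG i)); exact: measurable_fun_pair.
have mGF i : measurable_fun setT (fun x => \int[leb]_s G i (s, x))%E.
  by apply: (@measurable_fun_fubini_tonelli_G _ _ (measurableTypeR R) E R leb (G i)).
have c0 : (0 <= (2 `^ p * C1)%:E)%E by rewrite lee_fin mulr_ge0 ?powR_ge0.
apply: (@le_trans _ _ (\int[mu]_x ((2 `^ p * C1)%:E * \sum_i \int[leb]_s G i (s, x)))%E).
  have mS : measurable_fun setT (fun x => (2 `^ p * C1)%:E * \sum_i \int[leb]_s G i (s, x))%E.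
    by apply: emeasurable_funM => //; exact: emeasurable_sum.
  have mL : measurable_fun setT (fun x => (W x * `|u (2 *: x) - u x| `^ p)%:E).
    apply: measurable_wint => //; apply: measurable_funB; last exact: lu.1.
    by apply: measurable_dilate; exact: lu.1.
  apply: ae_ge0_le_integral => //.
  - by move=> x _; rewrite lee_fin mulr_ge0 ?powR_ge0.
  - by move=> x _; rewrite mule_ge0// sume_ge0// => i _; exact: integral_ge0.
  move: ae1; apply: filterS => x + _; rewrite scale1r => ->.
  have mk : measurable_fun setT (fun s : R => \sum_i us i (s *: x) * x ord0 i).
    apply: measurable_sum => i; apply: measurable_funM => //.
    have mp : measurable_fun setT (fun s : measurableTypeR R => (s, x)).
      exact: measurable_fun_pair.
    exact: (measurableT_comp (lus i).1 (measurableT_comp measurable_scale_pair mp)).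
  have H1 := powR_Rintegral_itv12_le p1 mk.
  have K1 : (W x)%:E \is a fin_num by [].
  rewrite EFinM; apply: le_trans (lee_wpmul2l _ H1) _; first by rewrite lee_fin.
  rewrite muleCA EFinM -muleA; apply: lee_wpmul2l; first by rewrite lee_fin powR_ge0.
  rewrite -ge0_integral_sum// -!ge0_integralZl//;
    try (by apply/measurable_EFinP/measurable_funTS/measurable_powR_norm);
    try (by apply: emeasurable_sum); try (by move=> s _; rewrite lee_fin powR_ge0);
    try (by move=> s _; apply: sume_ge0 => i _); try (by rewrite lee_fin).
  rewrite integral_mkcond; apply: ge0_le_integral => //.
  - by move=> s _; rewrite patchE; case: ifP => // _; rewrite -EFinM lee_fin mulr_ge0 ?powR_ge0.
  - apply/(measurable_restrictT _ mJ)/measurable_funTS; apply: emeasurable_funM => //.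
    by apply/measurable_EFinP/measurable_powR_norm.
  - by apply: emeasurable_funM => //; apply: emeasurable_sum.
  move=> s _; rewrite patchE; case: ifPn => sJ; last first.
    by rewrite mule_ge0// sume_ge0.
  move: (sJ); rewrite inE /J /= in_itv/= => s12.
  rewrite /G /= sumEFin -!EFinM lee_fin.
  have -> : chi s = 1 by rewrite /chi indicE sJ.
  under [X in _ <= _ * X]eq_bigr do rewrite mul1r.
  apply: (@le_trans _ _ (W x * (C1 * \sum_i (`|us i (s *: x)| * `|x|) `^ p))).
    apply: ler_wpM2l => //; apply: le_trans (HC1 (fun i => `|us i (s *: x)| * `|x|) _); last first.
      by move=> i; exact: mulr_ge0.
    apply: ge0_ler_powR; rewrite ?nnegrE ?(ltW p0)//; first by apply: sumr_ge0 => i _; exact: mulr_ge0.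
    apply: le_trans (ler_norm_sum _ _ _) _; apply: ler_sum => i _.
    rewrite normrM; apply: ler_wpM2l => //; exact: le_coord_norm.
  rewrite mulrCA; apply: ler_wpM2l => //; rewrite mulr_sumr; apply: ler_sum => i _.
  by rewrite powRM// mulrCA mulrC; apply: ler_wpM2r; [exact: powR_ge0|exact: WW2].
rewrite ge0_integralZl//; last 2 first.
- exact: emeasurable_sum.
- by move=> x _; apply: sume_ge0 => i _; exact: integral_ge0.
apply: lee_wpmul2l => //; rewrite ge0_integral_sum//; last first.
  by move=> i x _; exact: integral_ge0.
apply: lee_sum => i _; rewrite -(fubini_tonelli (m1 := leb) (m2 := mu) (G i))//.
have w0 := wint_ge0 p (us i) W20.
have E1 s : chi s != 0 -> (\int[mu]_x G i (s, x) <= wint p W2 (us i))%E.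
  rewrite /chi indicE; case: (boolP (_ \in _)) => [|_]; last by rewrite eqxx.
  move=> sJ _; move: (sJ); rewrite inE /= in_itv/= => /andP[s1 s2].
  have s0 : 0 < s by exact: lt_le_trans s1.
  rewrite [leLHS](_ : _ = ((s^-1 ^+ N)%:E * wint p W2 (us i))%E); last first.
    rewrite -wint_dilate//; last exact: (lus i).1.
    by apply: eq_integral => x _; rewrite /G /= /chi indicE sJ mul1r.
  rewrite -[leRHS]mul1e; apply: lee_wpmul2r => //; rewrite lee_fin.
  by rewrite exprn_ile1// ?invr_ge0 ?(ltW s0)// invf_le1.
apply: (@le_trans _ _ (\int[leb]_s ((chi s)%:E * wint p W2 (us i)))%E).
  have mchi1 : measurable_fun setT chi by exact: measurable_indic.
  apply: ge0_le_integral => //.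
  - by move=> s _; exact: integral_ge0.
  - by apply: (@measurable_fun_fubini_tonelli_F _ _ (measurableTypeR R) E R mu (G i)).
  - by apply: emeasurable_funM => //; exact/measurable_EFinP.
  move=> s _; have [c0s|/E1 E1s] := eqVneq (chi s) 0.
    by rewrite c0s mul0e /fubini_F; under eq_integral do rewrite /G /= c0s mul0r; rewrite integral0.
  have : chi s = 0 \/ chi s = 1 by rewrite /chi indicE; case: (_ \in _); [right|left].
  move=> [c0s|->]; last by rewrite mul1e.
  by rewrite c0s mul0e /fubini_F; under eq_integral do rewrite /G /= c0s mul0r; rewrite integral0.
rewrite ge0_integralZr//; last 2 first.
- by apply/measurable_EFinP; exact: measurable_indic.
- by move=> s _; rewrite lee_fin.
rewrite integral_indic// setIT.
have H : lebesgue_measure (`[(1 : R), 2]%classic : set (measurableTypeR R)) = 1%E.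
  rewrite lebesgue_measure_itv/= lte_fin ltr1n -EFinB; congr EFin.
  by rewrite addrK.
rewrite -[leRHS]mul1e; apply: lee_wpmul2r => //.
by rewrite -H.
Qed.

End hardy.

Section hardy_inequalities.
Context {R : realType} {N : nat}.
Local Notation E := 'rV[R]_N.
Local Notation mu := (lebesgue_rV N : {sigma_finite_measure set E -> \bar R}).
Implicit Types (x y : E) (u v w W : E -> R) (us : 'I_N -> E -> R) (p b r g : R).

Lemma fatou_le (f_ : nat -> E -> R) (f : E -> R) (L : \bar R) :
  (forall n, measurable_fun setT (f_ n)) -> (forall n x, 0 <= f_ n x) ->
  (forall x, (fun n => f_ n x) @ \oo --> f x) ->
  (forall n, (\int[mu]_x (f_ n x)%:E <= L)%E) -> (\int[mu]_x (f x)%:E <= L)%E.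
Proof.
move=> mf f0 ff fL; have mfE n : measurable_fun setT (EFin \o f_ n) by exact/measurable_EFinP.
have f0E : forall n x, setT x -> (0 <= (EFin \o f_ n) x)%E by move=> n x _ /=; rewrite lee_fin.
have := @fatou _ _ R mu setT measurableT (fun n => EFin \o f_ n) mfE f0E.
under eq_integral => x _.
  have -> : limn_einf (fun n => (EFin \o f_ n) x) = (f x)%:E.
    have cv : (fun n => (EFin \o f_ n) x) @ \oo --> (f x)%:E.
      by apply: cvg_EFin (ff x); exact: nearW.
    by rewrite (cvg_limn_einf_sup cv).
  over.
move=> /le_trans; apply; rewrite limn_einf_lim; apply: lime_le; first exact: is_cvg_einfs.
apply: nearW => n; apply: le_trans (fL n); apply: ereal_inf_lbound => /=.
by exists n => //=.
Qed.

(** Continuity of the power is drawn from its differentiability at positive arguments; at the limit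
    0 the bound t^p <= t on [0, 1] squeezes instead. *)
Lemma cvg_norm_powR (s : nat -> R) (l p : R) : 1 <= p -> s @ \oo --> l ->
  (fun n => `|s n| `^ p) @ \oo --> `|l| `^ p.
Proof.
move=> p1 sl; have p0 : 0 < p by exact: lt_le_trans p1.
have nsl : (fun n => `|s n|) @ \oo --> `|l| by exact: cvg_norm.
have [l0|l0] := eqVneq l 0; last first.
  have l1 : 0 < `|l| by rewrite normr_gt0.
  have cp : {for `|l|, continuous (fun t : R => t `^ p)}.
    apply: differentiable_continuous; apply/derivable1_diffP; apply: derivable_powR.
    by rewrite in_itv/= l1.
  exact: (@cvg_comp _ _ _ _ (fun t : R => t `^ p) _ _ _ nsl cp).
rewrite l0 normr0 powR0 ?gt_eqF//; rewrite l0 normr0 in nsl.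
apply: (squeeze_cvgr _ (cvg_cst (0 : R)) nsl).
  near=> n; rewrite powR_ge0/=; have [->|sn0] := eqVneq (s n) 0.
    by rewrite normr0 powR0 ?gt_eqF.
  apply: ge1r_powR => //; rewrite normr_gt0 sn0/=; near: n.
  move/cvgrPdist_lt : nsl => /(_ 1 ltr01); apply: filterS => n.
  by rewrite sub0r normrN normr_id => /ltW.
Unshelve. all: by end_near. Qed.

(** At the origin the value is 0 for every nonzero exponent, negative ones included. *)
Definition hw (g r : R) : E -> R := fun x => \1_[set y : E | `|y| < r] x * `|x| `^ g.

Lemma hw_ge0 g r x : 0 <= hw g r x.
Proof. by rewrite mulr_ge0 ?powR_ge0. Qed.

Lemma measurable_norm_powR g : measurable_fun setT (fun x : E => `|x| `^ g).
Proof. exact: (measurableT_comp (measurable_powR _) measurable_rV_norm). Qed.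

Lemma measurable_hw g r : measurable_fun setT (hw g r).
Proof.
apply: measurable_funM; first by apply: measurable_indic; exact: measurable_rV_ball.
exact: measurable_norm_powR.
Qed.

Lemma ball_indicE r x : \1_[set y : E | `|y| < r] x = (`|x| < r)%R%:R :> R.
Proof. by rewrite indicE; congr (nat_of_bool _)%:R; apply/idP/idP; rewrite inE. Qed.

(** Subtracting [t * X] from both sides requires [X] to be finite; the truncated weights exist for
    this purpose. *)
Let absorb (X Y D : \bar R) (t : R) : 0 <= t < 1 -> (0 <= X)%E -> (X < +oo)%E ->
  (0 <= Y)%E -> (Y < +oo)%E -> (0 <= D)%E -> (D < +oo)%E ->
  (X <= t%:E * (X + Y) + D)%E -> (X <= ((1 - t)^-1)%:E * (t%:E * Y + D))%E.
Proof.
move=> /andP[t0 t1]; case: X => [X| |] // _ _; case: Y => [Y| |] // _ _; case: D => [D| |] // _ _.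
rewrite -!EFinM -?EFinD ?lee_fin => H.
rewrite mulrC ler_pdivlMr ?subr_gt0//; lra.
Qed.

Let gt1_two_powR (a : R) : 0 < a -> 1 < 2 `^ a.
Proof. by move=> a0; rewrite /powR pnatr_eq0 expR_gt1 mulr_gt0// ln_gt0// ltr1n. Qed.

(** The norms of [x] and [s *: x] differ by a factor between 1 and 2, so the change of argument
    costs a power of 2; the absolute value covers both signs of [(1 - b) * p]. *)
Let weight_bound (b p : R) x (s : R) : 1 <= p -> 1 <= s <= 2 ->
  hw (- (b * p)) 1 x * `|x| `^ p <=
  2 `^ `|(1 - b) * p| * hw ((1 - b) * p) 2 (s *: x).
Proof.
move=> p1 /andP[s1 s2]; have p0 : 0 < p by exact: lt_le_trans p1.
have s0 : 0 < s by exact: lt_le_trans s1.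
rewrite /hw !ball_indicE /= [`|s *: x|]normrZ [`|s|]ger0_norm ?(ltW s0)//.
have [x1|x1] := ltP `|x| 1; last by rewrite !mul0r !mulr_ge0 ?powR_ge0.
have [x0|xn0] := eqVneq `|x| 0.
  by rewrite x0 [0 `^ p]powR0 ?gt_eqF// mulr0 !mulr_ge0 ?powR_ge0.
have xs : s * `|x| < 2.
  by apply: le_lt_trans (_ : 2 * `|x| < _); [rewrite ler_wpM2r|rewrite gtr_pMr].
rewrite xs !mul1r -powRD; last by rewrite xn0 implybT.
have -> : - (b * p) + p = (1 - b) * p by ring.
rewrite powRM ?(ltW s0)// mulrA -[leLHS]mul1r ler_wpM2r ?powR_ge0//.
apply: (@le_trans _ _ (s `^ `|(1 - b) * p| * s `^ ((1 - b) * p))); last first.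
  rewrite ler_wpM2r ?powR_ge0//; apply: ge0_ler_powR; rewrite ?nnegrE ?(ltW s0)//.
rewrite -powRD; last by rewrite (gt_eqF s0) implybT.
rewrite -(powRr0 s); apply: ler_powR => //.
by rewrite -lerBlDr sub0r -normrN ler_norm.
Qed.

(** Capping the weight at [n] makes the weighted norm finite beforehand; the resulting bound is
    independent of [n] and passes to the limit by Fatou's lemma. *)
Definition trunc_weight (b p : R) (n : nat) : E -> R :=
  fun x => \1_[set y : E | `|y| < 1] x * Num.min (`|x| `^ (- (b * p))) n%:R.

Lemma trunc_weight_ge0 b p n x : 0 <= trunc_weight b p n x.
Proof. by rewrite mulr_ge0// le_min powR_ge0 ler0n. Qed.

Lemma measurable_trunc_weight b p n : measurable_fun setT (trunc_weight b p n).
Proof.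
apply: measurable_funM; first by apply: measurable_indic; exact: measurable_rV_ball.
by apply: measurable_minr => //; exact: measurable_norm_powR.
Qed.

Lemma measurable_ball_indic r : measurable_fun setT (\1_[set y : E | `|y| < r] : E -> R).
Proof. by apply: measurable_indic; exact: measurable_rV_ball. Qed.

(** Halving the argument doubles the ball. Inside the unit ball homogeneity gives the factor; on the
    annulus 1 <= |x| < 2 the new weight is at most that factor and is charged to the indicator. *)
Lemma trunc_weight_half b p n x : 0 <= b * p ->
  trunc_weight b p n (2^-1 *: x) <=
  2 `^ (b * p) * (trunc_weight b p n x + \1_[set y : E | `|y| < 2] x).
Proof.
move=> bp0; rewrite /trunc_weight.
have c1 : 1 <= 2 `^ (b * p).
  by rewrite -[leLHS](powRr0 2); apply: ler_powR; rewrite ?ler1n.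
rewrite !ball_indicE normrZ ger0_norm ?invr_ge0//.
have [x2|x2] := ltP (2^-1 * `|x|) 1; last first.
  by rewrite mul0r mulr_ge0 ?powR_ge0// addr_ge0// mulr_ge0// le_min powR_ge0 ler0n.
rewrite mul1r; have -> : `|x| < 2 by rewrite -(ltr_pM2l (x := 2^-1)) ?invr_gt0// mulVf.
rewrite powRM ?invr_ge0//.
have -> : 2^-1 `^ (- (b * p)) = 2 `^ (b * p) :> R.
  by rewrite -powR_inv1// -powRrM mulN1r opprK.
have [x1|x1] := ltP `|x| 1.
  rewrite mul1r mulrDr mulr1; apply: (@le_trans _ _ (2 `^ (b * p) * Num.min (`|x| `^ (- (b * p))) n%:R)); last by rewrite lerDl powR_ge0.
  rewrite minr_pMr ?powR_ge0// le_min ge_min lexx/= ge_min.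
  by apply/orP; right; rewrite ler_peMl.
rewrite mul0r add0r mulr1 ge_min; apply/orP; left.
rewrite ler_piMr ?powR_ge0// -[leRHS](powRr0 `|x|); apply: ler_powR => //.
by rewrite oppr_le0.
Qed.

(** u(x) is u(2x) minus the increment; substituting in the first term brings 2^-N from the measure
    and 2^(bp) from the weight. *)
Let trunc_step (b p d : R) n u : 1 <= p -> 0 <= b -> 0 < d -> measurable_fun setT u ->
  (wint p (trunc_weight b p n) u <=
   (((1 + d) `^ p) * (2^-1 ^+ N * 2 `^ (b * p)))%R%:E *
     (wint p (trunc_weight b p n) u + wint p \1_[set y : E | (`|y| < 2)%R] u) +
   ((1 + d^-1) `^ p)%R%:E * wint p (trunc_weight b p n) (fun x => u (2 *: x) - u x)%R)%E.
Proof.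
move=> p1 b0 d0 mu1; have p0 : 0 < p by exact: lt_le_trans p1.
have mW := measurable_trunc_weight b p n; have W0 := trunc_weight_ge0 b p n.
have mu2 := measurable_dilate 2 mu1; have mB := measurable_ball_indic 2.
have mud : measurable_fun setT (fun x => u (2 *: x) - u x) := measurable_funB mu2 mu1.
apply: le_trans (wint_tri p1 d0 mW mu1 mu2 mud W0 _) _.
  by move=> x; rewrite -{1}(subKr (u (2 *: x)) (u x)) ler_normB.
apply: leeD2r.
have mV : measurable_fun setT (fun x => trunc_weight b p n (2^-1 *: x)) := measurable_dilate _ mW.
have EV : (fun x => trunc_weight b p n (2^-1 *: (2 *: x))) = trunc_weight b p n.
  by apply/funext => x; rewrite scalerA mulVf ?pnatr_eq0// scale1r.
have V0 x : 0 <= trunc_weight b p n (2^-1 *: x) by exact: W0.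
have := @wint_dilate _ _ p _ u 2 (ltr0Sn _ _) mV mu1 V0; rewrite EV => ->.
have mS : measurable_fun setT (fun x => trunc_weight b p n x + \1_[set y : E | `|y| < 2] x).
  exact: measurable_funD mW mB.
have S0 x : 0 <= trunc_weight b p n x + \1_[set y : E | `|y| < 2] x by rewrite addr_ge0.
have H1 : (wint p (fun x => trunc_weight b p n (2^-1 *: x)) u <=
    (2 `^ (b * p))%:E * (wint p (trunc_weight b p n) u + wint p \1_[set y : E | (`|y| < 2)%R] u))%E.
  have B0 : forall x, 0 <= \1_[set y : E | `|y| < 2] x :> R by [].
  rewrite -(wintD p mW mB mu1 W0 B0) -(wintZ p (powR_ge0 _ _) mS mu1 S0).
  apply: (le_wint mV mu1 _ mu1 V0); first exact: measurable_funM.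
  move=> x; apply: ler_wpM2r; first exact: powR_ge0.
  by apply: trunc_weight_half; rewrite mulr_ge0// ltW.
rewrite EFinM -muleA; apply: lee_wpmul2l; first by rewrite lee_fin powR_ge0.
rewrite EFinM -muleA; apply: lee_wpmul2l; first by rewrite lee_fin exprn_ge0// invr_ge0.
exact: H1.
Qed.

Lemma hardy_subcritical (k : E -> R) p b u us : (0 < N)%N -> plateau k -> 1 <= p ->
  0 <= b -> b * p < N%:R -> locint u -> (forall i, locint (us i)) ->
  (forall i, wderiv0 i u (us i)) ->
  (wint p \1_[set y : E | (`|y| < 2)%R] u < +oo)%E ->
  (forall i, (wint p (hw ((1 - b) * p)%R 2) (us i) < +oo)%E) ->
  (wint p (hw (- (b * p))%R 1) u < +oo)%E.
Proof.
move=> N0 pk p1 b0 bpN lu lus uus Y1 us1; have p0 : 0 < p by exact: lt_le_trans p1.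
have [C C0 HC] := dilation_estimate N0 pk p1.
have mu1 := lu.1.
have [D [D0 D1 HD]] : exists D : \bar R, [/\ (0 <= D)%E, (D < +oo)%E &
    forall n, (wint p (trunc_weight b p n) (fun x => u (2 *: x) - u x)%R <= D)%E].
  pose K : R := 2 `^ `|(1 - b) * p|.
  have K0 : 0 <= K by exact: powR_ge0.
  have mW2 : measurable_fun setT (fun x => K * hw ((1 - b) * p) 2 x).
    by apply: measurable_funM => //; exact: measurable_hw.
  have W20 x : 0 <= K * hw ((1 - b) * p) 2 x by rewrite mulr_ge0// hw_ge0.
  exists (C%:E * \sum_i wint p (fun x => K * hw ((1 - b) * p) 2 x)%R (us i))%E; split.
  - by apply: mule_ge0; [rewrite lee_fin|apply: sume_ge0 => i _; exact: wint_ge0].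
  - apply: lte_mul_pinfty; [by rewrite lee_fin|by []|apply: lte_sum_pinfty => i _].
    rewrite (wintZ p K0 (measurable_hw _ _) (lus i).1 (hw_ge0 _ _)).
    by apply: lte_mul_pinfty; [rewrite lee_fin|by []|exact: us1].
  move=> n; apply: (HC _ _ _ _ lu lus uus (measurable_trunc_weight _ _ _) mW2
    (trunc_weight_ge0 _ _ _) W20).
  move=> x s s12; apply: le_trans (weight_bound b x p1 s12); apply: ler_wpM2r.
    exact: powR_ge0.
  by rewrite /trunc_weight /hw ler_wpM2l// ge_min lexx.
have Y0 : (0 <= wint p \1_[set y : E | (`|y| < 2)%R] u)%E by apply: wint_ge0 => x.
set Y := wint p _ u in Y0 Y1.
(* Half of the gap N - bp is spent on the triangle inequality, where (1 + d)^p = 2^a; the other half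
   remains, so that the contraction factor is 2^(a - 2a) = 2^(-a). *)
pose a := (N%:R - b * p) / 2; have a0 : 0 < a by rewrite divr_gt0// subr_gt0.
pose d := 2 `^ (a / p) - 1; have d0 : 0 < d by rewrite subr_gt0 gt1_two_powR// divr_gt0.
pose t : R := 2 `^ (- a).
have t01 : 0 <= t < 1.
  by rewrite powR_ge0/= /t powRN invf_lt1 ?gt1_two_powR// powR_gt0.
have tE : (1 + d) `^ p * (2^-1 ^+ N * 2 `^ (b * p)) = t.
  rewrite /d subrKC -powRrM divfK ?gt_eqF//.
  rewrite -powR_inv1// -powR_mulrn ?powR_ge0// -powRrM mulN1r -!powRD; try (by rewrite pnatr_eq0 implybT).
  by rewrite /t /a; congr (_ `^ _); field.
pose D' := (((1 + d^-1) `^ p)%:E * D)%E.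
have D'0 : (0 <= D')%E by apply: mule_ge0; [rewrite lee_fin powR_ge0|].
have D'1 : (D' < +oo)%E by apply: lte_mul_pinfty; [rewrite lee_fin powR_ge0|by []|].
have X1 n : (wint p (trunc_weight b p n) u < +oo)%E.
  apply: (@le_lt_trans _ _ (n%:R%:E * Y)%E); last by apply: lte_mul_pinfty; [rewrite lee_fin|by []|].
  have mB := measurable_ball_indic 2.
  rewrite -(wintZ p (ler0n _ n) mB mu1 (fun x => _))//.
  apply: (le_wint (measurable_trunc_weight _ _ _) mu1 _ mu1 (trunc_weight_ge0 _ _ _)).
    exact: measurable_funM.
  move=> x; apply: ler_wpM2r; first exact: powR_ge0.
  rewrite /trunc_weight !ball_indicE; have [x1|x1] := ltP `|x| 1; last by rewrite mul0r mulr_ge0.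
  by rewrite (lt_trans x1) ?ltr1n// mul1r mulr1 ge_min lexx orbT.
have L n : (wint p (trunc_weight b p n) u <= ((1 - t)^-1)%:E * (t%:E * Y + D'))%E.
  apply: absorb t01 (wint_ge0 p u (trunc_weight_ge0 b p n)) (X1 n) Y0 Y1 D'0 D'1 _.
  apply: le_trans (trunc_step n p1 b0 d0 mu1) _; rewrite tE; apply: leeD2l.
  by apply: lee_wpmul2l (HD n); rewrite lee_fin powR_ge0.
have L0oo : (((1 - t)^-1)%:E * (t%:E * Y + D') < +oo)%E.
  move: t01 => /andP[t0 t1].
  have tY : (0 <= t%:E * Y)%E by apply: mule_ge0; [rewrite lee_fin|].
  apply: lte_mul_pinfty; [by rewrite lee_fin invr_ge0 subr_ge0 ltW|by []|].
  by apply: lte_add_pinfty; [apply: lte_mul_pinfty; [rewrite lee_fin|by []|]|].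
apply: le_lt_trans L0oo; rewrite /wint.
apply: (@fatou_le (fun n x => trunc_weight b p n x * `|u x| `^ p)).
- move=> n; apply: measurable_funM; [exact: measurable_trunc_weight|exact: measurable_powR_norm].
- by move=> n x; apply: mulr_ge0; [exact: trunc_weight_ge0|exact: powR_ge0].
- move=> x; apply: cvg_near_cst; near=> n; congr (_ * _); rewrite /trunc_weight /hw; congr (_ * _).
  apply/min_idPl; near: n; exact: nbhs_infty_ger.
- exact: L.
Unshelve. all: by end_near. Qed.

Lemma hardy_supercritical (k : E -> R) p b u us : (0 < N)%N -> plateau k -> 1 <= p ->
  N%:R < b * p -> locint u -> (forall i, locint (us i)) ->
  (forall i, wderiv0 i u (us i)) -> {for 0, continuous u} -> u 0 = 0 ->
  (forall i, (wint p (hw ((1 - b) * p)%R 2) (us i) < +oo)%E) ->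
  (wint p (hw (- (b * p))%R 1) u < +oo)%E.
Proof.
move=> N0 pk p1 bpN lu lus uus cu u0 us1; have p0 : 0 < p by exact: lt_le_trans p1.
have mu1 := lu.1.
have mH := measurable_hw (- (b * p)) 1; have H0 := hw_ge0 (- (b * p)) 1.
have half_le W v : W = hw (- (b * p)) 1 -> measurable_fun setT v ->
    (wint p W (fun x => v (2^-1 *: x)) <= (2 `^ (N%:R - b * p))%:E * wint p W v)%E.
  move=> -> mv.
  have mV : measurable_fun setT (fun x => hw (- (b * p)) 1 (2 *: x)) := measurable_dilate _ mH.
  have V0 x : 0 <= hw (- (b * p)) 1 (2 *: x) by exact: H0.
  have EV : (fun x => hw (- (b * p)) 1 (2 *: (2^-1 *: x))) = hw (- (b * p)) 1.
    by apply/funext => x; rewrite scalerA mulfV ?pnatr_eq0// scale1r.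
  have := @wint_dilate _ _ p _ v 2^-1 ltac:(by rewrite invr_gt0) mV mv V0; rewrite EV invrK => ->.
  have H1 : (wint p (fun x => hw (- (b * p)) 1 (2 *: x)) v <= (2 `^ (- (b * p)))%:E * wint p (hw (- (b * p)) 1) v)%E.
    rewrite -(wintZ p (powR_ge0 _ _) mH mv H0).
    apply: (le_wint mV mv _ mv V0); first exact: measurable_funM.
    move=> x; apply: ler_wpM2r; first exact: powR_ge0.
    rewrite /hw !ball_indicE normrZ ger0_norm//.
    have [x2|x2] := ltP (2 * `|x|) 1; last by rewrite mul0r !mulr_ge0 ?powR_ge0.
    have -> : `|x| < 1 by apply: le_lt_trans x2; rewrite ler_peMl// ler1n.
    by rewrite !mul1r powRM.
  apply: (@le_trans _ _ ((2 ^+ N)%:E * ((2 `^ (- (b * p)))%:E * wint p (hw (- (b * p)) 1) v))%E).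
    by apply: lee_wpmul2l => //; rewrite lee_fin exprn_ge0.
  by rewrite muleA -EFinM -powR_mulrn// -powRD// pnatr_eq0 implybT.
have [C C0 HC] := dilation_estimate N0 pk p1.
have [D [D0 D1 HD]] : exists D : \bar R, [/\ (0 <= D)%E, (D < +oo)%E &
    (wint p (hw (- (b * p)) 1) (fun x => u (2 *: x) - u x)%R <= D)%E].
  pose K : R := 2 `^ `|(1 - b) * p|.
  have K0 : 0 <= K by exact: powR_ge0.
  have mW2 : measurable_fun setT (fun x => K * hw ((1 - b) * p) 2 x).
    by apply: measurable_funM => //; exact: measurable_hw.
  have W20 x : 0 <= K * hw ((1 - b) * p) 2 x by rewrite mulr_ge0// hw_ge0.
  exists (C%:E * \sum_i wint p (fun x => K * hw ((1 - b) * p) 2 x)%R (us i))%E; split.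
  - by apply: mule_ge0; [rewrite lee_fin|apply: sume_ge0 => i _; exact: wint_ge0].
  - apply: lte_mul_pinfty; [by rewrite lee_fin|by []|apply: lte_sum_pinfty => i _].
    rewrite (wintZ p K0 (measurable_hw _ _) (lus i).1 (hw_ge0 _ _)).
    by apply: lte_mul_pinfty; [rewrite lee_fin|by []|exact: us1].
  apply: (HC _ _ _ _ lu lus uus mH mW2 H0 W20).
  by move=> x s s12; exact: weight_bound.
pose a := (b * p - N%:R) / 2; have a0 : 0 < a by rewrite divr_gt0// subr_gt0.
pose d := 2 `^ (a / p) - 1; have d0 : 0 < d by rewrite subr_gt0 gt1_two_powR// divr_gt0.
pose t : R := 2 `^ (- a).
have t01 : 0 <= t < 1.
  by rewrite powR_ge0/= /t powRN invf_lt1 ?gt1_two_powR// powR_gt0.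
have tE : (1 + d) `^ p * 2 `^ (N%:R - b * p) = t.
  rewrite /d subrKC -powRrM divfK ?gt_eqF// -powRD; last by rewrite pnatr_eq0 implybT.
  by rewrite /t /a; congr (_ `^ _); field.
pose e (n : nat) x := u x - u ((2^-1 ^+ n) *: x).
have me n : measurable_fun setT (e n) by exact: measurable_funB mu1 (measurable_dilate _ mu1).
have mud : measurable_fun setT (fun x => u (2 *: x) - u x) := measurable_funB (measurable_dilate _ mu1) mu1.
pose L0 := (((1 + d^-1) `^ p * 2 `^ (N%:R - b * p))%:E * D)%E.
have L00 : (0 <= L0)%E by apply: mule_ge0; [rewrite lee_fin mulr_ge0 ?powR_ge0|].
have L01 : (L0 < +oo)%E by apply: lte_mul_pinfty; [rewrite lee_fin mulr_ge0 ?powR_ge0|by []|].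
have step n : (wint p (hw (- (b * p)) 1) (e n.+1) <= t%:E * wint p (hw (- (b * p)) 1) (e n) + L0)%E.
  have mv := measurable_dilate 2^-1 (me n); have mw := measurable_dilate 2^-1 mud.
  apply: le_trans (wint_tri p1 d0 mH (me n.+1) mv mw H0 _) _.
    move=> x; apply: le_trans (ler_normD _ _); rewrite le_eqVlt; apply/orP; left; apply/eqP.
    congr `|_|; rewrite /e !scalerA mulfV ?pnatr_eq0// scale1r -exprSr.
    by rewrite addrCA addrAC subrr add0r.
  rewrite -tE EFinM -muleA; apply: leeD.
    by apply: lee_wpmul2l; [rewrite lee_fin powR_ge0|exact: half_le].
  rewrite /L0 EFinM -muleA; apply: lee_wpmul2l; first by rewrite lee_fin powR_ge0.
  apply: le_trans (half_le _ _ erefl mud) _.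
  by apply: lee_wpmul2l; [rewrite lee_fin powR_ge0|].
have bound n : (wint p (hw (- (b * p)) 1) (e n) <= ((1 - t)^-1)%:E * L0)%E.
  move: t01 => /andP[t0 t1].
  elim: n => [|n IH].
    rewrite /wint (_ : (fun x => _) = cst 0%E); last first.
      apply/funext => x; rewrite /e expr0 scale1r subrr normr0 powR0 ?gt_eqF//.
      by rewrite mulr0.
    by rewrite integral0; apply: mule_ge0; [rewrite lee_fin invr_ge0 subr_ge0 ltW|].
  apply: le_trans (step n) _.
  apply: (@le_trans _ _ (t%:E * (((1 - t)^-1)%:E * L0) + L0)%E).
    by apply: leeD2r; apply: lee_wpmul2l; [rewrite lee_fin|].
  move: L00 L01; case: (L0) => [l| |] // _ _; rewrite -!EFinM -EFinD lee_fin.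
  rewrite le_eqVlt; apply/orP; left; apply/eqP; field.
  by rewrite subr_eq0 gt_eqF.
apply: (@le_lt_trans _ _ (((1 - t)^-1)%:E * L0)%E); last first.
  move: t01 => /andP[t0 t1].
  by apply: lte_mul_pinfty; [rewrite lee_fin invr_ge0 subr_ge0 ltW|by []|].
rewrite /wint; apply: (@fatou_le (fun n x => hw (- (b * p)) 1 x * `|e n x| `^ p)).
- by move=> n; apply: measurable_funM; [exact: mH|exact: measurable_powR_norm (me n)].
- by move=> n x; apply: mulr_ge0; [exact: H0|exact: powR_ge0].
- move=> x; apply: cvgM; first exact: cvg_cst.
  have c0 : (fun n => (2^-1 ^+ n : R) *: x) @ \oo --> (0 : E).
    rewrite -[X in _ --> X](scale0r x); apply: cvgZr_tmp; apply: cvg_expr.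
    by rewrite ger0_norm ?invr_ge0// invf_lt1// ltr1n.
  have ce : (fun n => e n x) @ \oo --> u x.
    rewrite /e -[X in _ --> X]subr0 -u0; apply: cvgB; first exact: cvg_cst.
    exact: (@cvg_comp _ _ _ _ u _ _ _ c0 cu).
  exact: cvg_norm_powR.
- exact: bound.
Qed.

End hardy_inequalities.

(** * Removability of the origin *)

Section removable_origin.
Context {R : realType} {N : nat}.
Local Notation E := 'rV[R]_N.
Local Notation mu := (lebesgue_rV N : {sigma_finite_measure set E -> \bar R}).
Implicit Types (x y : E) (u v f : E -> R) (us : 'I_N -> E -> R).

Lemma locint_wint1 u r : locint u -> (wint 1 \1_[set y : E | (`|y| < r)%R] u < +oo)%E.
Proof.
move=> lu; have := locint_integrable (g := \1_[set y : E | `|y| < r]) (C := 1) (r := r) lu.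
move=> /(_ (measurable_ball_indic r)) H.
have : mu.-integrable setT (EFin \o (fun x => u x * \1_[set y : E | `|y| < r] x)).
  apply: H => x; rewrite ball_indicE; first by case: (_ < r); rewrite ?normr1 ?normr0.
  by move=> rx; rewrite ltNge rx.
move=> /integrableP[_]; congr (_ < _)%E; apply: eq_integral => x _ /=.
rewrite powRr1 ?normr_ge0// normrM mulrC; congr ((_ * _)%:E).
by rewrite ball_indicE ger0_norm.
Qed.

(** The outside Hardy inequality with p = 1 and exponent 1: the gradient then carries exponent 0,
    for which local integrability is enough, and [b * p < N%:R] reads 1 < N. *)
Lemma integrable_div_norm (k : E -> R) u us : (1 < N)%N -> plateau k ->
  locint u -> (forall i, locint (us i)) -> (forall i, wderiv0 i u (us i)) ->
  mu.-integrable setT (EFin \o (fun x => hw (- 1) 1 x * u x)).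
Proof.
move=> N1 pk lu lus uus; have N0 : (0 < N)%N by exact: ltnW.
have := @hardy_subcritical R N k 1 1 u us N0 pk (lexx _) ler01 _ lu lus uus (locint_wint1 2 lu).
rewrite mulr1 ltr1n => /(_ N1) H.
have mh := measurable_hw (R := R) (N := N) (- 1) 1.
apply/integrable_abs_lty; first by apply: measurable_funM => //; exact: lu.1.
have -> : (\int[mu]_x `|hw (- 1) 1 x * u x|%:E = wint 1 (hw (- 1) 1) u)%E.
  apply: eq_integral => x _; rewrite normrM powRr1// ger0_norm// hw_ge0//.
apply: H => i; rewrite subrr mul0r.
have := locint_wint1 2 (lus i); congr (_ < _)%E; apply: eq_integral => x _.
by rewrite /hw powRr0 mulr1.
Qed.

(** Testing with (1 - k(nx)) f produces one extra term containing the gradient of the cutoff. That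
    gradient tends to 0 at every nonzero point and is O(1 + 1/|x|) near the origin, so
    [integrable_div_norm] supplies a dominating function. *)
Lemma wderiv0_wderiv (k : E -> R) u us i : (1 < N)%N -> plateau k ->
  locint u -> (forall j, locint (us j)) -> (forall j, wderiv0 j u (us j)) ->
  wderiv i u (us i).
Proof.
move=> N1 pk lu lus uus f tf; have N0 : (0 < N)%N by exact: ltnW.
have [tk k1] := pk; have [r kr] := tk.2; have [Ck Ck0 kC] := rtest_bounded tk.
have tdk := rtest_pd i tk; have [Cd Cd0 dC] := rtest_bounded tdk; have [rd dr] := tdk.2.
have [Cf Cf0 fC] := rtest_bounded tf.
pose c (n : nat) x := 1 + -1 * k (n.+1%:R *: x).
pose dk (n : nat) x := n.+1%:R * pd i k (n.+1%:R *: x).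
have n0 n : 0 < n.+1%:R :> R by rewrite ltr0n.
have tkn n : rtest (fun x => k (n.+1%:R *: x)) by exact: rtest_scale (n0 n) tk.
have sc n : smooth_on setT (c n).
  apply: smooth_onD; [exact: openT|exact: smooth_on_cst|].
  by apply: smooth_onM; [exact: openT|exact: smooth_on_cst|exact: rtest_smooth].
have pc n x : pd i (c n) x = - dk n x.
  have [C P] := C1_at_comp_affine n.+1%:R 0 x (rtest_smooth tk).
  have E0 : (fun y => k (n.+1%:R *: y)) = (fun y => k (n.+1%:R *: y + 0)).
    by apply/funext => y; rewrite addr0.
  have C' : C1_at x (fun y => k (n.+1%:R *: y)) by rewrite E0.
  rewrite /c (pdD _ (C1_at_cst _ _) (C1_atM (C1_at_cst _ _) C')) pd_cst add0r.
  rewrite (pdM _ (C1_at_cst _ _) C') pd_cst mul0r add0r E0 P addr0 mulN1r.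
  by [].
have cfar n x : r <= n.+1%:R * `|x| -> c n x = 1.
  by move=> rx; rewrite /c kr ?mulr0 ?addr0// normrZ ger0_norm// ltW.
have mc n : measurable_fun setT (c n) by apply: continuous_measurable_rV; exact: smooth_continuous.
have tdk' n : rtest (fun x => pd i k (n.+1%:R *: x)) by exact: rtest_scale (n0 n) tdk.
have mdk n : measurable_fun setT (dk n).
  have tdn : rtest (dk n).
    by apply: rtestM (tdk' n); exact: smooth_on_cst.
  by apply: continuous_measurable_rV; exact: rtest_continuous.
have cB n x : `|c n x| <= 1 + Ck.
  by rewrite /c (le_trans (ler_normD _ _))// normr1 lerD2l mulN1r normrN.
have dkfar n x : rd <= n.+1%:R * `|x| -> dk n x = 0.
  by move=> rx; rewrite /dk dr ?mulr0// normrZ ger0_norm// ltW.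
have dk0 n : dk n 0 = 0.
  rewrite /dk scaler0 (_ : pd i k 0 = 0) ?mulr0//.
  rewrite -(@pd_cst _ _ 1 i 0); apply: near_eq_pd.
  by apply/nbhs_ballP; exists 1 => //= y; rewrite -ball_normE/= sub0r normrN => /k1.
(* Where [dk n] is nonzero, n + 1 < rd/|x|. For |x| < 1 this is the weight; for |x| >= 1 it is at
   most [rd], whence the added 1. *)
have dkB n x : `|dk n x| <= Cd * `|rd| * (hw (- 1) 1 x + 1).
  have h0 := hw_ge0 (- 1) 1 x.
  have [->|x0] := eqVneq x 0; first by rewrite dk0 normr0 mulr_ge0 ?addr_ge0 ?mulr_ge0 ?hw_ge0.
  have x1 : 0 < `|x| by rewrite normr_gt0.
  have [nr|/dkfar->] := ltP (n.+1%:R * `|x|) rd; last by rewrite normr0 !mulr_ge0// addr_ge0.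
  rewrite /dk normrM mulrC -mulrA ler_pM// ger0_norm ?(ltW (n0 n))//.
  have rr : 0 < rd by apply: le_lt_trans nr; rewrite mulr_ge0// ltW.
  rewrite gtr0_norm//; have [xx|xx] := ltP `|x| 1.
    rewrite (_ : hw _ _ _ = `|x|^-1); last by rewrite /hw ball_indicE xx mul1r powR_inv1 ?ltW.
    rewrite mulrDr mulr1; apply: le_trans (_ : rd / `|x| <= _); last by rewrite lerDl ltW.
    by rewrite ler_pdivlMr// ltW.
  rewrite mulrDr mulr1; apply: le_trans (_ : rd <= _); last by rewrite lerDr mulr_ge0// ltW.
  by rewrite ltW// (le_lt_trans _ nr)// ler_peMr// ltW.
pose G n x := u x * pd i (fun y => c n y * f y) x + us i x * (c n x * f x).
pose G0 x := u x * pd i f x + us i x * f x.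
have pcf n x : pd i (fun y => c n y * f y) x = - dk n x * f x + c n x * pd i f x.
  by rewrite (pdM _ (smooth_on_C1 (sc n) I) (smooth_on_C1 (rtest_smooth tf) I)) pc.
have tdf := rtest_pd i tf.
have mr (g : E -> R) : rtest g -> measurable_fun setT g.
  by move=> tg; apply: continuous_measurable_rV; exact: rtest_continuous.
have muE := lu.1; have musE := (lus i).1; have mf := mr _ tf; have mdf := mr _ tdf.
have tcf n : rtest0 (fun y => c n y * f y).
  split; first exact: rtestM.
  exists (n.+1%:R^-1); first by rewrite invr_gt0.
  move=> x xn; rewrite /c k1 ?mulr1 ?subrr ?mul0r//.
  by rewrite normrZ gtr0_norm// mulrC -ltr_pdivlMr// div1r.
have mG n : measurable_fun setT (G n).
  apply: measurable_funD; apply: measurable_funM; [exact: muE| |exact: musE|].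
    exact: mr _ (rtest_pd i (tcf n).1).
  exact: measurable_funM.
have mG0 : measurable_fun setT G0 by apply: measurable_funD; apply: measurable_funM.
pose g x := `|Cd * `|rd| * Cf * (hw (- 1) 1 x * u x)| + `|Cd * `|rd| * (u x * f x)| +
  (`|(1 + Ck) * (u x * pd i f x)| + `|(1 + Ck) * (us i x * f x)|).
have iZ (a : R) h : mu.-integrable setT (EFin \o h) ->
    mu.-integrable setT (EFin \o (fun x => `|a * h x|)).
  move=> ih; apply: (@integrable_le _ _ _ (fun x => a * h x)).
  - by apply: measurableT_comp => //; apply: measurable_funM => //; exact: integrable_measurable.
  - exact: (integrableZl _ a ih).
  - by move=> x; rewrite normr_id.
have ig : mu.-integrable setT (EFin \o g).
  have i1 := iZ (Cd * `|rd| * Cf) _ (integrable_div_norm N1 pk lu lus uus).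
  have i2 := iZ (Cd * `|rd|) _ (locint_mul_rtest lu tf).
  have i3 := iZ (1 + Ck) _ (locint_mul_rtest lu tdf).
  have i4 := iZ (1 + Ck) _ (locint_mul_rtest (lus i) tf).
  exact: (integrableD _ (integrableD _ i1 i2) (integrableD _ i3 i4)).
have Gg n x : `|G n x| <= g x.
  have C1 : 0 <= 1 + Ck by rewrite addr_ge0.
  have K0 : 0 <= Cd * `|rd| by rewrite mulr_ge0.
  have h0 := hw_ge0 (- 1) 1 x.
  rewrite /g; move: (hw _ _ _) h0 (dkB n x) => h h0 dkBx.
  rewrite /G pcf mulrDr -addrA (le_trans (ler_normD _ _))// lerD//.
    rewrite !normrM normrN (ger0_norm Cd0) normr_id (ger0_norm h0) (ger0_norm Cf0).
    apply: (@le_trans _ _ (`|u x| * (Cd * `|rd| * (h + 1) * `|f x|))).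
      by rewrite ler_wpM2l// ler_wpM2r.
    rewrite [leLHS](_ : _ = Cd * `|rd| * `|f x| * (h * `|u x|) + Cd * `|rd| * (`|u x| * `|f x|)).
      by rewrite lerD2r ler_wpM2r ?mulr_ge0// ler_wpM2l.
    by ring.
  rewrite (le_trans (ler_normD _ _))//; apply: lerD.
    rewrite !normrM (ger0_norm C1) mulrCA ler_wpM2r ?mulr_ge0// ?cB.
  rewrite !normrM (ger0_norm C1) mulrCA ler_wpM2r ?mulr_ge0// ?cB.
have Gcvg : {ae mu, forall x, (fun n => G n x) @ \oo --> G0 x}.
  apply: filterS (@ae_neq0 R N N0) => x x0; apply: cvg_near_cst; near=> n.
  have nx : 0 < `|x| by rewrite normr_gt0.
  have big (t : R) : t / `|x| <= n%:R -> t <= n.+1%:R * `|x|.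
    by move=> tn; rewrite -ler_pdivrMr//; apply: (le_trans tn); rewrite ler_nat.
  rewrite /G pcf dkfar ?cfar ?oppr0 ?mul0r ?add0r ?mul1r//; apply: big.
    by near: n; exact: nbhs_infty_ger.
  by near: n; exact: nbhs_infty_ger.
have G_eq0 n : \int[mu]_x G n x = 0.
  rewrite RintegralD//; last exact: (locint_mul_rtest (lus i) (tcf n).1).
    by rewrite (uus i _ (tcf n)) addNr.
  exact: (locint_mul_rtest lu (rtest_pd i (tcf n).1)).
have : \int[mu]_x G0 x = 0 by exact: (Rintegral_cvg_eq0 mG mG0 Gcvg ig Gg G_eq0).
rewrite RintegralD//; last exact: (locint_mul_rtest (lus i) tf).
  by move/eqP; rewrite addr_eq0 => /eqP.
exact: (locint_mul_rtest lu tdf).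
Unshelve. all: by end_near. Qed.

End removable_origin.

(** * Continuity of W^{2,p} functions when p > N/2 *)

Section averages.
Context {R : realType} {N : nat}.
Local Notation E := 'rV[R]_N.
Local Notation mu := (lebesgue_rV N : {sigma_finite_measure set E -> \bar R}).
Local Notation leb := (lebesgue_measure : {sigma_finite_measure set (measurableTypeR R) -> \bar R}).
Implicit Types (x y z : E) (u v f V rho sigma : E -> R) (p s : R).

Lemma rtest_integrable f : rtest f -> mu.-integrable setT (EFin \o f).
Proof.
move=> tf; have l1 : locint (fun _ : E => 1 : R).
  by apply: (@locint_bounded _ _ _ 1) => [|x]; [exact: measurable_cst|rewrite normr1].
have := locint_mul_rtest l1 tf; congr (integrable _ _ _).
by apply/funext => x /=; rewrite mul1r.
Qed.

Lemma Rintegral_norm_le (f g : E -> R) : mu.-integrable setT (EFin \o f) ->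
  mu.-integrable setT (EFin \o g) -> (forall x, `|f x| <= g x) ->
  `|\int[mu]_x f x| <= \int[mu]_x g x.
Proof.
move=> fi gi fg; apply: (le_trans (le_normr_Rintegral _ fi)) => //.
apply: le_Rintegral => //; apply: (integrable_le _ gi) => [|x].
  by apply: measurableT_comp => //; exact: integrable_measurable.
by rewrite normr_id (le_trans (fg x))// ler_norm.
Qed.

Lemma Lpr_integrable p V : Lpr p V -> mu.-integrable setT (EFin \o (fun x => `|V x| `^ p)).
Proof.
move=> [mV Vp]; apply/integrable_abs_lty; first exact: measurable_powR_norm.
by under eq_integral do rewrite ger0_norm ?powR_ge0//.
Qed.

(** [young_powR] with threshold A = s^(-N/p): the support of [sigma] contributes A and the p-th
    power contributes A^(1-p) s^-N, which is the same power of [s]. *)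
Lemma average_bound p sigma V : 1 <= p -> rtest sigma -> Lpr p V ->
  exists2 C : R, 0 <= C & forall s x, 0 < s ->
    `|\int[mu]_z (V (s *: z + x) * sigma z)| <= C * s `^ (- (N%:R / p)).
Proof.
move=> p1 ts LV; have p0 : 0 < p by apply: lt_le_trans p1.
have [K K0 Ks] := rtest_bounded ts; have [r sr] := ts.2.
have lV := Lpr_locint p1 LV; have iV := Lpr_integrable LV.
pose I := \int[mu]_x (`|V x| `^ p); pose b : E -> R := \1_[set y : E | `|y| < r].
have I0 : 0 <= I by apply: Rintegral_ge0 => // x _; rewrite powR_ge0.
have ib : mu.-integrable setT (EFin \o b).
  have l1 : locint (fun _ : E => 1 : R).
    by apply: (@locint_bounded _ _ _ 1) => [|x]; [exact: measurable_cst|rewrite normr1].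
  have := locint_integrable (C := 1) (r := r) l1 (measurable_ball_indic r).
  rewrite (_ : (fun x => 1 * _) = b); last by apply/funext => x; rewrite mul1r.
  apply=> x; rewrite ball_indicE; first by case: (_ < r); rewrite ?normr1 ?normr0.
  by move=> rx; rewrite ltNge rx.
pose vol := \int[mu]_x b x.
have v0 : 0 <= vol by apply: Rintegral_ge0 => // x _; rewrite /b ball_indicE.
exists (K * (vol + I)); first by rewrite mulr_ge0// addr_ge0.
move=> s x s0; set A := s `^ _.
have A0 : 0 < A by rewrite powR_gt0.
have iVs := integrable_affine x s0 iV.
have iH : mu.-integrable setT (EFin \o (fun z => K * A * b z + K * A `^ (1 - p) * `|V (s *: z + x)| `^ p)).
  exact: (integrableD _ (integrableZl _ (K * A) ib) (integrableZl _ (K * A `^ (1 - p)) iVs)).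
apply: (le_trans (Rintegral_norm_le _ iH _)).
- exact: locint_mul_rtest (locint_affine x s0 lV) ts.
- move=> z; rewrite normrM /b ball_indicE; have [zr|/sr ->] := ltP `|z| r; last first.
    by rewrite normr0 mulr0 mulr0 add0r !mulr_ge0// powR_ge0.
  rewrite mulr1 -!mulrA -mulrDr mulrC ler_pM//; exact: young_powR.
rewrite RintegralD//; [|exact: (integrableZl _ (K * A) ib)|exact: (integrableZl _ (K * A `^ (1 - p)) iVs)].
rewrite !RintegralZl// -/vol (_ : \int[mu]_z _ = s ^- N * I); last first.
  rewrite /I (Rintegral_affine x s0 iV) mulrA mulVf ?mul1r//.
  by rewrite expf_neq0// gt_eqF.
rewrite -!mulrA -mulrDr ler_wpM2l// [leRHS]mulrDl mulrC lerD2l mulrA mulrC ler_wpM2l//.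
rewrite /A -powRrM -powR_mulrn ?(ltW s0)// -powRN -powRD ?(gt_eqF s0) ?implybT//.
rewrite le_eqVlt; apply/orP; left; apply/eqP; congr (_ `^ _).
by field; rewrite gt_eqF.
Qed.

Lemma wderiv_shift i u v x : locint u -> locint v -> wderiv i u v ->
  wderiv i (fun y => u (y + x)) (fun y => v (y + x)).
Proof.
move=> lu lv uv f tf.
have tg : rtest (fun y => f (1 *: y + - x)) by exact: rtest_affine.
have pg y : pd i (fun y => f (1 *: y + - x)) y = pd i f (1 *: y + - x).
  by have [_ ->] := C1_at_comp_affine 1 (- x) y tf.1; rewrite mul1r.
have E1 (w h : E -> R) : locint w -> rtest h ->
    \int[mu]_y (w (y + x) * h y) = \int[mu]_y (w y * h (1 *: y + - x)).
  move=> lw th; rewrite [RHS](@Rintegral_affine _ _ 1 x)//; last first.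
    by apply: (@locint_mul_rtest _ _ w) => //; exact: rtest_affine.
  rewrite expr1n mul1r; apply: eq_Rintegral => y _; rewrite !scale1r.
  by rewrite addrK.
rewrite !E1//; last exact: rtest_pd.
by under eq_Rintegral do rewrite -pg; exact: uv.
Qed.

Lemma average_flow f u (us : 'I_N -> E -> R) (a b : R) x : 0 < a < b -> rtest f ->
  locint u -> (forall i, locint (us i)) -> (forall i, wderiv i u (us i)) ->
  \int[mu]_z (u (b *: z + x) * f z) - \int[mu]_z (u (a *: z + x) * f z) =
  \int[leb]_(s in `[a, b]) \sum_i \int[mu]_z (us i (s *: z + x) * coordM i f z).
Proof.
move=> ab tf lu lus uus.
have sh w : locint w -> locint (fun y => w (y + x)).
  move=> /(locint_affine x ltr01); congr locint; apply/funext => y; by rewrite scale1r.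
apply: (@wderiv_flow _ _ f (fun y => u (y + x)) (fun i y => us i (y + x))) => //.
- exact: sh.
- by move=> i; exact: sh.
- by move=> i; exact: wderiv_shift.
Qed.

(** Multiplying the bump by its reflection makes it even, so that averaging can be moved from [u]
    onto a test function without changing the kernel. *)
Lemma plateau_mollifier (k : E -> R) : plateau k -> exists rho : E -> R,
  [/\ rtest rho, \int[mu]_x rho x = 1 & forall x, rho (- x) = rho x].
Proof.
move=> /plateau_bump[q [tq q01 q1]].
pose q2 x := q (-1 *: x + 0) * q x.
have tq2 : rtest q2.
  by apply: rtestM => //; exact: (smooth_comp_affine (-1) 0 tq.1).
have iq := rtest_integrable tq2.
have q20 x : 0 <= q2 x by rewrite mulr_ge0// (andP (q01 _)).1.
have I0 : 0 < \int[mu]_x q2 x.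
  rewrite lt_neqAle Rintegral_ge0// andbT; apply/negP => /eqP/esym I0.
  have : (\int[mu]_x `|(q2 x)%:E| = 0)%E.
    rewrite -[RHS]/(0%:E) -I0 /Rintegral fineK; last exact: integrable_fin_num.
    by apply: eq_integral => x _; rewrite gee0_abs// lee_fin.
  have mq : measurable_fun setT (EFin \o q2) by exact: measurable_int iq.
  move/(ae_eq_integral_abs _ measurableT mq).1 => [Z [mZ Z0 sZ]].
  have := @lebesgue_rV_ball1_gt0 R N; apply/negP; rewrite -leNgt -Z0.
  apply: le_measure; rewrite ?inE//; first exact: measurable_rV_ball.
  move=> x /= x1; apply: sZ => /= /(_ I) [] /eqP; apply/negP.
  rewrite gt_eqF// mulr_gt0// q1//.
  by rewrite addr0 scaleN1r normrN.
exists (fun x => (\int[mu]_x q2 x)^-1 * q2 x); split.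
- by apply: rtestM tq2; exact: smooth_on_cst.
- by rewrite RintegralZl// mulVf// gt_eqF.
- by move=> x; rewrite /q2 !addr0 !scaleN1r opprK [q x * _]mulrC.
Qed.

End averages.

(** With c (1 - t) = K the sequence a_k - c t^k is nondecreasing and bounded, hence convergent, and
    c t^k tends to 0. The error bound is the tail of the geometric series. *)
Lemma geometric_cvg (R : realType) (a : nat -> R) (K t : R) : 0 <= t < 1 ->
  (forall k, `|a k.+1 - a k| <= K * t ^+ k) ->
  exists2 l, a @ \oo --> l & forall k, `|a k - l| <= K / (1 - t) * t ^+ k.
Proof.
move=> /andP[t0 t1] aK.
have d0 : 0 < 1 - t by rewrite subr_gt0.
have K0 : 0 <= K by have := aK 0; rewrite expr0 mulr1; apply: le_trans.
pose c := K / (1 - t).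
have c0 : 0 <= c by rewrite divr_ge0// ltW.
have cK : c * (1 - t) = K by rewrite /c divfK// gt_eqF.
have am (k m : nat) : `|a (k + m)%N - a k| <= c * (t ^+ k - t ^+ (k + m)%N).
  elim: m => [|m IH]; first by rewrite addn0 !subrr mulr0 normr0.
  rewrite addnS -(subrKA (a (k + m)%N)) (le_trans (ler_normD _ _))//.
  apply: le_trans (lerD (aK _) IH) _.
  by rewrite -cK exprS le_eqVlt; apply/orP; left; apply/eqP; ring.
pose b k := a k - c * t ^+ k.
have ndb : nondecreasing_seq b.
  apply/nondecreasing_seqP => k; rewrite /b exprS -subr_ge0.
  have := aK k; rewrite ler_norml -cK => /andP[+ _]; lra.
have bub k : b k <= a 0 + c.
  rewrite /b; have := am 0 k; rewrite add0n expr0 ler_norml => /andP[_].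
  have : 0 <= c * t ^+ k by rewrite mulr_ge0// exprn_ge0.
  lra.
have cb : cvgn b.
  by apply: nondecreasing_is_cvgn => //; exists (a 0 + c) => _ [k _ <-].
have ct : (fun k => c * t ^+ k) @ \oo --> (0 : R).
  by rewrite -(mulr0 c); apply: cvgMr; apply: cvg_expr; rewrite ger0_norm.
have ca : a @ \oo --> limn b.
  rewrite (_ : a = b + (fun k => c * t ^+ k)); last first.
    by apply/funext => k; rewrite /b/= fctE subrK.
  by rewrite -(addr0 (limn b)); exact: cvgD cb ct.
exists (limn b) => // k.
have : (fun m => `|a (m + k)%N - a k|) @ \oo --> `|limn b - a k|.
  apply: cvg_norm; apply: cvgB; last exact: cvg_cst.
  by rewrite (cvg_shiftn k a).
move=> /cvg_lim => /(_ (@norm_hausdorff _ _)) E.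
rewrite distrC -E; apply: limr_le.
  apply/cvg_ex; exists `|limn b - a k|; apply: cvg_norm; apply: cvgB; last exact: cvg_cst.
  by rewrite (cvg_shiftn k a).
apply: nearW => m; rewrite addnC (le_trans (am _ _))// ler_wpM2l// gerBl exprn_ge0//.
Qed.

Section mollifiers.
Context {R : realType} {N : nat}.
Local Notation E := 'rV[R]_N.
Local Notation mu := (lebesgue_rV N : {sigma_finite_measure set E -> \bar R}).
Local Notation leb := (lebesgue_measure : {sigma_finite_measure set (measurableTypeR R) -> \bar R}).
Implicit Types (x y z : E) (u v f V rho sigma : E -> R) (p s : R).

Lemma locint_ball_integrable u r : locint u ->
  mu.-integrable setT (EFin \o (fun x => u x * \1_[set y : E | `|y| < r] x)).
Proof.
move=> lu; apply: (locint_integrable (C := 1) (r := r) lu (measurable_ball_indic r)) => x.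
  by rewrite ball_indicE; case: (_ < r); rewrite ?normr1 ?normr0.
by rewrite ball_indicE => rx; rewrite ltNge rx.
Qed.

Lemma locint_ball_le u (g : E -> R) (C r : R) : locint u -> measurable_fun setT g ->
  (forall x, `|g x| <= C) -> (forall x, r <= `|x| -> g x = 0) ->
  `|\int[mu]_x (u x * g x)| <= C * \int[mu]_x `|u x * \1_[set y : E | `|y| < r] x|.
Proof.
move=> lu mg gC gr.
have ib := locint_ball_integrable r lu.
have ib' : mu.-integrable setT (EFin \o (fun x => `|u x * \1_[set y : E | `|y| < r] x|)).
  apply: (integrable_le _ ib) => [|x]; last by rewrite normr_id.
  by apply: measurableT_comp => //; exact: integrable_measurable ib.
rewrite -RintegralZl//; apply: Rintegral_norm_le.
- exact: locint_integrable lu mg gC gr.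
- exact: (integrableZl _ C ib').
- move=> x; rewrite ball_indicE normrM; have [xr|/gr->] := ltP `|x| r.
    by rewrite mulr1 mulrC ler_wpM2r.
  by rewrite normr0 !mulr0 normr0 mulr0.
Qed.

Definition mollify rho u : E -> R := fun x => \int[mu]_y (u y * rho (y - x)).

(** For increments of norm at most 1 the difference of the two kernels is supported in one fixed
    ball and bounded by a Lipschitz constant times the increment. *)
Lemma continuous_mollify rho u : rtest rho -> locint u -> continuous (mollify rho u).
Proof.
move=> tr lu x; have [L L0 rL] := rtest_lipschitz tr; have [r rr] := tr.2.
pose I := \int[mu]_y `|u y * \1_[set y : E | `|y| < r + (`|x| + 1)] y|.
have I0 : 0 <= I by apply: Rintegral_ge0.
have tx w : rtest (fun y => rho (y - w)).
  by have := rtest_affine (- w) ltr01 tr; congr rtest; apply/funext => y; rewrite scale1r.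
have H h : `|h| <= 1 -> `|mollify rho u (x + h) - mollify rho u x| <= L * `|h| * I.
  move=> h1; rewrite /mollify -RintegralB//; [|exact: locint_mul_rtest (tx _)..].
  under eq_Rintegral do rewrite -mulrBr.
  apply: locint_ball_le => //.
  - apply: continuous_measurable_rV; apply: rtest_continuous.
    have := rtestD (tx (x + h)) (@rtestM _ _ (fun=> -1) _ (smooth_on_cst _) (tx x)).
    by congr rtest; apply/funext => y; rewrite mulN1r.
  - by move=> y; rewrite opprD addrA; have := rL (y - x) (- h); rewrite normrN.
  - move=> y ry; have hx := ler_normD x h.
    have h1' : r <= `|y - x| by apply: le_trans (lerB_dist _ _); lra.
    have h2' : r <= `|y - (x + h)| by apply: le_trans (lerB_dist _ _); lra.
    by rewrite !rr// subrr.
apply/(@cvgrPdist_lt _ _ _ (nbhs x) (nbhs_filter x)) => e e0.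
apply/nbhs_ballP; exists (Num.min 1 (e / (L * I + 1))) => /=.
  by rewrite lt_min ltr01/= divr_gt0// ltr_wpDl// mulr_ge0.
move=> y; rewrite -ball_normE/= lt_min => /andP[y1 ye].
have yH := H (y - x); rewrite [x + _]addrC subrK in yH.
have y1' : `|y - x| <= 1 by rewrite distrC ltW.
rewrite distrC (le_lt_trans (yH y1'))// mulrAC (distrC y x).
have LI : 0 < L * I + 1 by rewrite ltr_wpDl// mulr_ge0.
rewrite ltr_pdivlMr// in ye; apply: le_lt_trans ye.
by rewrite mulrC ler_wpM2l// lerDl.
Qed.

Lemma Rintegral_mollify rho u f : rtest rho -> locint u -> rtest f ->
  \int[mu]_x (mollify rho u x * f x) = \int[mu]_y (u y * \int[mu]_x (rho (y - x) * f x)).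
Proof.
move=> tr lu tf; have [r rr] := tr.2; have [s fs] := tf.2.
have [C C0 rC] := rtest_bounded tr.
pose F (z : E * E) := u z.2 * (rho (z.2 - z.1) * f z.1).
have ms : measurable_fun setT (fun z : E * E => z.2 - z.1).
  apply: measurable_fun_rV => i.
  rewrite (_ : _ \o _ = (fun z : E * E => rV_coord i z.2 - rV_coord i z.1)); last first.
    by apply/funext => z; rewrite /rV_coord/= !mxE.
  apply: measurable_funB; exact: measurableT_comp (measurable_rV_coord i) _.
have mF : measurable_fun setT F.
  apply: measurable_funM; first exact: measurableT_comp lu.1 _.
  apply: measurable_funM.
    exact: measurableT_comp (continuous_measurable_rV (rtest_continuous tr)) ms.
  exact: measurableT_comp (continuous_measurable_rV (rtest_continuous tf)) _.
have iF : (mu \x mu)%E.-integrable setT (EFin \o F).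
  apply: (@integrable_prod_le _ _ _ _ _ _ _ _ f
    (fun y => C * (u y * \1_[set y : E | `|y| < r + s] y))) => //.
  - exact: rtest_integrable.
  - exact: (integrableZl _ C (locint_ball_integrable (r + s) lu)).
  move=> x y; rewrite /F/= ball_indicE.
  have [xs|/fs->] := ltP `|x| s; last by rewrite !mulr0 normr0 mul0r.
  have [yr|/rr->] := ltP `|y - x| r; last by rewrite mul0r mulr0 normr0 mulr_ge0.
  rewrite (_ : `|y| < r + s); last first.
    by rewrite -(subrK x y) (le_lt_trans (ler_normD _ _))// ltrD.
  rewrite mulr1 !normrM (ger0_norm C0) mulrA [leRHS]mulrC ler_wpM2r//.
  by rewrite mulrC ler_wpM2r.
have [_ _ ] := Rintegral_fubini iF; rewrite /F/= => H.
rewrite (_ : \int[mu]_x _ = \int[mu]_x \int[mu]_y (u y * (rho (y - x) * f x))); last first.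
  apply: eq_Rintegral => x _; rewrite /mollify -RintegralZr//.
    by apply: eq_Rintegral => y _; rewrite mulrA.
  have := locint_mul_rtest lu (rtest_affine (- x) ltr01 tr).
  by congr (integrable _ _ _); apply/funext => y /=; rewrite scale1r.
rewrite H; apply: eq_Rintegral => y _; rewrite RintegralZl_measurable//.
apply: measurable_funM; last exact: (continuous_measurable_rV (rtest_continuous tf)).
apply: continuous_measurable_rV.
rewrite (_ : (fun x => _) = (fun x => rho (-1 *: x + y))); last first.
  by apply/funext => x; rewrite scaleN1r addrC.
exact: smooth_continuous (smooth_comp_affine (-1) y tr.1).
Qed.

End mollifiers.

Section embedding.
Context {R : realType} {N : nat}.
Local Notation E := 'rV[R]_N.
Local Notation mu := (lebesgue_rV N : {sigma_finite_measure set E -> \bar R}).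
Local Notation leb := (lebesgue_measure : {sigma_finite_measure set (measurableTypeR R) -> \bar R}).
Implicit Types (x y z : E) (u v f V rho sigma : E -> R) (p s : R).

Lemma rtest_shift rho x : rtest rho -> rtest (fun y => rho (y - x)).
Proof.
move=> tr; have := rtest_affine (- x) ltr01 tr.
by congr rtest; apply/funext => y; rewrite scale1r.
Qed.

Definition rescale rho s : E -> R := fun w => s^-1 ^+ N * rho (s^-1 *: w).

Lemma rtest_rescale rho s : 0 < s -> rtest rho -> rtest (rescale rho s).
Proof.
move=> s0 tr; have si : 0 < s^-1 by rewrite invr_gt0.
have t1 : rtest (fun w => rho (s^-1 *: w)) by exact: rtest_scale si tr.
by apply: rtestM t1; exact: smooth_on_cst.
Qed.

(** Two views of one object: averages with a fixed kernel obey the dilation flow, while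
    mollifications are continuous and can be tested. *)
Lemma average_mollify rho u s x : 0 < s -> rtest rho -> locint u ->
  \int[mu]_z (u (s *: z + x) * rho z) = mollify (rescale rho s) u x.
Proof.
move=> s0 tr lu; have trs := rtest_rescale s0 tr.
rewrite /mollify [RHS](@Rintegral_affine _ _ s x)//; last first.
  exact: locint_mul_rtest lu (rtest_shift x trs).
have sn : s != 0 by rewrite gt_eqF.
rewrite -RintegralZl_measurable; last first.
  have ma : measurable_fun setT (fun z => u (s *: z + x)) by exact: (locint_affine x s0 lu).1.
  apply: measurable_funM => //.
  under eq_fun do rewrite addrK.
  exact: (measurable_dilate s (continuous_measurable_rV (rtest_continuous trs))).
apply: eq_Rintegral => z _; rewrite /rescale addrK scalerA mulVf// scale1r.
by rewrite [RHS]mulrCA; congr (_ * _); rewrite mulrA -exprMn mulfV// expr1n mul1r.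
Qed.

(** Fubini and the evenness of [rho] move the mollification onto [f], which is Lipschitz with
    bounded support; the error is O(s) without any approximation theorem for [u]. The restriction to
    s <= 1 keeps the supports in one ball. *)
Lemma mollify_close rho u f : rtest rho -> \int[mu]_x rho x = 1 ->
  (forall x, rho (- x) = rho x) -> locint u -> rtest f ->
  exists2 C : R, 0 <= C & forall s, 0 < s <= 1 ->
    `|\int[mu]_x (mollify (rescale rho s) u x * f x) - \int[mu]_x (u x * f x)| <= C * s.
Proof.
move=> tr r1 re lu tf.
have [L L0 fL] := rtest_lipschitz tf; have [r rr] := tr.2; have [q fq] := tf.2.
have ir := rtest_integrable tr.
have ir' : mu.-integrable setT (EFin \o (fun x => `|rho x|)).
  apply: (integrable_le _ ir) => [|x]; last by rewrite normr_id.
  by apply: measurableT_comp => //; exact: integrable_measurable ir.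
pose r' := Num.max r 0; have r'0 : 0 <= r' by rewrite le_max lexx orbT.
pose J := \int[mu]_x `|rho x|; have J0 : 0 <= J by apply: Rintegral_ge0.
pose I := \int[mu]_x `|u x * \1_[set y : E | `|y| < q + r'] x|.
have I0 : 0 <= I by apply: Rintegral_ge0.
exists (L * r' * J * I); first by rewrite !mulr_ge0.
move=> s /andP[s0 s1]; have trs := rtest_rescale s0 tr.
have lf : locint f by exact: integrable_locint (rtest_integrable tf).
rewrite Rintegral_mollify//.
pose g y := mollify (rescale rho s) f y - f y.
have gE y : g y = \int[mu]_z ((f (s *: z + y) - f y) * rho z).
  rewrite /g -average_mollify//; under [RHS]eq_Rintegral do rewrite mulrBl.
  rewrite RintegralB//; last exact: (integrableZl _ (f y) ir).
    by rewrite RintegralZl// r1 mulr1.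
  exact: locint_mul_rtest (locint_affine y s0 lf) tr.
have ME y : \int[mu]_x (rescale rho s (y - x) * f x) = mollify (rescale rho s) f y.
  apply: eq_Rintegral => x _; rewrite mulrC; congr (_ * _).
  by rewrite /rescale -(opprB x y) scalerN re.
under eq_Rintegral do rewrite ME.
have mg : measurable_fun setT g.
  apply: measurable_funB; apply: continuous_measurable_rV.
    exact: continuous_mollify.
  exact: rtest_continuous.
have gC y : `|g y| <= L * s * r' * J.
  rewrite gE -RintegralZl//; apply: Rintegral_norm_le.
  - under eq_fun do rewrite mulrBl.
    exact: (integrableB _ (locint_mul_rtest (locint_affine y s0 lf) tr) (integrableZl _ (f y) ir)).
  - exact: (integrableZl _ (L * s * r') ir').
  - move=> z; have [zr|/rr->] := ltP `|z| r; last by rewrite mulr0 normr0 mulr0.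
    rewrite normrM ler_wpM2r// [s *: z + y]addrC (le_trans (fL _ _))// -mulrA ler_wpM2l//.
    by rewrite normrZ gtr0_norm// ler_wpM2l ?(ltW s0)// le_max ltW.
have gq y : q + r' <= `|y| -> g y = 0.
  move=> yq; rewrite gE (_ : (fun z => _) = (fun=> 0)); last first.
    apply/funext => z; have [zr|/rr->] := ltP `|z| r; last by rewrite mulr0.
    have zr' : `|s *: z| <= r'.
      rewrite normrZ gtr0_norm//; apply: (@le_trans _ _ `|z|); first by rewrite ler_piMl.
      by rewrite le_max ltW.
    rewrite !fq ?subrr ?mul0r//; first by apply: le_trans yq; rewrite lerDl.
    have H : `|y| - `|s *: z| <= `|s *: z + y|.
      by have := lerB_dist y (- (s *: z)); rewrite normrN opprK [y + _]addrC.
    by apply: le_trans H; lra.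
  by rewrite Rintegral_cst// mul0r.
rewrite (_ : _ - _ = \int[mu]_x (u x * g x)); last first.
  rewrite -RintegralB//; last exact: locint_mul_rtest lu tf.
    by apply: eq_Rintegral => y _; rewrite mulrBr.
  rewrite (_ : (fun x => _) = (fun x => u x * g x + u x * f x)); last first.
    by apply/funext => x; rewrite -mulrDr /g subrK.
  exact: (integrableD _ (locint_integrable lu mg gC gq) (locint_mul_rtest lu tf)).
apply: (le_trans (locint_ball_le lu mg gC gq)).
by rewrite -/I le_eqVlt; apply/orP; left; apply/eqP; ring.
Qed.

Lemma average_flow_bound f u (us : 'I_N -> E -> R) (a b M : R) x : 0 < a < b -> rtest f ->
  locint u -> (forall i, locint (us i)) -> (forall i, wderiv i u (us i)) ->
  (forall s, a <= s <= b -> \sum_i `|\int[mu]_z (us i (s *: z + x) * coordM i f z)| <= M) ->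
  `|\int[mu]_z (u (b *: z + x) * f z) - \int[mu]_z (u (a *: z + x) * f z)| <= M * (b - a).
Proof.
move=> ab tf lu lus uus sM; have /andP[a0 ltab] := ab.
rewrite (average_flow x ab tf lu lus uus) Rintegral_itv_indic.
pose h i s := \1_(`[a, b]%classic : set R) s * \int[mu]_z (us i (s *: z + x) * coordM i f z).
have ih i : leb.-integrable setT (EFin \o h i).
  have tc : rtest (coordM i f) by apply: rtestM tf; exact: smooth_coord.
  have [C C0 cC] := rtest_bounded tc; have [r cr] := tc.2.
  have lx : locint (fun y => us i (y + x)).
    by have := locint_affine x ltr01 (lus i); congr locint; apply/funext => y; rewrite scale1r.
  have := integrable_dilate_prod b a0 lx (continuous_measurable_rV (rtest_continuous tc)) cC cr.
  move=> /Rintegral_fubini[+ _ _]; congr (integrable _ _ _); apply/funext => s /=.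
  congr EFin; rewrite /h indicE; have [|_] := boolP (s \in _); last first.
    by rewrite mul0r (_ : (fun y => _) = (fun=> 0)) ?Rintegral_cst ?mul0r//;
      apply/funext => y; rewrite mul0r.
  by rewrite mul1r => _; apply: eq_Rintegral => y _; rewrite mul1r.
have [iH _] := Rintegral_sum (index_enum 'I_N) ih.
have HE : (fun s => \sum_i h i s) = (fun s => \1_(`[a, b]%classic : set R) s *
    \sum_i \int[mu]_z (us i (s *: z + x) * coordM i f z)).
  by apply/funext => s; rewrite mulr_sumr.
rewrite HE in iH.
have iM : leb.-integrable setT (EFin \o (fun s => M * \1_(`[a, b]%classic : set R) s)).
  exact: (integrableZl _ M (integrable_itv_indic a b)).
apply: (le_trans (le_normr_Rintegral _ iH)) => //.
apply: (@le_trans _ _ (\int[leb]_s (M * \1_(`[a, b]%classic : set R) s))).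
  apply: le_Rintegral => //; first exact: (integrable_norm iH).
  move=> s _; rewrite normrM indicE; have [|_] := boolP (s \in _); last by rewrite normr0 mul0r mulr0.
  rewrite inE/= in_itv/= normr1 mul1r mulr1 => sab.
  by rewrite (le_trans (ler_norm_sum _ _ _))// sM.
rewrite RintegralZl//; last exact: integrable_itv_indic.
rewrite /Rintegral integral_indic// setIT.
have lE : lebesgue_measure (`[a, b]%classic : set R) = (b - a)%:E.
  by rewrite lebesgue_measure_itv/= lte_fin ltab.
by rewrite [X in fine X]lE.
Qed.

End embedding.

Section sobolev_embedding.
Context {R : realType} {N : nat}.
Local Notation E := 'rV[R]_N.
Local Notation mu := (lebesgue_rV N : {sigma_finite_measure set E -> \bar R}).
Implicit Types (x y z : E) (u v f rho : E -> R) (p s : R).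

Lemma average_bound_fin p (I : finType) (sigma V : I -> E -> R) : 1 <= p ->
  (forall i, rtest (sigma i)) -> (forall i, Lpr p (V i)) ->
  exists2 C : R, 0 <= C & forall s x, 0 < s ->
    \sum_i `|\int[mu]_z (V i (s *: z + x) * sigma i z)| <= C * s `^ (- (N%:R / p)).
Proof.
move=> p1 ts LV.
have /choice[C HC] : forall i, exists C : R, 0 <= C /\ forall s x, 0 < s ->
    `|\int[mu]_z (V i (s *: z + x) * sigma i z)| <= C * s `^ (- (N%:R / p)).
  by move=> i; have [C C0 CH] := average_bound p1 (ts i) (LV i); exists C.
exists (\sum_i C i); first by apply: sumr_ge0 => i _; have [] := HC i.
by move=> s x s0; rewrite mulr_suml; apply: ler_sum => i _; have [_] := HC i; apply.
Qed.

(** On a given ball [u] coincides with its product by a dilated plateau, which is continuous with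
    bounded support and hence bounded. *)
Lemma continuous_locint (k : E -> R) u : plateau k -> continuous u -> locint u.
Proof.
move=> [tk k1] cu; split; first exact: continuous_measurable_rV.
move=> t; pose a := (`|t| + 1)^-1.
have a0 : 0 < a by rewrite invr_gt0 ltr_wpDl.
have tka : rtest (fun x => k (a *: x)) by exact: rtest_scale a0 tk.
have cw : continuous (fun x => u x * k (a *: x)).
  by move=> x; apply: continuousM; [exact: cu|exact: rtest_continuous tka x].
have [C C0 wC] : exists2 C : R, 0 <= C & forall x, `|u x * k (a *: x)| <= C.
  apply: bounded_support_bounded => //; have [r kr] := tka.2.
  by exists r => x /kr ->; rewrite mulr0.
have [_ /(_ t)] := locint_bounded (continuous_measurable_rV cw) wC.
apply: eq_integrable; first exact: measurable_rV_ball.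
move=> x; rewrite inE/= => xt; rewrite k1 ?mulr1//.
rewrite normrZ gtr0_norm// mulrC ltr_pdivrMr ?ltr_wpDl// mul1r.
by rewrite (lt_le_trans xt)// (le_trans (ler_norm _))// lerDl.
Qed.

Lemma sobolev_continuous (k : E -> R) p u (us : 'I_N -> E -> R) (uss : 'I_N -> 'I_N -> E -> R) :
  plateau k -> 1 <= p -> N%:R < 2 * p -> locint u -> (forall i, Lpr p (us i)) ->
  (forall i, wderiv i u (us i)) -> (forall i j, Lpr p (uss i j)) ->
  (forall i j, wderiv j (us i) (uss i j)) ->
  exists2 u0 : E -> R, continuous u0 & {ae mu, forall x, u x = u0 x}.
Proof.
move=> pk p1 Np lu Lus uus Luss usss.
have p0 : 0 < p by apply: lt_le_trans p1.
have lus i := Lpr_locint p1 (Lus i); have luss i j := Lpr_locint p1 (Luss i j).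
have [rho [tr r1 re]] := plateau_mollifier pk.
have [q bq] := plateau_bump pk.
have tc f i : rtest f -> rtest (coordM i f) by exact: rtest_coordM.
(* [A f V s] averages [V] at scale [s]. By the dilation flow the averages of the first
   derivatives at scale [2^-n] are O(r^n) with [r < 2], so that those of [u] converge
   geometrically. *)
pose A f (V : E -> R) (s : R) x := \int[mu]_z (V (s *: z + x) * f z).
pose B i s x := A (coordM i rho) (us i) s x.
have [D D0 HD] := @average_bound_fin p ('I_N * 'I_N)%type
  (fun ij => coordM ij.2 (coordM ij.1 rho)) (fun ij => uss ij.1 ij.2) p1
  (fun ij => tc _ _ (tc _ _ tr)) (fun ij => Luss _ _).
have [C0 C00 HC] := @average_bound_fin p 'I_N (fun i => coordM i rho) us p1
  (fun i => tc _ _ tr) Lus.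
pose d (n : nat) : R := 2^-1 ^+ n.
have d0 n : 0 < d n by rewrite exprn_gt0.
have dS n : d n = 2 * d n.+1 by rewrite /d exprS mulrA mulfV ?mul1r.
have d1 n : d n <= 1 by rewrite exprn_ile1// invf_le1// ler1n.
(* At scale 2^-n the averages of the second derivatives are O(2^(nN/p)), and a dyadic step of the
   flow gains the length 2^-n. The growth ratio is [q0], and N < 2p says precisely that it is below
   2. *)
pose q0 : R := 2 `^ (N%:R / p - 1).
have q00 : 0 < q0 by rewrite powR_gt0.
have q02 : q0 < 2.
  have l2 : 0 < ln (2 : R) by rewrite ln_gt0// ltr1n.
  rewrite /q0 /powR (gt_eqF (ltr0Sn _ 1)) -[ltRHS](lnK (x := 2)) ?posrE//.
  by rewrite ltr_expR gtr_pMl// ltrBlDr ltr_pdivrMr.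
(* [r < 2] makes [r / 2] a contraction ratio for the averages of [u]; the lower bound 3/2 is the
   slack used by the induction in [claim2]. *)
have [r [r32 r2 qr]] : exists r : R, [/\ 3 / 2 <= r, r < 2 & q0 <= r].
  by exists (Num.max (3 / 2) q0); rewrite gt_max q02 !le_max !lexx orbT andbT; split=> //; lra.
have r0 : 0 < r by lra.
have dq n : d n.+1 `^ (- (N%:R / p)) * d n.+1 <= r ^+ n.+1.
  rewrite -[X in _ * X](powRr1 (a := d n.+1)) ?(ltW (d0 _))//.
  rewrite -powRD ?(gt_eqF (d0 _)) ?implybT//.
  rewrite (_ : d n.+1 `^ _ = q0 ^+ n.+1); first by rewrite lerXn2r// nnegrE ltW.
  have -> : d n.+1 = 2 `^ (- n.+1%:R) by rewrite /d powRN powR_mulrn// exprVn.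
  rewrite -(powR_mulrn n.+1 (ltW q00)) /q0 -(powRrM 2 (- n.+1%:R)) -(powRrM 2 (_ - 1)).
  by congr (_ `^ _); ring.
have claim1 i n s x : d n.+1 <= s <= d n -> `|B i (d n) x - B i s x| <= D * r ^+ n.+1.
  move=> /andP[sn]; rewrite le_eqVlt => /orP[/eqP ->|ns].
    by rewrite subrr normr0 mulr_ge0// exprn_ge0// ltW.
  have s0 : 0 < s by apply: lt_le_trans sn.
  have sab : 0 < s < d n by rewrite s0.
  apply: (le_trans (average_flow_bound (M := D * d n.+1 `^ (- (N%:R / p))) sab
    (tc _ _ tr) (lus i) (luss i) (usss i) _)).
    move=> t /andP[st tn]; have t0 : 0 < t by apply: lt_le_trans st.
    apply: (le_trans _ (le_trans (HD t x t0) _)).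
      (* The sum for a single [i] is part of the sum over all pairs, whose other terms are
         nonnegative. *)
      rewrite (bigID (fun ij : 'I_N * 'I_N => ij.1 == i))/= -[leLHS]addr0 lerD//; last first.
        by apply: sumr_ge0.
      rewrite (reindex_onto (fun j => (i, j)) snd)/=; last by move=> [a b] /= /eqP ->.
      by under [leRHS]eq_bigl do rewrite !eqxx.
    rewrite ler_wpM2l// !powRN lef_pV2 ?posrE ?powR_gt0//.
    by rewrite ge0_ler_powR ?nnegrE ?divr_ge0 ?ler0n ?(ltW p0) ?(ltW t0) ?(ltW (d0 _))// (le_trans sn).
  rewrite -mulrA ler_wpM2l//; apply: le_trans (dq n); rewrite ler_wpM2l ?powR_ge0//.
  by rewrite dS; lra.
pose C' := C0 + 3 * D.
have claim2 i n x : `|B i (d n) x| <= C' * r ^+ n.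
  elim: n => [|n IH].
    rewrite expr0 mulr1 /d expr0; apply: (@le_trans _ _ C0); last by rewrite lerDl mulr_ge0.
    have := HC 1 x ltr01; rewrite powR1 mulr1; apply: le_trans.
    by rewrite (bigD1 i)//= lerDl sumr_ge0.
  have : `|B i (d n) x - B i (d n.+1) x| <= D * r ^+ n.+1.
    by apply: claim1; rewrite lexx/= [leRHS]dS; have := d0 n.+1; lra.
  rewrite distrC; set b1 := B i (d n.+1) x; set b0 := B i (d n) x in IH *.
  have := ler_normD (b1 - b0) b0; rewrite subrK => H1 H2.
  apply: (le_trans H1); apply: (le_trans (lerD H2 IH)).
  (* The induction closes if C' + D r <= C' r; for C' = C0 + 3 D the difference is the displayed
     combination, nonnegative since r >= 3/2. *)
  rewrite exprS -subr_ge0 (_ : _ - _ = r ^+ n * (C0 * (r - 1) + D * (2 * r - 3))).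
    apply: mulr_ge0; first by rewrite exprn_ge0// ltW.
    have r1' : 0 <= r - 1 by lra.
    have r3' : 0 <= 2 * r - 3 by lra.
    by rewrite addr_ge0// mulr_ge0.
  by rewrite /C'; ring.
have claim3 i n s x : d n.+1 <= s <= d n -> `|B i s x| <= (C' + 2 * D) * r ^+ n.
  move=> sn; have H1 := claim1 i n s x sn; have H2 := claim2 i n x.
  have := ler_normB (B i (d n) x) (B i (d n) x - B i s x); rewrite opprB addrC subrK => H3.
  apply: (le_trans H3); apply: (le_trans (lerD H2 H1)).
  rewrite (mulrDl C') lerD2l exprS mulrA ler_wpM2r ?exprn_ge0 ?(ltW r0)//.
  by rewrite mulrC ler_wpM2r// ltW.
pose K := N%:R * (C' + 2 * D).
have C'0 : 0 <= C' by rewrite addr_ge0// mulr_ge0.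
have K0 : 0 <= K by rewrite mulr_ge0// addr_ge0// mulr_ge0.
have claim4 n x : `|A rho u (d n.+1) x - A rho u (d n) x| <= K * (r / 2) ^+ n.
  rewrite distrC.
  have dd : 0 < d n.+1 < d n by rewrite d0/= [ltRHS]dS; have := d0 n.+1; lra.
  apply: (le_trans (average_flow_bound (M := K * r ^+ n) dd tr lu lus uus _)).
    move=> s sn; rewrite -mulrA mulr_natl.
    apply: le_trans (_ : \sum_(i < N) ((C' + 2 * D) * r ^+ n) <= _); last first.
      by rewrite sumr_const card_ord.
    by apply: ler_sum => i _; exact: claim3.
  rewrite -mulrA ler_wpM2l// exprMn ler_wpM2l ?exprn_ge0 ?(ltW r0)//.
  by rewrite -/(d n); have := d0 n.+1; lra.
have th : 0 <= r / 2 < 1 by apply/andP; split; lra.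
have /choice[u0 Hu0] : forall x, exists l : R, forall n,
    `|A rho u (d n) x - l| <= K / (1 - r / 2) * (r / 2) ^+ n.
  by move=> x; have [l _ Hl] := geometric_cvg th (fun n => claim4 n x); exists l.
set c := K / (1 - r / 2) in Hu0.
have c0 : 0 <= c by rewrite divr_ge0//; lra.
have ct : (fun n => c * (r / 2) ^+ n) @ \oo --> (0 : R).
  by rewrite -(mulr0 c); apply: cvgMr; apply: cvg_expr; rewrite ger0_norm; lra.
have cA n : continuous (A rho u (d n)).
  rewrite (_ : A _ _ _ = mollify (rescale rho (d n)) u); last first.
    by apply/funext => x; exact: average_mollify.
  by apply: continuous_mollify => //; exact: rtest_rescale.
have cu0 : continuous u0.
  move=> x; apply/(@cvgrPdist_lt _ _ _ (nbhs x) (nbhs_filter x)) => e e0.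
  have e3 : 0 < e / 3 by rewrite divr_gt0.
  have [n _ /(_ n (leqnn n))] := (cvgrPdist_lt _ _).1 ct _ e3.
  rewrite sub0r normrN => /(le_lt_trans (ler_norm _)) cn.
  have := (@cvgrPdist_lt _ _ _ (nbhs x) (nbhs_filter x) _ _).1 (cA n x) _ e3.
  apply: filterS => y xy.
  have := Hu0 x n; have := Hu0 y n; move: xy cn.
  set a := A _ _ _ x; set b := A _ _ _ y.
  have : `|u0 x - u0 y| <= `|a - u0 x| + `|a - b| + `|b - u0 y|.
    rewrite (_ : u0 x - u0 y = - (a - u0 x) + (a - b) + (b - u0 y)); last by ring.
    by rewrite (le_trans (ler_normD _ _))// lerD2r (le_trans (ler_normD _ _))// normrN.
  lra.
exists u0 => //.
have lu0 : locint u0 by exact: continuous_locint pk cu0.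
have lN v : locint v -> locint (fun x => -1 * v x) by exact: locintZ.
have := locint_test_eq0 bq (locintD lu (lN _ lu0)).
(* Tested against [f], the averages tend to [u] by [mollify_close], and to [u0] because their
   pointwise convergence is uniform in the centre. *)
have H f : rtest f -> \int[mu]_x ((u x + -1 * u0 x) * f x) = 0.
  move=> tf; have [C HC0 HCf] := mollify_close tr r1 re lu tf.
  have if_ : mu.-integrable setT (EFin \o (fun x => `|f x|)).
    exact: (integrable_norm (rtest_integrable tf)).
  have iu := locint_mul_rtest lu tf; have iu0 := locint_mul_rtest lu0 tf.
  rewrite (_ : \int[mu]_x _ = \int[mu]_x (u x * f x) - \int[mu]_x (u0 x * f x)); last first.
    by rewrite -RintegralB//; apply: eq_Rintegral => x _; rewrite mulN1r mulrBl.
  set a := _ - _; pose J := \int[mu]_x `|f x|.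
  have aB n : `|a| <= c * (r / 2) ^+ n * J + C * d n.
    have iA : mu.-integrable setT (EFin \o (fun x => mollify (rescale rho (d n)) u x * f x)).
      apply: locint_mul_rtest tf; apply: continuous_locint pk _.
      by apply: continuous_mollify => //; exact: rtest_rescale.
    have dn : 0 < d n <= 1 by rewrite d0 d1.
    have := HCf _ dn; set b := \int[mu]_x (mollify _ _ _ * _) => H1.
    have H2 : `|b - \int[mu]_x (u0 x * f x)| <= c * (r / 2) ^+ n * J.
      rewrite /b -RintegralB// -RintegralZl//; apply: Rintegral_norm_le.
      - exact: (integrableB _ iA iu0).
      - exact: (integrableZl _ _ if_).
      - by move=> x; rewrite -mulrBl normrM ler_wpM2r// -average_mollify// Hu0.
    rewrite /a -(subrKA b) addrC (le_trans (ler_normD _ _))// lerD//.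
    by rewrite distrC.
  apply/eqP; rewrite -normr_le0.
  have cv : (fun n => c * (r / 2) ^+ n * J + C * d n) @ \oo --> (0 * J + C * 0 : R).
    apply: cvgD; first by apply: cvgMl.
    by apply: cvgMr; apply: cvg_expr; rewrite ger0_norm ?invf_lt1 ?ltr1n.
  rewrite mul0r mulr0 addr0 in cv.
  rewrite -(cvg_lim (@Rhausdorff R) cv); apply: limr_ge; first by apply/cvg_ex; exists 0.
  exact: nearW.
move=> /(_ H); apply: filterS => x; rewrite mulN1r => /eqP.
by rewrite subr_eq0 => /eqP.
Qed.

End sobolev_embedding.

(** * Derivatives of the profile phi *)

Lemma powR_antimono (R : realType) (t b d : R) : 0 < t <= 1 -> d <= b -> t `^ b <= t `^ d.
Proof.
move=> /andP[t0 t1] db; rewrite /powR gt_eqF// ler_expR.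
by rewrite ler_wnM2r// ln_le0.
Qed.

Section radial_powers.
Context {R : realType} {N : nat}.
Local Notation E := 'rV[R]_N.
Implicit Types (x y z : E) (f g : E -> R) (i j : 'I_N) (a b : R).

Lemma C1_at_comp1 (G : R -> R) f x (d : R) : C1_at x f -> is_derive (f x) 1 G d ->
  C1_at x (fun y => G (f y)) /\ forall i, pd i (fun y => G (f y)) x = d * pd i f x.
Proof.
move=> [cf df] dG.
have H i : is_derive x (delta_mx ord0 i) (fun y => G (f y)) (d * pd i f x).
  rewrite -[x in is_derive x](addr0) -(scale0r (delta_mx ord0 i)).
  apply/is_derive_line.
  have dL : is_derive (0 : R) 1 (fun s => f (x + s *: delta_mx ord0 i)) (pd i f x).
    apply/is_derive_line; rewrite scale0r addr0.
    exact: DeriveDef (df i) _.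
  apply: is_derive1_comp => //.
  by rewrite scale0r addr0.
split; last by move=> i; exact: derive_val.
split; last by move=> i; exact: ex_derive.
apply: continuous_comp cf _.
by apply: differentiable_continuous; apply/derivable1_diffP; exact: ex_derive.
Qed.

Lemma C1_at_sum n (F : 'I_n -> E -> R) x : (forall k, C1_at x (F k)) ->
  C1_at x (fun y => \sum_k F k y) /\
  forall i, pd i (fun y => \sum_k F k y) x = \sum_k pd i (F k) x.
Proof.
elim: n => [|n IH] in F *.
  move=> _; rewrite (_ : (fun y => _) = (fun=> 0)); last by apply/funext => y; rewrite big_ord0.
  by split=> [|i]; [exact: C1_at_cst|rewrite pd_cst big_ord0].
move=> CF; rewrite (_ : (fun y => _) = (fun y => \sum_(k < n) F (widen_ord (leqnSn n) k) y + F ord_max y)).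
  have [C P] := IH (fun k => F (widen_ord (leqnSn n) k)) (fun k => CF _).
  split=> [|i]; first exact: C1_atD C (CF ord_max).
  by rewrite (pdD i C (CF ord_max)) P big_ord_recr.
by apply/funext => y; rewrite big_ord_recr.
Qed.

(** The squared Euclidean norm, a polynomial. The sup norm is not differentiable, so radial
    functions are differentiated through [sqn] and then estimated by powers of the sup norm. *)
Definition sqn x : R := \sum_i x ord0 i ^+ 2.

Lemma sqn_C1 x : C1_at x sqn /\ forall i, pd i sqn x = 2 * x ord0 i.
Proof.
have [C P] := @C1_at_sum N (fun k y => y ord0 k * y ord0 k) x
  (fun k => C1_atM (C1_at_coord x k) (C1_at_coord x k)).
split=> // i; rewrite [LHS]P (bigD1 i)//= big1 => [|k ki].
  rewrite addr0 (pdM _ (C1_at_coord x i) (C1_at_coord x i)) pd_coord eqxx /= mulr1n.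
  by ring.
rewrite (pdM _ (C1_at_coord x k) (C1_at_coord x k)) pd_coord.
by rewrite eq_sym (negbTE ki) mul0r mulr0 addr0.
Qed.

Lemma sqn_ge x : `|x| ^+ 2 <= sqn x.
Proof.
have [->|x0] := eqVneq x 0; first by rewrite normr0 expr0n/= sumr_ge0// => i _; rewrite sqr_ge0.
have s0 : 0 <= sqn x by apply: sumr_ge0 => i _; rewrite sqr_ge0.
rewrite -(@ler_sqrt _ _ (sqn x))// sqrtr_sqr normr_id; apply/rV_norm_leP; first exact: sqrtr_ge0.
move=> i; rewrite -sqrtr_sqr ler_sqrt// /sqn (bigD1 i)//= lerDl sumr_ge0// => k _.
exact: sqr_ge0.
Qed.

Lemma sqn_le x : sqn x <= N%:R * `|x| ^+ 2.
Proof.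
apply: (@le_trans _ _ (\sum_(i < N) `|x| ^+ 2)); last by rewrite sumr_const card_ord mulr_natl.
apply: ler_sum => i _.
by rewrite -real_normK ?num_real// lerXn2r ?nnegrE// le_coord_norm.
Qed.

Lemma sqn_gt0 x : x != 0 -> 0 < sqn x.
Proof. by move=> x0; rewrite (lt_le_trans _ (sqn_ge x))// exprn_gt0// normr_gt0. Qed.

Lemma sqn_powR b : exists2 C : R, 0 <= C &
  forall x, x != 0 -> sqn x `^ b <= C * `|x| `^ (2 * b).
Proof.
exists (Num.max 1 (N%:R `^ b)); first by rewrite le_max ler01.
move=> x x0; have nx : 0 < `|x| by rewrite normr_gt0.
have nE : `|x| `^ (2 * b) = (`|x| ^+ 2) `^ b by rewrite powRrM powR_mulrn.
have [b0|b0] := leP 0 b.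
  apply: (@le_trans _ _ ((N%:R * `|x| ^+ 2) `^ b)).
    by rewrite ge0_ler_powR ?nnegrE ?sqn_le// ?mulr_ge0 ?exprn_ge0// (ltW (sqn_gt0 x0)).
  by rewrite powRM ?exprn_ge0// nE ler_wpM2r ?powR_ge0// le_max lexx orbT.
apply: (@le_trans _ _ (`|x| `^ (2 * b))); last by rewrite ler_peMl ?powR_ge0// le_max lexx.
rewrite nE -[b]opprK !(powRN _ (- b)) lef_pV2 ?posrE ?powR_gt0 ?sqn_gt0 ?exprn_gt0//.
rewrite ge0_ler_powR ?nnegrE ?sqn_ge ?exprn_ge0 ?(ltW (sqn_gt0 x0))//.
by rewrite oppr_ge0 ltW.
Qed.

Lemma sqn_powR_C1 a x : x != 0 -> C1_at x (fun y => sqn y `^ a) /\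
  forall i, pd i (fun y => sqn y `^ a) x = 2 * a * (x ord0 i * sqn x `^ (a - 1)).
Proof.
move=> x0; have [C P] := sqn_C1 x.
have [C' P'] := C1_at_comp1 C (is_derive1_powR a (sqn_gt0 x0)).
by split=> // i; rewrite P' P; ring.
Qed.

Lemma near_neq0 x : x != 0 -> \forall y \near x, y != 0.
Proof. by move=> x0; apply: open_nbhs_nbhs; split=> //; exact: open_rV_neq0. Qed.

Lemma sqn_powR_pd2 a i x : x != 0 ->
  C1_at x (pd i (fun y => sqn y `^ a)) /\
  forall j, pd j (pd i (fun y => sqn y `^ a)) x =
    2 * a * ((j == i)%:R * sqn x `^ (a - 1) +
      x ord0 i * (2 * (a - 1) * (x ord0 j * sqn x `^ (a - 1 - 1)))).
Proof.
move=> x0; have [C P] := sqn_powR_C1 (a - 1) x0.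
have CM := C1_atM (C1_at_coord x i) C.
have CMM := C1_atM (C1_at_cst (2 * a) x) CM.
have ne : {near x, (fun y => 2 * a * (y ord0 i * sqn y `^ (a - 1))) =1 pd i (fun y => sqn y `^ a)}.
  by apply: filterS (near_neq0 x0) => y y0; have [_ ->] := sqn_powR_C1 a y0.
split; first exact: near_eq_C1_at ne CMM.
move=> j; rewrite -(near_eq_pd j ne) (pdM j (C1_at_cst (2 * a) x) CM) pd_cst mul0r add0r (pdM j (C1_at_coord x i) C).
by rewrite pd_coord P.
Qed.

(** Each derivative costs one power of |x|, giving |x|^(2a-1) and |x|^(2a-2), which for |x| < 1 are
    controlled as soon as 2a >= 2 - alpha. The case a = 0 is separate: there the derivatives
    vanish. *)
Lemma sqn_powR_pd_bound (alpha a : R) : alpha < 2 -> a = 0 \/ 2 - alpha <= 2 * a ->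
  exists2 C : R, 0 <= C & forall x, x != 0 -> `|x| < 1 ->
    (forall i, `|pd i (fun y => sqn y `^ a) x| <= C * `|x| `^ (1 - alpha)) /\
    (forall i j, `|pd j (pd i (fun y => sqn y `^ a)) x| <= C * `|x| `^ (- alpha)).
Proof.
move=> al2 Ha; have [C1 C10 H1] := sqn_powR (a - 1); have [C2 C20 H2] := sqn_powR (a - 1 - 1).
exists (`|2 * a| * (C1 + `|2 * (a - 1)| * C2)); first by rewrite mulr_ge0// addr_ge0// mulr_ge0.
move=> x x0 x1; have nx : 0 < `|x| by rewrite normr_gt0.
have S1 := H1 x x0; have S2 := H2 x x0.
have pP b : 0 <= sqn x `^ b by exact: powR_ge0.
have K0 : 0 <= `|2 * (a - 1)| * C2 by rewrite mulr_ge0.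
case: Ha => [a0|Ha].
  split=> i; first by have [_ ->] := sqn_powR_C1 a x0; rewrite a0 mulr0 !mul0r normr0 mul0r.
  by move=> j; have [_ ->] := sqn_powR_pd2 a i x0; rewrite a0 mulr0 !mul0r normr0 mul0r.
have nD b d : `|x| `^ b * `|x| `^ d = `|x| `^ (b + d).
  by rewrite powRD// (gt_eqF nx) implybT.
have nxp b d : d <= b -> `|x| `^ b <= `|x| `^ d.
  by move=> db; apply: powR_antimono => //; rewrite nx ltW.
split=> i.
  have [_ ->] := sqn_powR_C1 a x0; rewrite normrM -mulrA ler_wpM2l// normrM (ger0_norm (pP _)).
  apply: (@le_trans _ _ (`|x| * (C1 * `|x| `^ (2 * (a - 1))))).
    by rewrite ler_pM// le_coord_norm.
  rewrite mulrCA -[X in _ * (X * _)]powRr1// nD.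
  by rewrite ler_pM ?powR_ge0// ?lerDl//; apply: nxp; lra.
move=> j; have [_ ->] := sqn_powR_pd2 a i x0; rewrite normrM -[leRHS]mulrA ler_wpM2l//.
apply: (le_trans (ler_normD _ _)); rewrite [leRHS]mulrDl; apply: lerD.
  rewrite normrM (ger0_norm (pP _)); apply: (@le_trans _ _ (1 * (C1 * `|x| `^ (2 * (a - 1))))).
    by rewrite ler_pM//; case: eqP; rewrite ?normr1 ?normr0.
  by rewrite mul1r ler_wpM2l//; apply: nxp; lra.
rewrite mulrCA (normrM (2 * (a - 1))) -[leRHS]mulrA ler_wpM2l// !normrM (ger0_norm (pP _)).
apply: (@le_trans _ _ (`|x| * (`|x| * (C2 * `|x| `^ (2 * (a - 1 - 1)))))).
  by rewrite !ler_pM ?mulr_ge0 ?powR_ge0 ?le_coord_norm.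
rewrite !(mulrCA _ C2) ler_wpM2l// -{1 2}[`|x|](powRr1)//.
by rewrite !nD; apply: nxp; lra.
Qed.

End radial_powers.

Section singular_multipliers.
Context {R : realType} {N : nat}.
Local Notation E := 'rV[R]_N.
Implicit Types (x y z : E) (f g h : E -> R) (i j : 'I_N) (a b alpha : R).

(** One dilated plateau removes the origin and another removes infinity; the product is a test
    function, hence bounded, and agrees with [h] on the annulus. *)
Lemma smooth_annulus_bounded (k : E -> R) h (d M : R) : plateau k ->
  smooth_on [set x | x != 0] h -> 0 < d ->
  exists2 C : R, 0 <= C & forall x, d <= `|x| -> `|x| < M -> `|h x| <= C.
Proof.
move=> [tk k1] sh d0; have [r kr] := tk.2.
pose a := (`|r| + 1) / d; pose b := (`|M| + 1)^-1.
have a0 : 0 < a by rewrite divr_gt0// ltr_wpDl.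
have b0 : 0 < b by rewrite invr_gt0 ltr_wpDl.
have ts (e : R) : 0 < e -> rtest (fun x => k (e *: x)).
  move=> e0; have := rtest_affine 0 e0 tk.
  by congr rtest; apply/funext => x; rewrite addr0.
have s1 : smooth_on setT (fun x => 1 + -1 * k (a *: x)).
  apply: smooth_onD; [exact: openT|exact: smooth_on_cst|].
  by apply: smooth_onM; [exact: openT|exact: smooth_on_cst|exact: (ts _ a0).1].
have tq : rtest0 (fun x => (1 + -1 * k (a *: x)) * k (b *: x)).
  split; first exact: rtestM s1 (ts _ b0).
  exists a^-1; first by rewrite invr_gt0.
  move=> x xa; rewrite k1 ?mulr1 ?subrr ?mul0r//.
  by rewrite normrZ gtr0_norm// mulrC -ltr_pdivlMr// div1r.
have [C C0 HC] := rtest_bounded (rtest0_mul_smooth sh tq).1.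
exists C => // x dx xM; have := HC x.
rewrite kr; last first.
  rewrite normrZ gtr0_norm// /a mulrAC ler_pdivlMr//.
  apply: (@le_trans _ _ ((`|r| + 1) * d)); last by rewrite ler_wpM2l// addr_ge0.
  by rewrite ler_wpM2r ?(ltW d0)// (le_trans (ler_norm _))// lerDl.
rewrite k1 ?mulr0 ?addr0 ?mulr1//.
rewrite normrZ gtr0_norm// mulrC ltr_pdivrMr ?ltr_wpDl// mul1r.
by rewrite (lt_le_trans xM)// (le_trans (ler_norm _))// lerDl.
Qed.

(** What the multiplication theorems require of [phi] and of its inverse. The weights [hw] vanish
    outside the unit ball, so away from the origin this is plain boundedness; with exponent
    [alpha = 0] it is so everywhere. *)
Definition singular_multiplier alpha g := smooth_on [set x | x != 0] g /\
  exists2 C : R, 0 <= C & forall x, x != 0 ->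
    [/\ `|g x| <= C, forall i, `|pd i g x| <= C * (1 + hw (1 - alpha) 1 x) &
        forall i j, `|pd j (pd i g) x| <= C * (1 + hw (- alpha) 1 x)].

Lemma psi_sqn alpha (c : R) (m : nat) x :
  psi alpha c m x = \sum_(k < m.+1)
    c ^+ k * Gamma ((N%:R - alpha) / (2 - alpha)) /
      ((2 - alpha) ^+ (2 * k) * k`!%:R * Gamma ((N%:R - alpha) / (2 - alpha) + k%:R)) *
    sqn x `^ (2^-1 * ((2 - alpha) * k%:R)).
Proof.
apply: eq_bigr => k _; congr (_ * _).
by rewrite [RHS]powRrM powR12_sqrt// sumr_ge0// => i _; exact: sqr_ge0.
Qed.

Lemma sum_powers_bound alpha n (c e : 'I_n -> R) f (d : R) : alpha < 2 ->
  (forall l : 'I_n, e l = 0 \/ 2 - alpha <= 2 * e l) -> 0 < d <= 1 ->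
  (forall x, `|x| < d -> f x = \sum_k c k * sqn x `^ e k) ->
  exists2 C : R, 0 <= C & forall x, x != 0 -> `|x| < d ->
    (forall i, `|pd i f x| <= C * `|x| `^ (1 - alpha)) /\
    (forall i j, `|pd j (pd i f) x| <= C * `|x| `^ (- alpha)).
Proof.
move=> al2 He /andP[d0 d1] fE.
have /choice[C HC] : forall k, exists C : R, 0 <= C /\ forall x, x != 0 -> `|x| < 1 ->
    (forall i, `|pd i (fun y => sqn y `^ e k) x| <= C * `|x| `^ (1 - alpha)) /\
    (forall i j, `|pd j (pd i (fun y => sqn y `^ e k)) x| <= C * `|x| `^ (- alpha)).
  by move=> k; have [C C0 H] := @sqn_powR_pd_bound R N _ _ al2 (He k); exists C.
exists (\sum_k `|c k| * C k).
  by apply: sumr_ge0 => k _; rewrite mulr_ge0//; have [] := HC k.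
have P1 x : x != 0 -> `|x| < d -> forall i,
    pd i f x = \sum_k c k * pd i (fun y => sqn y `^ e k) x.
  move=> x0 xd i; have CF k := C1_atM (C1_at_cst (c k) x) (sqn_powR_C1 (e k) x0).1.
  have [_ P] := C1_at_sum CF.
  have ne : {near x, f =1 (fun y => \sum_k c k * sqn y `^ e k)}.
    apply/nbhs_ballP; exists (d - `|x|) => /=; first by rewrite subr_gt0.
    move=> y; rewrite -ball_normE/= => xy; apply: fE.
    have := lerB_dist y x; rewrite distrC; lra.
  rewrite (near_eq_pd i ne) P; apply: eq_bigr => k _.
  by rewrite (pdM i (C1_at_cst (c k) x) (sqn_powR_C1 (e k) x0).1) pd_cst mul0r add0r.
move=> x x0 xd; have x1 : `|x| < 1 by apply: lt_le_trans d1.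
split=> i.
  rewrite P1// (le_trans (ler_norm_sum _ _ _))// mulr_suml; apply: ler_sum => k _.
  by rewrite normrM -mulrA ler_wpM2l//; have [_ /(_ x x0 x1)[+ _]] := HC k; apply.
move=> j.
have CF k := C1_atM (C1_at_cst (c k) x) (sqn_powR_pd2 (e k) i x0).1.
have [_ P] := C1_at_sum CF.
have ne : {near x, pd i f =1 (fun y => \sum_k c k * pd i (fun z => sqn z `^ e k) y)}.
  have nd : \forall y \near x, `|y| < d.
    apply/nbhs_ballP; exists (d - `|x|) => /=; first by rewrite subr_gt0.
    move=> y; rewrite -ball_normE/= => xy.
    have := lerB_dist y x; rewrite distrC; lra.
  by apply: filterS2 (near_neq0 x0) nd => y y0 yd; exact: P1.
rewrite (near_eq_pd j ne) P (le_trans (ler_norm_sum _ _ _))// mulr_suml; apply: ler_sum => k _.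
rewrite (pdM j (C1_at_cst (c k) x) (sqn_powR_pd2 (e k) i x0).1) pd_cst mul0r add0r.
by rewrite normrM -mulrA ler_wpM2l//; have [_ /(_ x x0 x1)[_]] := HC k; apply.
Qed.

Lemma enorm_sqn x : enorm x = Num.sqrt (sqn x). Proof. by []. Qed.

Lemma norm_le_enorm x : `|x| <= enorm x.
Proof. by rewrite enorm_sqn -[leLHS]normr_id -sqrtr_sqr ler_sqrt ?sqn_ge// (le_trans _ (sqn_ge x))// sqr_ge0. Qed.

Lemma enorm_le_norm x : enorm x <= N%:R * `|x|.
Proof.
have [->|x0] := eqVneq x 0.
  rewrite normr0 mulr0 enorm_sqn /sqn big1 ?sqrtr0// => i _.
  by rewrite mxE expr0n.
have N1 : 1 <= N%:R :> R.
  rewrite ler1n lt0n; apply: contra_neq x0 => N0; subst N.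
  exact: thinmx0.
rewrite -[leRHS](ger0_norm (mulr_ge0 (ler0n R N) (normr_ge0 x))) -sqrtr_sqr enorm_sqn.
rewrite ler_sqrt ?sqr_ge0// (le_trans (sqn_le x))// exprMn ler_wpM2r ?sqr_ge0//.
by rewrite expr2 ler_peMl.
Qed.

(** Three zones: near 0 the explicit powers in [psi], whose exponents are 0 or at least [2 - alpha];
    then a bounded annulus; then the region where [phi] is constant. *)
Lemma is_phi_multiplier (k : E -> R) alpha (c : R) (m : nat) phi : plateau k -> 0 < alpha < 2 ->
  is_phi alpha c m phi -> singular_multiplier alpha phi.
Proof.
move=> pk /andP[al0 al2] [sphi _ phi12 phi0 [M phiM]]; split=> //.
have [d0 /= d00 Hd] := (nbhs_ballP _ _).1 phi0.
pose d := Num.min d0 1.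
have d01 : 0 < d <= 1 by rewrite /d lt_min d00 ltr01 ge_min lexx orbT.
have e0 (l : 'I_m.+1) : 2^-1 * ((2 - alpha) * l%:R) = 0 \/
    2 - alpha <= 2 * (2^-1 * ((2 - alpha) * l%:R)).
  have [l0|l0] := posnP l; first by left; rewrite l0 !mulr0.
  right; rewrite mulrA mulfV// mul1r ler_peMr ?ler1n//; lra.
have [C1 C10 H1] := sum_powers_bound al2 e0 d01 (f := phi)
  (c := fun l => c ^+ l * Gamma ((N%:R - alpha) / (2 - alpha)) /
      ((2 - alpha) ^+ (2 * l) * l`!%:R * Gamma ((N%:R - alpha) / (2 - alpha) + l%:R)))
  (fun x => ltac:(move=> xd; rewrite -psi_sqn; apply: Hd; rewrite -ball_normE/= sub0r normrN;
    apply: (lt_le_trans xd); rewrite ge_min lexx//)).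
have d_gt0 : 0 < d by case/andP: d01.
have [Ka Ka0 HKa] : exists2 K : R, 0 <= K & forall i x, d <= `|x| -> `|x| < M + 1 -> `|pd i phi x| <= K.
  have /choice[K HK] : forall i, exists K : R, 0 <= K /\
      forall x, d <= `|x| -> `|x| < M + 1 -> `|pd i phi x| <= K.
    move=> i; have [K K0 H] := smooth_annulus_bounded (M + 1) pk (smooth_on_pd i sphi) d_gt0.
    by exists K.
  exists (\sum_i K i) => [|i x dx xM]; first by apply: sumr_ge0 => i _; have [] := HK i.
  rewrite (bigD1 i)//= (le_trans ((HK i).2 x dx xM))// lerDl sumr_ge0// => j _.
  by have [] := HK j.
have [Kb Kb0 HKb] : exists2 K : R, 0 <= K &
    forall i j x, d <= `|x| -> `|x| < M + 1 -> `|pd j (pd i phi) x| <= K.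
  have /choice[K HK] : forall ij : 'I_N * 'I_N, exists K : R, 0 <= K /\
      forall x, d <= `|x| -> `|x| < M + 1 -> `|pd ij.2 (pd ij.1 phi) x| <= K.
    move=> ij; have [K K0 H] := smooth_annulus_bounded (M + 1) pk
      (smooth_on_pd ij.2 (smooth_on_pd ij.1 sphi)) d_gt0.
    by exists K.
  exists (\sum_ij K ij) => [|i j x dx xM]; first by apply: sumr_ge0 => ij _; have [] := HK ij.
  rewrite (bigD1 (i, j))//= (le_trans ((HK (i, j)).2 x dx xM))// lerDl sumr_ge0// => ij _.
  by have [] := HK ij.
have far x : M < `|x| -> \forall y \near x, phi y = 1.
  move=> Mx; apply/nbhs_ballP; exists (`|x| - M) => /=; first by rewrite subr_gt0.
  move=> y; rewrite -ball_normE/= => xy; apply: phiM; apply: lt_le_trans (norm_le_enorm y).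
  have := lerB_dist x y; lra.
have far1 x i : M < `|x| -> pd i phi x = 0.
  by move=> Mx; rewrite (@near_eq_pd _ _ x phi (fun=> 1) i (far x Mx)) pd_cst.
have far2 x i j : M < `|x| -> pd j (pd i phi) x = 0.
  move=> Mx; rewrite (@near_eq_pd _ _ x (pd i phi) (fun=> 0) j) ?pd_cst//.
  apply/nbhs_ballP; exists (`|x| - M) => /=; first by rewrite subr_gt0.
  move=> y; rewrite -ball_normE/= => xy; apply: far1.
  have := lerB_dist x y; lra.
exists (2 + C1 + Ka + Kb); first by rewrite !addr_ge0.
move=> x x0; have hge e := hw_ge0 e 1 x.
split=> [|i|i j].
- have /andP[h1 h2] := phi12 x; rewrite ger0_norm; lra.
- have := hge (1 - alpha); have [xd|dx] := ltP `|x| d.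
    have x1 : `|x| < 1 by apply: (lt_le_trans xd); case/andP: d01.
    have [/(_ i) + _] := H1 x x0 xd; rewrite /hw ball_indicE x1 mul1r => Hi p0.
    by apply: (le_trans Hi); apply: ler_pM => //; lra.
  have [xM|Mx] := ltP `|x| (M + 1); last first.
    by rewrite far1 ?normr0; [move=> ?; rewrite mulr_ge0//; lra|lra].
  move=> h0; apply: (le_trans (HKa i x dx xM)); rewrite mulrDr mulr1.
  have : 0 <= (2 + C1 + Ka + Kb) * hw (1 - alpha) 1 x by rewrite mulr_ge0//; lra.
  by move: (_ * hw _ _ _) => t t0; lra.
- have := hge (- alpha); have [xd|dx] := ltP `|x| d.
    have x1 : `|x| < 1 by apply: (lt_le_trans xd); case/andP: d01.
    have [_ /(_ i j) +] := H1 x x0 xd; rewrite /hw ball_indicE x1 mul1r => Hi p0.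
    by apply: (le_trans Hi); apply: ler_pM => //; lra.
  have [xM|Mx] := ltP `|x| (M + 1); last first.
    by rewrite far2 ?normr0; [move=> ?; rewrite mulr_ge0//; lra|lra].
  move=> h0; apply: (le_trans (HKb i j x dx xM)); rewrite mulrDr mulr1.
  have : 0 <= (2 + C1 + Ka + Kb) * hw (- alpha) 1 x by rewrite mulr_ge0//; lra.
  by move: (_ * hw _ _ _) => t t0; lra.
Qed.

End singular_multipliers.

Section profile.
Context {R : realType} {N : nat}.
Local Notation E := 'rV[R]_N.
Implicit Types (x y z : E) (f g h : E -> R) (i j : 'I_N) (a b alpha : R).

(** Second derivatives of the inverse contain a product of two first derivatives, of order |x|^(2 -
    2 alpha); near the origin this is dominated by |x|^(-alpha) because alpha <= 2. *)
Lemma singular_multiplierV alpha g : alpha <= 2 -> singular_multiplier alpha g ->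
  (forall x, 1 / 2 <= g x) -> singular_multiplier alpha (fun x => (g x)^-1).
Proof.
move=> al2 [sg [C C0 HC]] g12.
have gp x : 0 < g x by rewrite (lt_le_trans _ (g12 x))// divr_gt0.
have gn0 x : g x != 0 by rewrite gt_eqF.
have gi x : 0 <= (g x)^-1 <= 2.
  by rewrite invr_ge0 ltW//= -[leRHS]invrK lef_pV2 ?posrE ?invr_gt0// -div1r.
have oN : open [set x : E | x != 0] by exact: open_rV_neq0.
split; first exact: smooth_onV.
have P1 x i : x != 0 -> pd i (fun y => (g y)^-1) x = -1 * pd i g x * ((g x)^-1 * (g x)^-1).
  by move=> x0; rewrite (pdV i (gn0 x) (smooth_on_C1 sg x0)) mulN1r.
have P2 x i j : x != 0 -> pd j (pd i (fun y => (g y)^-1)) x =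
    - pd j (pd i g) x * ((g x)^-1 * (g x)^-1) +
    2 * (pd i g x * pd j g x) * ((g x)^-1 * (g x)^-1 * (g x)^-1).
  move=> x0.
  have C1 := smooth_on_C1 sg x0; have C2 := smooth_on_C1 (smooth_on_pd i sg) x0.
  have CV := C1_atV (gn0 x) C1; have CVV := C1_atM CV CV.
  have CN := C1_atM (C1_at_cst (-1) x) C2.
  have ne : {near x, pd i (fun y => (g y)^-1) =1
      (fun y => -1 * pd i g y * ((g y)^-1 * (g y)^-1))}.
    by apply: filterS (near_neq0 x0) => y y0; exact: P1.
  rewrite (near_eq_pd j ne) (pdM j CN CVV) (pdM j CV CV) (pdM j (C1_at_cst (-1) x) C2).
  rewrite pd_cst P1//; move: (pd i g x) (pd j g x) (pd j (pd i g) x) (g x)^-1 => p q r t.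
  by ring.
(* The numbers 2, 4 and 8 bound the first three powers of the inverse. The quadratic term carries 2
   times 8, doubled once more by (1 + s)^2 <= 2 (1 + s^2). *)
exists (2 + 4 * C + 32 * C ^+ 2); first by rewrite !addr_ge0 ?mulr_ge0 ?sqr_ge0.
have CC : 0 <= C ^+ 2 by exact: sqr_ge0.
move=> x x0; have [_ H1 H2] := HC x x0; have /andP[g0 g2] := gi x.
have nx : 0 < `|x| by rewrite normr_gt0.
have G2 : `|(g x)^-1 * (g x)^-1| <= 4.
  by rewrite ger0_norm ?mulr_ge0// (_ : 4 = 2 * 2); [rewrite ler_pM|ring].
have G3 : `|(g x)^-1 * (g x)^-1 * (g x)^-1| <= 8.
  by rewrite normrM (ger0_norm g0) (_ : 8 = 4 * 2); [rewrite ler_pM|ring].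
have h1 : 0 <= hw (1 - alpha) 1 x by exact: hw_ge0.
have h2 : 0 <= hw (- alpha) 1 x by exact: hw_ge0.
have h12 : hw (1 - alpha) 1 x ^+ 2 <= hw (- alpha) 1 x.
  rewrite /hw !ball_indicE; have [x1|_] := ltP `|x| 1; last by rewrite !mul0r expr0n.
  rewrite !mul1r expr2 -powRD ?(gt_eqF nx) ?implybT//.
  by apply: powR_antimono; [rewrite nx ltW|lra].
split=> [|i|i j].
- by rewrite ger0_norm// (le_trans g2)//; lra.
- rewrite P1// !normrM normrN1 mul1r -normrM.
  apply: (le_trans (ler_pM _ _ (H1 i) G2)) => //.
  rewrite mulrAC ler_wpM2r ?addr_ge0//; lra.
- rewrite P2// (le_trans (ler_normD _ _))//.
  apply: (@le_trans _ _ (C * (1 + hw (- alpha) 1 x) * 4 +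
      (2 * (C * (1 + hw (1 - alpha) 1 x) * (C * (1 + hw (1 - alpha) 1 x)))) * 8)).
    apply: lerD; rewrite normrM; first by rewrite normrN; apply: ler_pM => //; exact: H2.
    apply: ler_pM => //; rewrite normrM [`|2|]ger0_norm// ler_wpM2l// normrM.
    by apply: ler_pM => //; exact: H1.
  move: h1 h2 h12; move: (hw (1 - alpha) 1 x) (hw (- alpha) 1 x) => s t s0 t0 st.
  have s2 : (1 + s) ^+ 2 <= 2 * (1 + t).
    apply: (@le_trans _ _ (2 * (1 + s ^+ 2))); last by rewrite ler_wpM2l// lerD2l.
    rewrite -subr_ge0 (_ : _ - _ = (1 - s) ^+ 2); [exact: sqr_ge0|ring].
  apply: (@le_trans _ _ (C * (1 + t) * 4 + C ^+ 2 * 16 * (2 * (1 + t)))).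
    rewrite lerD2l (_ : _ * 8 = C ^+ 2 * 16 * (1 + s) ^+ 2); last by ring.
    by rewrite ler_wpM2l// mulr_ge0.
  rewrite (_ : _ + _ = (4 * C + 32 * C ^+ 2) * (1 + t)); last by ring.
  by rewrite ler_wpM2r ?addr_ge0//; lra.
Qed.

Lemma continuous_sqn_powR a : 0 <= a -> {for 0, continuous (fun x : E => sqn x `^ a)}.
Proof.
rewrite le_eqVlt => /orP[/eqP<-|a0].
  by rewrite (_ : (fun x => _) = (fun=> 1)); [exact: cst_continuous|apply/funext => x; rewrite powRr0].
have [C C0 HC] := @sqn_powR R N a.
have s00 : sqn (0 : E) = 0.
  by rewrite /sqn big1// => i _; rewrite mxE expr0n.
rewrite /prop_for /continuous_at; apply/(@cvgrPdist_lt _ _ _ (nbhs (0 : E)) (nbhs_filter (0 : E))) => e e0.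
rewrite s00 powR0 ?gt_eqF//.
pose d := (e / (C + 1)) `^ (2 * a)^-1.
have eC : 0 < e / (C + 1) by rewrite divr_gt0// ltr_wpDl.
have d0 : 0 < d by rewrite powR_gt0.
apply/nbhs_ballP; exists d => //= y; rewrite -ball_normE/= !sub0r !normrN => yd.
rewrite ger0_norm ?powR_ge0//.
have [->|y0] := eqVneq y 0; first by rewrite s00 powR0 ?gt_eqF.
rewrite (le_lt_trans (HC y y0))//.
have : `|y| `^ (2 * a) < d `^ (2 * a).
  by rewrite gt0_ltr_powR ?nnegrE ?(ltW d0)// mulr_gt0.
rewrite /d -powRrM mulVf ?mulf_neq0 ?gt_eqF// powRr1 ?(ltW eC)// ltr_pdivlMr ?ltr_wpDl//.
by apply: le_lt_trans; rewrite mulrC ler_wpM2l ?powR_ge0// lerDl.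
Qed.

(* [psi 0] is [G / G] with [G] a value of [Gamma], hence 0 or 1, and [phi 0 >= 1/2]:
   nothing needs to be known about [Gamma]. *)
Lemma is_phi0 alpha (c : R) (m : nat) (phi : E -> R) : alpha < 2 ->
  is_phi alpha c m phi -> phi 0 = 1.
Proof.
move=> al2 [_ _ phi12 phi0 _].
have := nbhs_singleton phi0; rewrite psi_sqn big_ord_recl/= big1 => [|l _].
  have -> : sqn (0 : E) = 0 by rewrite /sqn big1// => i _; rewrite mxE expr0n.
  rewrite mulr0 mulr0 powRr0 mulr1 muln0 !expr0 !mul1r addr0 addr0 => H.
  have /andP[h _] := phi12 0.
  have [G0|G0] := eqVneq (Gamma ((N%:R - alpha) / (2 - alpha))) 0.
    by move: h; rewrite H G0 mul0r; lra.
  by rewrite H divff.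
have -> : sqn (0 : E) = 0 by rewrite /sqn big1// => i _; rewrite mxE expr0n.
by rewrite powR0 ?mulr0// gt_eqF// !mulr_gt0// ?subr_gt0.
Qed.

(** Only the origin is in question, and there all exponents occurring in [psi] are nonnegative. *)
Lemma is_phi_continuous alpha (c : R) (m : nat) (phi : E -> R) : alpha < 2 ->
  is_phi alpha c m phi -> continuous phi.
Proof.
move=> al2 [sphi _ _ phi0 _] x.
have [->|x0] := eqVneq x 0; last by have [] := smooth_on_C1 sphi x0.
have csum (s : seq 'I_m.+1) (F : 'I_m.+1 -> E -> R) :
    (forall l, {for 0, continuous (F l)}) -> {for 0, continuous (fun y => \sum_(l <- s) F l y)}.
  move=> cF; elim: s => [|l s IH].
    by rewrite (_ : (fun y => _) = (fun=> 0)); [exact: cst_continuous|apply/funext => y; rewrite big_nil].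
  rewrite (_ : (fun y => _) = (fun y => F l y + \sum_(l <- s) F l y)).
    exact: continuousD (cF l) IH.
  by apply/funext => y; rewrite big_cons.
have cpsi : {for 0, continuous (@psi R N alpha c m)}.
  rewrite (_ : psi _ _ _ = (fun x => \sum_(l < m.+1)
    c ^+ l * Gamma ((N%:R - alpha) / (2 - alpha)) /
      ((2 - alpha) ^+ (2 * l) * l`!%:R * Gamma ((N%:R - alpha) / (2 - alpha) + l%:R)) *
    sqn x `^ (2^-1 * ((2 - alpha) * l%:R)))); last by apply/funext => y; exact: psi_sqn.
  apply: csum => l; apply: continuousM; first exact: cst_continuous.
  by apply: continuous_sqn_powR; rewrite !mulr_ge0// subr_ge0 ltW.
rewrite /prop_for /continuous_at (nbhs_singleton phi0).
apply: cvg_trans cpsi; apply: near_eq_cvg; first exact: (nbhs_filter (0 : E)).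
by apply: filterS phi0 => y ->.
Qed.

End profile.

(** * Multipliers of W^{1,p} and W^{2,p} *)

Section real_multipliers.
Context {R : realType} {N : nat}.
Local Notation E := 'rV[R]_N.
Local Notation mu := (lebesgue_rV N : {sigma_finite_measure set E -> \bar R}).
Implicit Types (x y z : E) (f g h u v w : E -> R) (i j : 'I_N) (e r p alpha : R).

Lemma LprD p u v : 1 <= p -> Lpr p u -> Lpr p v -> Lpr p (fun x => u x + v x).
Proof.
move=> p1 [mu_ u1] [mv v1]; split; first exact: measurable_funD.
have m1 : measurable_fun setT (fun _ : E => 1 : R) by exact: measurable_cst.
have E1 w : wint p (fun=> 1) w = (\int[mu]_x (`|w x| `^ p)%:E)%E.
  by apply: eq_integral => x _; rewrite mul1r.
rewrite -E1; apply: (le_lt_trans (@wint_tri _ _ p (fun=> 1) _ u v 1 _ _ _ _ _ _ _ _)) => //.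
- exact: measurable_funD.
- by move=> x; exact: ler_normD.
- by rewrite !E1; apply: lte_add_pinfty; [exact: (lte_mul_pinfty _ _ u1)|exact: (lte_mul_pinfty _ _ v1)].
Qed.

Lemma LprZ p (a : R) u : 0 <= p -> Lpr p u -> Lpr p (fun x => a * u x).
Proof.
move=> p0 [mu_ u1]; split; first exact: measurable_funM.
under eq_integral do rewrite normrM powRM// EFinM.
rewrite ge0_integralZl//.
- by apply: lte_mul_pinfty; [rewrite lee_fin powR_ge0|by []|].
- by apply/measurable_EFinP; exact: measurable_powR_norm.
Qed.

Lemma ae_le_Lpr p u v : (0 < N)%N -> 0 <= p -> measurable_fun setT u -> Lpr p v ->
  (forall x, x != 0 -> `|u x| <= `|v x|) -> Lpr p u.
Proof.
move=> N0 p0 mu_ [mv v1] uv; split; first exact: mu_.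
have mp w : measurable_fun setT w -> measurable_fun setT (fun x => (`|w x| `^ p)%:E).
  by move=> mw; apply/measurable_EFinP; exact: measurable_powR_norm.
have pp w x : [set: E] x -> (0 <= (`|w x| `^ p)%:E)%E by rewrite lee_fin powR_ge0.
apply: le_lt_trans v1.
apply: (ae_ge0_le_integral measurableT (pp u) (mp _ mu_) (pp v) (mp _ mv)).
apply: filterS (@ae_neq0 R N N0) => x x0 _.
by rewrite lee_fin ge0_ler_powR ?nnegrE// uv.
Qed.

Lemma wint_hw_Lpr p e r v : 0 <= e -> Lpr p v -> (wint p (hw e r) v < +oo)%E.
Proof.
move=> e0 [mv v1].
apply: (@le_lt_trans _ _ (wint p (fun=> `|r| `^ e) v)).
  apply: le_wint => //; first exact: measurable_hw; first by move=> x; exact: hw_ge0.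
  move=> x; rewrite ler_wpM2r ?powR_ge0// /hw ball_indicE.
  have [xr|_] := ltP `|x| r; last by rewrite mul0r powR_ge0.
  by rewrite mul1r ge0_ler_powR ?nnegrE// (le_trans (ltW xr))// ler_norm.
rewrite /wint; under eq_integral do rewrite EFinM.
rewrite ge0_integralZl//.
- by apply: lte_mul_pinfty; [rewrite lee_fin powR_ge0|by []|].
- by apply/measurable_EFinP; exact: measurable_powR_norm.
Qed.

Lemma Lpr_mul_hw p h v (C e : R) : (0 < N)%N -> 1 <= p -> 0 <= C -> measurable_fun setT h ->
  (forall x, x != 0 -> `|h x| <= C * (1 + hw e 1 x)) -> Lpr p v ->
  (wint p (hw (e * p) 1) v < +oo)%E -> Lpr p (fun x => h x * v x).
Proof.
move=> N0 p1 C0 mh hC Lv vh; have p0 : 0 < p by apply: lt_le_trans p1.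
have mv := Lv.1.
apply: (@ae_le_Lpr p _ (fun x => C * v x + C * (hw e 1 x * v x)) N0 (ltW p0)).
- exact: measurable_funM.
- apply: (LprD p1 (LprZ C (ltW p0) Lv)); apply: (LprZ _ (ltW p0)).
  split; first exact: measurable_funM (measurable_hw _ _) mv.
  rewrite (_ : integral _ _ _ = wint p (hw (e * p) 1) v)//; apply: eq_integral => x _.
  rewrite /hw ball_indicE; case: (`|x| < 1).
    by rewrite !mul1r normrM powRM// ger0_norm ?powR_ge0// powRrM.
  by rewrite !mul0r normr0 powR0// gt_eqF.
- move=> x x0; rewrite -mulrDr -[X in X + _]mul1r -mulrDl !normrM.
  rewrite (ger0_norm C0) (@ger0_norm _ (1 + _)) ?addr_ge0 ?hw_ge0// mulrA.
  by rewrite ler_wpM2r// hC.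
Qed.

(** On each set |x| >= 1/(n+1) the function agrees with its product by a cutoff vanishing near 0,
    which is continuous everywhere; these sets and the origin cover the space. *)
Lemma smooth_off0_measurable (k : E -> R) h : plateau k -> smooth_on [set x : E | x != 0] h ->
  measurable_fun setT h.
Proof.
move=> [tk k1] sh.
pose D (n : nat) : set E := [set x | n.+1%:R^-1 <= `|x|].
have mD n : measurable (D n).
  rewrite (_ : D n = ~` [set x : E | `|x| < n.+1%:R^-1]).
    by apply: measurableC; exact: measurable_rV_ball.
  by apply/seteqP; split=> x /=; rewrite /D/=; [move=> /le_gtF ->|move/negP; rewrite -leNgt].
have UD : \bigcup_n D n = [set x : E | x != 0].
  apply/seteqP; split=> x /=; first by move=> [n _]; rewrite /D/= -normr_gt0; apply: lt_le_trans; rewrite invr_gt0.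
  rewrite -normr_gt0 => x0; exists (Num.truncn `|x|^-1) => //; rewrite /D/=.
  rewrite -[leRHS]invrK lef_pV2 ?posrE ?invr_gt0// ltW//.
  exact: truncnS_gt.
have -> : [set: E] = [set x : E | x != 0] `|` [set 0].
  by apply/seteqP; split=> x //= _; case: (eqVneq x 0); [right|left].
apply/measurable_funU; [by rewrite -UD; exact: bigcup_measurable|exact: measurable_rV_set0|].
split; last exact: measurable_fun_set1.
rewrite -UD; apply/measurable_fun_bigcup => // n.
have [r kr] := tk.2.
pose a := (`|r| + 1) * n.+1%:R.
have a0 : 0 < a by rewrite mulr_gt0// ltr_wpDl.
have tka : rtest (fun x => k (a *: x)) by exact: rtest_scale a0 tk.
apply: (@eq_measurable_fun _ _ _ _ _ (fun x => h x * (1 + -1 * k (a *: x)))).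
  move=> x; rewrite inE /D/= => xn; rewrite kr ?mulr0 ?addr0 ?mulr1//.
  rewrite normrZ gtr0_norm// /a -mulrA; apply: (@le_trans _ _ ((`|r| + 1) * 1)).
    by rewrite mulr1 (le_trans (ler_norm _))// lerDl.
  by rewrite ler_wpM2l ?addr_ge0// mulrC -ler_pdivrMr// div1r.
apply: (@measurable_funS _ _ _ _ setT) => //.
apply: continuous_measurable_rV => x.
have [->|x0] := eqVneq x 0.
  have ne : {near (0 : E), (fun=> 0) =1 (fun x => h x * (1 + -1 * k (a *: x)))}.
    apply/nbhs_ballP; exists a^-1 => /=; first by rewrite invr_gt0.
    move=> y; rewrite -ball_normE/= sub0r normrN => ya; rewrite k1 ?mulr1 ?subrr ?mulr0//.
    by rewrite normrZ gtr0_norm// mulrC -ltr_pdivlMr// div1r.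
  exact: (near_eq_C1_at ne (C1_at_cst _ _)).1.
have c1 : C1_at x (fun x => 1 + -1 * k (a *: x)).
  exact: C1_atD (C1_at_cst 1 x) (C1_atM (C1_at_cst (-1) x) (smooth_on_C1 tka.1 I)).
exact: (C1_atM (smooth_on_C1 sh x0) c1).1.
Qed.

(** As [f] vanishes near the origin, the product of [g] and [f] is a legitimate test function for
    [w], and the singularity of [g] is never met. *)
Lemma wderiv0_mul g w v i : smooth_on [set x : E | x != 0] g -> locint w -> locint v ->
  wderiv0 i w v -> wderiv0 i (fun x => g x * w x) (fun x => pd i g x * w x + g x * v x).
Proof.
move=> sg lw lv wv f tf.
have t1 := rtest0_mul_smooth sg tf; have t2 := rtest0_mul_smooth (smooth_on_pd i sg) tf.
have t3 := rtest0_mul_smooth sg (rtest0_pd i tf).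
have P x : pd i (fun y => g y * f y) x = pd i g x * f x + g x * pd i f x.
  have [->|x0] := eqVneq x 0; last first.
    by apply: pdM; [exact: smooth_on_C1 sg x0|exact: smooth_on_C1 tf.1.1 I].
  have [e e0 fe] := tf.2.
  have f0 y : `|0 - y| < e -> f y = 0 by rewrite sub0r normrN; exact: fe.
  rewrite (rtest_eq0_near (f := f)); last by exists e.
  rewrite (rtest_eq0_near (f := fun y => g y * f y)); last by exists e => // y /f0 ->; rewrite mulr0.
  by rewrite fe ?normr0// !mulr0 addr0.
have := wv _ t1.
have -> : \int[mu]_x (w x * pd i (fun y => g y * f y) x) =
    \int[mu]_x (w x * (pd i g x * f x)) + \int[mu]_x (w x * (g x * pd i f x)).
  rewrite -RintegralD//; [|exact: locint_mul_rtest lw t2.1|exact: locint_mul_rtest lw t3.1].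
  by apply: eq_Rintegral => x _; rewrite P mulrDr.
have -> : \int[mu]_x ((pd i g x * w x + g x * v x) * f x) =
    \int[mu]_x (w x * (pd i g x * f x)) + \int[mu]_x (v x * (g x * f x)).
  rewrite -RintegralD//; [|exact: locint_mul_rtest lw t2.1|exact: locint_mul_rtest lv t1.1].
  by apply: eq_Rintegral => x _; ring.
rewrite (_ : \int[mu]_x (g x * w x * _) = \int[mu]_x (w x * (g x * pd i f x))); last first.
  by apply: eq_Rintegral => x _; ring.
lra.
Qed.

End real_multipliers.

Section sobolev_multipliers.
Context {R : realType} {N : nat}.
Local Notation E := 'rV[R]_N.
Local Notation mu := (lebesgue_rV N : {sigma_finite_measure set E -> \bar R}).
Implicit Types (x y z : E) (f g h u v w : E -> R) (i j : 'I_N) (e r p alpha : R).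
Implicit Types (ws : 'I_N -> E -> R) (wss : 'I_N -> 'I_N -> E -> R).

Definition W1 p w ws := Lpr p w /\ forall i, Lpr p (ws i) /\ wderiv i w (ws i).
Definition W2 p w ws wss := W1 p w ws /\ forall i, W1 p (ws i) (wss i).

Context (k : E -> R) (p : R) (pk : plateau k) (N1 : (1 < N)%N) (p1 : 1 <= p).
Let N0 : (0 < N)%N := ltnW N1.
Let p0 : 0 < p := lt_le_trans ltr01 p1.

(** Between the radii 1 and 2 the power |x|^e is at most 1 + 2^e whatever the sign of [e], so that
    region is controlled by the unweighted norm. *)
Lemma wint_hw_radius e v : measurable_fun setT v -> Lpr p v ->
  (wint p (hw e 1) v < +oo)%E <-> (wint p (hw e 2) v < +oo)%E.
Proof.
move=> mv Lv; split=> H.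
  pose K := 1 + 2 `^ e; have K0 : 0 <= K by rewrite addr_ge0// powR_ge0.
  have mh r s : measurable_fun setT (hw r s : E -> R) by exact: measurable_hw.
  have hg r s x : 0 <= hw r s x by exact: hw_ge0.
  have mK : measurable_fun setT (fun x => K * hw 0 2 x : R).
    exact: measurable_funM (measurable_cst _) (mh 0 2).
  have K20 x : 0 <= K * hw 0 2 x by rewrite mulr_ge0.
  have HK : (wint p (fun x => K * hw 0 2 x)%R v < +oo)%E.
    rewrite wintZ//; apply: lte_mul_pinfty; [by rewrite lee_fin|by []|].
    exact: wint_hw_Lpr.
  apply: (@le_lt_trans _ _ (wint p (fun x => hw e 1 x + K * hw 0 2 x)%R v)).
    apply: (le_wint (mh e 2) mv (measurable_funD (mh e 1) mK) mv (hg e 2)) => x.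
    rewrite ler_wpM2r ?powR_ge0// -[leRHS]/(hw e 1 x + K * hw 0 2 x).
    rewrite /hw !ball_indicE; have [x1|x1] := ltP `|x| 1.
      have x2 : `|x| < 2 by lra.
      by rewrite x2 !mul1r lerDl mulr_ge0 ?powR_ge0.
    have [x2|_] := ltP `|x| 2; last by rewrite !mul0r mulr0 addr0.
    rewrite mul0r add0r !mul1r powRr0 mulr1 /K.
    have [e0|e0] := leP 0 e.
      apply: (@le_trans _ _ (2 `^ e)); last by rewrite lerDr.
      by rewrite ge0_ler_powR ?nnegrE// ltW.
    apply: (@le_trans _ _ 1); last by rewrite lerDl powR_ge0.
    by rewrite -[leRHS](powRr0 `|x|) ler_powR// ltW.
  rewrite (wintD p (mh e 1) mK mv (hg e 1) K20); exact: lte_add_pinfty.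
apply: le_lt_trans H.
apply: (le_wint (measurable_hw _ _) mv (measurable_hw _ _) mv (hw_ge0 _ _)) => x.
rewrite ler_wpM2r ?powR_ge0// /hw ler_wpM2r ?powR_ge0// !ball_indicE.
by have [x1|x1] := ltP `|x| 1; have [x2|x2] := ltP `|x| 2 => //; lra.
Qed.

(** For alpha <= 1 the exponent is nonnegative and the weight bounded. Otherwise the outside Hardy
    inequality applies with [b = alpha - 1], where the gradient carries the positive exponent
    [(2 - alpha) * p]. *)
Lemma hardy_first w ws alpha : W1 p w ws -> alpha < 2 -> (alpha - 1) * p < N%:R ->
  (wint p (hw ((1 - alpha) * p) 2) w < +oo)%E.
Proof.
move=> [Lw Hw] al2 alN; have [al1|al1] := leP alpha 1.
  by apply: wint_hw_Lpr => //; rewrite mulr_ge0 ?(ltW p0)// subr_ge0.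
apply: (wint_hw_radius ((1 - alpha) * p) Lw.1 Lw).1.
have lw := Lpr_locint p1 Lw; have lws i := Lpr_locint p1 (Hw i).1.
have b0 : 0 <= alpha - 1 by lra.
have := @hardy_subcritical R N k p (alpha - 1) w ws N0 pk p1 b0 alN lw lws
  (fun i => wderiv_wderiv0 (Hw i).2).
rewrite (_ : - ((alpha - 1) * p) = (1 - alpha) * p); last by ring.
apply.
  have := wint_hw_Lpr 2 (lexx 0) Lw; congr (_ < _)%E; apply: eq_integral => x _.
  by rewrite /hw powRr0 mulr1.
move=> i; apply: wint_hw_Lpr (Hw i).1; rewrite mulr_ge0 ?(ltW p0)//; lra.
Qed.

(** With exponent [alpha] the Hardy inequality asks for a weighted norm of the gradient, which
    [hardy_first] obtains from the second derivatives. *)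
Lemma hardy_second w ws wss alpha : W2 p w ws wss -> 0 <= alpha < 2 -> alpha * p < N%:R ->
  (wint p (hw (- (alpha * p)) 1) w < +oo)%E.
Proof.
move=> [[Lw Hw] Hws] /andP[al0 al2] alN.
have lw := Lpr_locint p1 Lw; have lws i := Lpr_locint p1 (Hw i).1.
apply: (@hardy_subcritical R N k p alpha w ws N0 pk p1 al0 alN lw lws
  (fun i => wderiv_wderiv0 (Hw i).2)).
  have := wint_hw_Lpr 2 (lexx 0) Lw; congr (_ < _)%E; apply: eq_integral => x _.
  by rewrite /hw powRr0 mulr1.
move=> i; apply: hardy_first (Hws i) al2 _.
by apply: le_lt_trans alN; rewrite mulrBl gerBl mul1r ltW.
Qed.

(** The inside Hardy inequality needs the strict N < bp, so [b] is chosen above [alpha] but still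
    within the range of [hardy_first]; near the origin the larger exponent dominates. It is applied
    to the continuous representative, which has the same weak derivatives. *)
Lemma hardy_second_vanishing w w0 ws wss alpha : W2 p w ws wss -> 0 <= alpha < 2 ->
  N%:R <= alpha * p -> (alpha - 1) * p < N%:R -> continuous w0 -> w0 0 = 0 ->
  {ae mu, forall x, w x = w0 x} -> (wint p (hw (- (alpha * p)) 1) w < +oo)%E.
Proof.
move=> [[Lw Hw] Hws] /andP[al0 al2] Nal alN cw0 w00 ww0.
have lw := Lpr_locint p1 Lw; have lws i := Lpr_locint p1 (Hw i).1.
have [b [ab b2 bN]] : exists b : R, [/\ alpha < b, b < 2 & (b - 1) * p < N%:R].
  pose t := Num.min 2 (N%:R / p + 1).
  have at_ : alpha < t.
    by rewrite lt_min al2/= -ltrBlDr ltr_pdivlMr.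
  have t2 : t <= 2 by rewrite ge_min lexx.
  have tN : t <= N%:R / p + 1 by rewrite ge_min lexx orbT.
  exists ((alpha + t) / 2); split; [lra|lra|].
  rewrite -ltr_pdivlMr//; lra.
have mw0 := continuous_measurable_rV cw0; have mw := Lw.1.
have lw0 := continuous_locint pk cw0.
have ww00 i : wderiv0 i w0 (ws i).
  move=> f tf; rewrite -(wderiv_wderiv0 (Hw i).2 tf) /Rintegral; congr fine.
  have mf := continuous_measurable_rV (rtest_continuous (rtest_pd i tf.1)).
  apply: ae_eq_integral => //.
  - by apply/measurable_EFinP; exact: measurable_funM.
  - by apply/measurable_EFinP; exact: measurable_funM.
  - by apply: filterS ww0 => x -> _.
have NbP : N%:R < b * p by apply: (le_lt_trans Nal); rewrite ltr_pM2r.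
have H := @hardy_supercritical R N k p b w0 ws N0 pk p1 NbP lw0 lws ww00 (cw0 0) w00
  (fun i => hardy_first (Hws i) b2 bN).
have mh e := measurable_hw (R := R) (N := N) e 1.
have mp v e : measurable_fun setT v -> measurable_fun setT (fun x => (hw e 1 x * `|v x| `^ p)%:E).
  by move=> mv; exact: measurable_wint.
have pp v e x : [set: E] x -> (0 <= (hw e 1 x * `|v x| `^ p)%:E)%E.
  by move=> _; rewrite lee_fin mulr_ge0 ?hw_ge0 ?powR_ge0.
apply: le_lt_trans H.
apply: (ae_ge0_le_integral measurableT (pp w _) (mp _ _ mw) (pp w0 _) (mp _ _ mw0)).
apply: filterS2 ww0 (@ae_neq0 R N N0) => x -> x0 _.
rewrite lee_fin ler_wpM2r ?powR_ge0// /hw ball_indicE.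
have [x1|_] := ltP `|x| 1; last by rewrite !mul0r.
rewrite !mul1r; apply: powR_antimono; first by rewrite normr_gt0 x0 ltW.
by rewrite lerN2 ler_pM2r// ltW.
Qed.

(** The term with [pd i g] is the one that requires |x|^(1 - alpha) w to be p-integrable near 0. The
    product rule holds first against functions vanishing near 0, and [wderiv0_wderiv] lifts that
    restriction. *)
Lemma multiplier_W1 g w ws alpha : singular_multiplier alpha g -> alpha < 2 ->
  (alpha - 1) * p < N%:R -> W1 p w ws ->
  W1 p (fun x => g x * w x) (fun i x => pd i g x * w x + g x * ws i x).
Proof.
move=> [sg [C C0 HC]] al2 alN Hw1; have [Lw Hw] := Hw1.
have hw1 : (wint p (hw ((1 - alpha) * p) 1) w < +oo)%E.
  by apply/(wint_hw_radius _ Lw.1 Lw); exact: hardy_first Hw1 al2 alN.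
have mg := smooth_off0_measurable pk sg.
have mgi i := smooth_off0_measurable pk (smooth_on_pd i sg).
have gB v : Lpr p v -> Lpr p (fun x => g x * v x).
  move=> Lv; apply: (Lpr_mul_hw (C := C) (e := 0) N0 p1 C0 mg _ Lv).
    move=> x x0; have [H _ _] := HC x x0; apply: (le_trans H).
    by rewrite ler_peMr// lerDl hw_ge0.
  by rewrite mul0r; exact: wint_hw_Lpr.
have L1 := gB _ Lw.
have L2 i : Lpr p (fun x => pd i g x * w x + g x * ws i x).
  apply: (LprD p1); last exact: gB (Hw i).1.
  apply: (Lpr_mul_hw (C := C) (e := 1 - alpha) N0 p1 C0 (mgi i) _ Lw hw1).
  by move=> x x0; have [_ H _] := HC x x0.
split; [exact: L1|move=> i; split; first exact: L2].
have lw := Lpr_locint p1 Lw.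
apply: (@wderiv0_wderiv R N k _ (fun i x => pd i g x * w x + g x * ws i x) i N1 pk).
- exact: Lpr_locint p1 L1.
- by move=> j; exact: Lpr_locint p1 (L2 j).
- by move=> j; apply: wderiv0_mul => //; [exact: Lpr_locint p1 (Hw j).1|exact: wderiv_wderiv0 (Hw j).2].
Qed.

(** [multiplier_W1] handles [g x * ws i x] but not [pd i g x * w x], whose factor is more singular.
    The latter is differentiated by [wderiv0_mul] only, and the origin is removed for the sum of
    both. *)
Lemma multiplier_W2 g w ws wss alpha : singular_multiplier alpha g -> alpha < 2 ->
  (alpha - 1) * p < N%:R -> W2 p w ws wss -> (wint p (hw (- (alpha * p)) 1) w < +oo)%E ->
  W2 p (fun x => g x * w x) (fun i x => pd i g x * w x + g x * ws i x)
    (fun i j x => (pd j (pd i g) x * w x + pd i g x * ws j x) +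
                  (pd j g x * ws i x + g x * wss i j x)).
Proof.
move=> smg al2 alN [Hw1 Hw2] hwa; have H1 := multiplier_W1 smg al2 alN Hw1.
have Hg i := multiplier_W1 smg al2 alN (Hw2 i).
have [sg [C C0 HC]] := smg; have [Lw Hw] := Hw1.
have h1 i : (wint p (hw ((1 - alpha) * p) 1) (ws i) < +oo)%E.
  by apply/(wint_hw_radius _ (Hw i).1.1 (Hw i).1); exact: hardy_first (Hw2 i) al2 alN.
have mgi i := smooth_off0_measurable pk (smooth_on_pd i sg).
have mgij i j := smooth_off0_measurable pk (smooth_on_pd j (smooth_on_pd i sg)).
have L1 i j : Lpr p (fun x => pd j (pd i g) x * w x).
  apply: (Lpr_mul_hw (C := C) (e := - alpha) N0 p1 C0 (mgij i j) _ Lw).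
    by move=> x x0; have [_ _ H] := HC x x0.
  by rewrite mulNr.
have L2 i j : Lpr p (fun x => pd i g x * ws j x).
  apply: (Lpr_mul_hw (C := C) (e := 1 - alpha) N0 p1 C0 (mgi i) _ (Hw j).1 (h1 j)).
  by move=> x x0; have [_ H _] := HC x x0.
have L12 i j := LprD p1 (L1 i j) (L2 i j).
have L34 i j : Lpr p (fun x => pd j g x * ws i x + g x * wss i j x) by exact: ((Hg i).2 j).1.
have LL i j := LprD p1 (L12 i j) (L34 i j).
split; [exact: H1|move=> i; split; first exact: (H1.2 i).1].
move=> j; split; first exact: LL.
apply: (@wderiv0_wderiv R N k _ (fun j x => (pd j (pd i g) x * w x + pd i g x * ws j x) +
                  (pd j g x * ws i x + g x * wss i j x)) j N1 pk).
- exact: Lpr_locint p1 (H1.2 i).1.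
- by move=> l; exact: Lpr_locint p1 (LL i l).
move=> l f tf.
have lw := Lpr_locint p1 Lw; have lws j' := Lpr_locint p1 (Hw j').1.
have D1 := wderiv0_mul (smooth_on_pd i sg) lw (lws l) (wderiv_wderiv0 (Hw l).2) tf.
have D2 := wderiv_wderiv0 ((Hg i).2 l).2 tf.
have t1 := rtest_pd l tf.1.
have l1 : locint (fun x => pd i g x * w x).
  apply: (Lpr_locint p1); apply: (Lpr_mul_hw (C := C) (e := 1 - alpha) N0 p1 C0 (mgi i) _ Lw).
    by move=> x x0; have [_ H _] := HC x x0.
  by apply/(wint_hw_radius _ Lw.1 Lw); exact: hardy_first Hw1 al2 alN.
have l2 := Lpr_locint p1 (Hg i).1.
have l12 := Lpr_locint p1 (L12 i l); have l34 := Lpr_locint p1 (L34 i l).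
rewrite (_ : \int[mu]_x _ = \int[mu]_x (pd i g x * w x * pd l f x) +
    \int[mu]_x (g x * ws i x * pd l f x)); last first.
  rewrite -RintegralD//; [|exact: locint_mul_rtest l1 t1|exact: locint_mul_rtest l2 t1].
  by apply: eq_Rintegral => x _; rewrite mulrDl.
rewrite D1 D2 -opprD; congr (- _).
rewrite -RintegralD//; [|exact: locint_mul_rtest l12 tf.1|exact: locint_mul_rtest l34 tf.1].
by apply: eq_Rintegral => x _; rewrite [RHS]mulrDl.
Qed.

End sobolev_multipliers.

(** * Test functions as Sobolev functions, and sums of Sobolev functions *)

Section sobolev_vector_space.
Context {R : realType} {N : nat}.
Local Notation E := 'rV[R]_N.
Local Notation mu := (lebesgue_rV N : {sigma_finite_measure set E -> \bar R}).
Implicit Types (x y z : E) (f g h u v w : E -> R) (i j : 'I_N) (e r p a b : R).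
Implicit Types (us vs : 'I_N -> E -> R) (uss vss : 'I_N -> 'I_N -> E -> R).

(** By translation invariance a difference quotient of [f] has integral 0; by the mean value theorem
    and the Lipschitz bound on the derivative, it differs from [pd i f] by O(1/n) on one fixed ball
    and not at all outside. *)
Lemma Rintegral_pd_eq0 f i : rtest f -> \int[mu]_x pd i f x = 0.
Proof.
move=> tf; have tdf := rtest_pd i tf; have [L L0 dL] := rtest_lipschitz tdf.
have [r fr] := tf.2; have [q dq] := tdf.2.
pose r' := Num.max r q + 1; pose B : E -> R := \1_[set y : E | `|y| < r'].
pose e := (delta_mx ord0 i : E); have e1 : `|e| <= 1 by exact: norm_delta_mx.
have l1 : locint (fun _ : E => 1 : R).
  by apply: (@locint_bounded _ _ _ 1) => [|x]; [exact: measurable_cst|rewrite normr1].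
have iB : mu.-integrable setT (EFin \o B).
  have := locint_ball_integrable r' l1; congr (integrable _ _ _).
  by apply/funext => x /=; rewrite mul1r.
have if_ := rtest_integrable tf; have idf := rtest_integrable tdf.
have key n : `|\int[mu]_x pd i f x| <= L * \int[mu]_x B x * n.+1%:R^-1.
  pose t : R := n.+1%:R^-1; have t0 : 0 < t by rewrite invr_gt0.
  have t1 : t <= 1 by rewrite invf_le1// ler1n.
  have ish : mu.-integrable setT (EFin \o (fun x => f (1 *: x + t *: e))).
    exact: integrable_affine ltr01 if_.
  have idif := integrableB measurableT ish if_.
  have I0 : \int[mu]_x (f (1 *: x + t *: e) - f x) = 0.
    by rewrite RintegralB// [X in _ - X](Rintegral_affine (t *: e) ltr01 if_) expr1n mul1r subrr.
  have -> : \int[mu]_x pd i f x =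
      \int[mu]_x (pd i f x - n.+1%:R * (f (1 *: x + t *: e) - f x)).
    rewrite RintegralB//; last exact: (integrableZl _ n.+1%:R idif).
    by rewrite RintegralZl// I0 mulr0 subr0.
  rewrite mulrAC -RintegralZl//; apply: Rintegral_norm_le.
  - exact: (integrableB _ idf (integrableZl _ n.+1%:R idif)).
  - exact: (integrableZl _ (L * t) iB).
  move=> x; rewrite scale1r.
  have sB (s : R) : `|s| <= `|t| -> `|s *: e| <= t.
    move=> st; rewrite normrZ -[leRHS]mulr1 -[t in leRHS]gtr0_norm//.
    exact: ler_pM.
  have [s st ->] := smooth_mvt x i t tf.1.
  rewrite mulrA mulfV ?gt_eqF// mul1r.
  rewrite /B ball_indicE; have [xr|rx] := ltP `|x| r'.
    rewrite mulr1 distrC (le_trans (dL _ _))// ler_wpM2l//.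
    exact: sB st.
  have rq : q <= Num.max r q by rewrite le_max lexx orbT.
  have se : `|s *: e| <= 1 by exact: le_trans (sB s st) t1.
  have := lerB_dist x (- (s *: e)); rewrite normrN opprK => H.
  by rewrite !dq ?subrr ?normr0 ?mulr0//; rewrite /r' in rx; lra.
apply/eqP; rewrite -normr_le0.
have cv : (fun n => L * \int[mu]_x B x * n.+1%:R^-1) @ \oo --> (L * \int[mu]_x B x * 0 : R).
  by apply: cvgMr; exact: cvg_harmonic.
rewrite mulr0 in cv.
rewrite -(cvg_lim (@Rhausdorff R) cv); apply: limr_ge; first by apply/cvg_ex; exists 0.
exact: nearW.
Qed.

Lemma rtest_wderiv f i : rtest f -> wderiv i f (pd i f).
Proof.
move=> tf g tg; have tfg := rtestM tf.1 tg.
have := Rintegral_pd_eq0 i tfg.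
under eq_Rintegral do rewrite (pdM i (smooth_on_C1 tf.1 I) (smooth_on_C1 tg.1 I)).
rewrite RintegralD//.
- by move/eqP; rewrite addrC addr_eq0 => /eqP.
- exact: rtest_integrable (rtestM (rtest_pd i tf).1 tg).
- exact: rtest_integrable (rtestM tf.1 (rtest_pd i tg)).
Qed.

Lemma rtest_Lpr p f : 1 <= p -> rtest f -> Lpr p f.
Proof.
move=> p1 tf; have p0 : 0 < p by apply: lt_le_trans p1.
have mf := continuous_measurable_rV (rtest_continuous tf).
split; first exact: mf.
have [C C0 fC] := rtest_bounded tf.
pose D := (C + 1) `^ (p - 1).
have : mu.-integrable setT (EFin \o (fun x => `|f x| `^ p)).
  apply: (@integrable_le _ _ _ (fun x => D * f x)).
  - exact: measurable_powR_norm.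
  - exact: (integrableZl _ D (rtest_integrable tf)).
  move=> x; rewrite normrM [leLHS]ger0_norm ?powR_ge0// [X in _ <= X * _]ger0_norm ?powR_ge0//.
  have [->|f0] := eqVneq (f x) 0; first by rewrite normr0 powR0 ?mulr0// gt_eqF.
  have nf : 0 < `|f x| by rewrite normr_gt0.
  rewrite -[leLHS](_ : `|f x| `^ (p - 1) * `|f x| = _).
    rewrite ler_wpM2r// ge0_ler_powR ?nnegrE ?subr_ge0 ?addr_ge0//.
    by rewrite (le_trans (fC x))// lerDl.
  rewrite -[X in _ * X](powRr1 (ltW nf)) -powRD ?(gt_eqF nf) ?implybT//.
  by rewrite subrK.
move=> /integrableP[_]; congr (_ < _)%E; apply: eq_integral => x _ /=.
by rewrite ger0_norm// powR_ge0.
Qed.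

Lemma rtest_W2 p f : 1 <= p -> rtest f -> W2 p f (fun i => pd i f) (fun i j => pd j (pd i f)).
Proof.
move=> p1 tf.
have H g : rtest g -> W1 p g (fun i => pd i g).
  move=> tg; split; first exact: rtest_Lpr.
  by move=> i; split; [apply: rtest_Lpr p1 _; exact: rtest_pd|exact: rtest_wderiv].
split; first exact: H.
by move=> i; apply: H; exact: rtest_pd.
Qed.

Lemma wderivD i u u' v v' : locint u -> locint u' -> locint v -> locint v' ->
  wderiv i u v -> wderiv i u' v' -> wderiv i (fun x => u x + u' x) (fun x => v x + v' x).
Proof.
move=> lu lu' lv lv' uv uv' f tf; have tdf := rtest_pd i tf.
have E1 h h' g : locint h -> locint h' -> rtest g ->
    \int[mu]_x ((h x + h' x) * g x) = \int[mu]_x (h x * g x) + \int[mu]_x (h' x * g x).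
  move=> lh lh' tg; rewrite -RintegralD//; [|exact: locint_mul_rtest lh tg|exact: locint_mul_rtest lh' tg].
  by apply: eq_Rintegral => x _; rewrite mulrDl.
by rewrite !E1// uv// uv'// opprD.
Qed.

Lemma W1D p u u' us us' : 1 <= p -> W1 p u us -> W1 p u' us' ->
  W1 p (fun x => u x + u' x) (fun i x => us i x + us' i x).
Proof.
move=> p1 [Lu Hu] [Lu' Hu']; split; first exact: LprD.
move=> i; have [Lui Di] := Hu i; have [Lui' Di'] := Hu' i; split; first exact: LprD.
by apply: wderivD Di Di'; exact: (@Lpr_locint _ _ p).
Qed.

Lemma W2D p u u' us us' uss uss' : 1 <= p -> W2 p u us uss -> W2 p u' us' uss' ->
  W2 p (fun x => u x + u' x) (fun i x => us i x + us' i x) (fun i j x => uss i j x + uss' i j x).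
Proof. by move=> p1 [H1 H2] [H1' H2']; split=> [|i]; apply: W1D. Qed.

End sobolev_vector_space.

(** * Complex-valued functions *)

Section complex_sobolev.
Local Open Scope complex_scope.
Context {R : realType} {N : nat}.
Local Notation E := 'rV[R]_N.
Local Notation mu := (lebesgue_rV N : {sigma_finite_measure set E -> \bar R}).
Implicit Types (x y z : E) (f u v w : E -> R[i]) (g h : E -> R) (i j : 'I_N) (p : R).
Implicit Types (Omega : set E) (s : seq 'I_N).
Local Notation re u := (fun x => complex.Re (u x)).
Local Notation im u := (fun x => complex.Im (u x)).

Lemma normc_bounds (c : R[i]) : [/\ `|complex.Re c| <= Normc.normc c,
  `|complex.Im c| <= Normc.normc c & Normc.normc c <= `|complex.Re c| + `|complex.Im c|].
Proof.
case: c => a b /=; have a2 := sqr_ge0 a; have b2 := sqr_ge0 b.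
have ab0 : 0 <= a ^+ 2 + b ^+ 2 by rewrite addr_ge0.
split.
- by rewrite -sqrtr_sqr ler_sqrt// lerDl.
- by rewrite -sqrtr_sqr ler_sqrt// lerDr.
rewrite -[leRHS]ger0_norm ?addr_ge0// -sqrtr_sqr ler_sqrt ?sqr_ge0//.
rewrite sqrrD !real_normK ?num_real// addrAC lerDl.
by rewrite mulrn_wge0// mulr_ge0.
Qed.

Lemma measurable_normc Omega u : measurable_fun Omega (re u) -> measurable_fun Omega (im u) ->
  measurable_fun Omega (fun x => Normc.normc (u x)).
Proof.
move=> mr mi; rewrite (_ : (fun x => _) =
    (fun x => (complex.Re (u x) ^+ 2 + complex.Im (u x) ^+ 2) `^ 2^-1)); last first.
  apply/funext => x; rewrite powR12_sqrt ?addr_ge0 ?sqr_ge0//.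
  by case: (u x).
apply: (measurableT_comp (f := fun t : R => t `^ 2^-1)); first exact: measurable_powR.
by apply: measurable_funD; exact: measurable_funX.
Qed.

Lemma Lp_setTP p u : 1 <= p -> Lp p setT u <-> Lpr p (re u) /\ Lpr p (im u).
Proof.
move=> p1; have p0 : 0 <= p by apply: le_trans p1.
have mp (v : E -> R) : measurable_fun setT v -> measurable_fun setT (fun x => (`|v x| `^ p)%:E : \bar R).
  by move=> mv; apply/measurable_EFinP; exact: measurable_powR_norm.
have pp (v : E -> R) x : [set: E] x -> (0 <= (v x `^ p)%:E)%E by rewrite lee_fin powR_ge0.
have mn : measurable_fun setT (re u) -> measurable_fun setT (im u) ->
    measurable_fun setT (fun x => (Normc.normc (u x) `^ p)%:E : \bar R).
  move=> mr mi; apply/measurable_EFinP; apply: (measurableT_comp (f := fun t : R => t `^ p)).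
    exact: measurable_powR.
  exact: measurable_normc.
split=> [[mr [mi H]]|[[mr Hr] [mi Hi]]].
  have le h : measurable_fun setT h -> (forall x, `|h x| <= Normc.normc (u x)) -> Lpr p h.
    move=> mh hu; split; first exact: mh.
    apply: le_lt_trans H.
    apply: (ge0_le_integral _ measurableT (pp _) (mp _ mh) (mn mr mi)) => x _.
    by rewrite lee_fin ge0_ler_powR ?nnegrE// (le_trans _ (hu x)).
  by split; [apply: (le _ mr)|apply: (le _ mi)] => x; have [] := normc_bounds (u x).
split; first exact: mr; split; first exact: mi.
have Lr : Lpr p (re u) by split. have Li : Lpr p (im u) by split.
have La (v : E -> R) : Lpr p v -> Lpr p (fun x => `|v x|).
  move=> [mv Hv]; split; first by apply: measurableT_comp => //; exact: mv.
  by under eq_integral do rewrite normr_id.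
have [ms Hs] := LprD p1 (La _ Lr) (La _ Li).
apply: le_lt_trans Hs.
apply: (ge0_le_integral _ measurableT (pp _) (mn mr mi) (mp _ ms)) => x _.
have [h1 _ h3] := normc_bounds (u x).
rewrite lee_fin ge0_ler_powR ?nnegrE//; first exact: le_trans h1.
by rewrite ger0_norm// addr_ge0.
Qed.

Lemma Lp_restrict p Omega u : measurable Omega -> Lp p setT u -> Lp p Omega u.
Proof.
move=> mO [mr [mi H]].
split; first exact: (measurable_funS measurableT (@subsetT _ _) mr).
split; first exact: (measurable_funS measurableT (@subsetT _ _) mi).
apply: le_lt_trans H; apply: (ge0_subset_integral _ mO measurableT).
- apply/measurable_EFinP; apply: (measurableT_comp (f := fun t : R => t `^ p)).
    exact: measurable_powR.
  exact: measurable_normc.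
- by move=> x _; rewrite lee_fin powR_ge0.
- exact: subsetT.
Qed.

Lemma dpart_cst0 s : dpart s (fun _ : E => 0 : R) = (fun=> 0).
Proof.
elim: s => [//|i s IH] /=; apply/funext => x.
by rewrite IH; exact: pd_cst.
Qed.

Lemma eq_dpart (O : set E) g h s : open O -> (forall x, O x -> g x = h x) ->
  forall x, O x -> dpart s g x = dpart s h x.
Proof.
move=> oO gh; elim: s => [|i s IH] //= x Ox.
exact: (near_eq_pd i (eq_on_near oO IH Ox)).
Qed.

Lemma dpart_notin_csupport f s x : ~ csupport f x ->
  dpart s (re f) x = 0 /\ dpart s (im f) x = 0.
Proof.
move=> nx; have oO : open (~` csupport f) by exact: closed_openC (@closed_closure _ _).
have f0 y : (~` csupport f) y -> f y = 0.
  by move=> ny; apply/eqP; apply: contrapT => /negP fy; apply: ny; exact: subset_closure.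
split.
  rewrite (@eq_dpart _ (re f) (fun=> 0) s oO) ?dpart_cst0// => y /f0 ->; by [].
rewrite (@eq_dpart _ (im f) (fun=> 0) s oO) ?dpart_cst0// => y /f0 ->; by [].
Qed.

Lemma test_fun_rtest Omega f : test_fun Omega f -> rtest (re f) /\ rtest (im f).
Proof.
move=> [[sr si] [cf _]].
have [M [Mr HM]] := compact_bounded cf.
have f0 x : `|M| + 2 <= `|x| -> f x = 0.
  move=> Mx; apply/eqP; apply: contrapT => /negP fx.
  have := HM (`|M| + 1); have M1 : M < `|M| + 1 by rewrite (le_lt_trans (ler_norm _))// ltrDl.
  have cx : csupport f x by exact: (@subset_closure _ [set y | f y != 0] x fx).
  by move=> /(_ M1 x cx); rewrite /= => H; lra.
by split; [split; [exact: sr|]|split; [exact: si|]]; exists (`|M| + 2) => x /f0 ->.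
Qed.

Lemma test_funS Omega Omega' f : Omega `<=` Omega' -> test_fun Omega f -> test_fun Omega' f.
Proof. by move=> OO [sf [cf fO]]; split=> //; split=> //; exact: subset_trans OO. Qed.

Lemma rtest_test_fun g : rtest g -> test_fun setT (fun x => (g x)%:C).
Proof.
move=> [sg [r gr]]; split; last split=> //.
  split; first by rewrite (_ : _ \o _ = g).
  by rewrite (_ : _ \o _ = (fun=> 0)); [exact: smooth_on_cst|].
apply: bounded_closed_compact; last exact: closed_closure.
have H x : csupport (fun x => (g x)%:C) x -> `|x| <= r.
  move=> cx; rewrite leNgt; apply/negP => rx.
  have : nbhs x (ball x (`|x| - r)) by apply: nbhsx_ballx; rewrite subr_gt0.
  move=> /cx[y [/= gy]]; rewrite -ball_normE/= => xy.
  have := lerB_dist x y => H.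
  by move: gy; rewrite gr ?eqxx//; lra.
exists r; split; first exact: num_real.
by move=> t rt x /H xr; exact: le_trans (ltW rt).
Qed.

Lemma cintegral_restrict Omega u : (forall x, ~ Omega x -> u x = 0) ->
  cintegral Omega u = cintegral setT u.
Proof.
move=> u0; rewrite /cintegral; congr (_ +i* _); rewrite Rintegral_mkcond.
  apply: eq_Rintegral => x _; rewrite patchE; case: ifPn => // /negP xO.
  by rewrite u0// => Ox; apply: xO; rewrite inE.
apply: eq_Rintegral => x _; rewrite patchE; case: ifPn => // /negP xO.
by rewrite u0// => Ox; apply: xO; rewrite inE.
Qed.

(** Derivatives of a test function vanish off its support, so integrals over [Omega] and over the
    whole space agree. This makes restriction of Sobolev functions immediate. *)
Lemma test_mul_restrict Omega f u s : test_fun Omega f ->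
  cintegral Omega (fun x => u x * cdpart s f x) = cintegral setT (fun x => u x * cdpart s f x).
Proof.
move=> [_ [_ fO]]; apply: cintegral_restrict => x nO.
have nx : ~ csupport f x by move=> /fO.
by rewrite /cdpart; have [-> ->] := dpart_notin_csupport s nx; rewrite mulr0.
Qed.

Lemma cdpart_nil f : cdpart [::] f = f.
Proof. by apply/funext => x; rewrite /cdpart/=; case: (f x). Qed.

Lemma test_mul_restrict0 Omega f u : test_fun Omega f ->
  cintegral Omega (fun x => u x * f x) = cintegral setT (fun x => u x * f x).
Proof. by move=> tf; have := test_mul_restrict u [::] tf; rewrite cdpart_nil. Qed.

Lemma weak_deriv_restrict Omega s u v : weak_deriv setT s u v -> weak_deriv Omega s u v.
Proof.
move=> uv f tf; rewrite test_mul_restrict// test_mul_restrict0//.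
by apply: uv; exact: test_funS tf.
Qed.

Lemma sobolev_restrict k p Omega u : measurable Omega -> sobolev k p setT u -> sobolev k p Omega u.
Proof.
move=> mO [Lu Hu]; split; first exact: Lp_restrict.
move=> s sk; have [v Lv uv] := Hu s sk; exists v; first exact: Lp_restrict.
exact: weak_deriv_restrict.
Qed.

Lemma eq_Rintegral_on Omega g h : (forall x, Omega x -> g x = h x) ->
  \int[mu]_(x in Omega) g x = \int[mu]_(x in Omega) h x.
Proof. by move=> gh; apply: eq_Rintegral => x; rewrite inE; exact: gh. Qed.

Lemma eq_sobolev k p Omega u u' : (forall x, Omega x -> u x = u' x) ->
  sobolev k p Omega u -> sobolev k p Omega u'.
Proof.
move=> uu' [[mr [mi H]] Hu]; split.
  split; first by apply: eq_measurable_fun mr => x; rewrite inE /= => /uu' ->.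
  split; first by apply: eq_measurable_fun mi => x; rewrite inE /= => /uu' ->.
  have <- : (\int[mu]_(x in Omega) (Normc.normc (u x) `^ p)%:E =
      \int[mu]_(x in Omega) (Normc.normc (u' x) `^ p)%:E)%E; last exact: H.
  by apply: eq_integral => x; rewrite inE => Ox; rewrite uu'.
move=> s sk; have [v Lv uv] := Hu s sk; exists v => // f tf.
rewrite -uv// /cintegral; congr (_ +i* _); apply: eq_Rintegral_on => x Ox; by rewrite uu'.
Qed.

(** Real-valued test functions are enough to separate real and imaginary parts. *)
Lemma weak_deriv_elim s u v : weak_deriv setT s u v -> forall g, rtest g ->
  \int[mu]_x (complex.Re (u x) * dpart s g x) =
    (-1) ^+ size s * \int[mu]_x (complex.Re (v x) * g x) /\
  \int[mu]_x (complex.Im (u x) * dpart s g x) =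
    (-1) ^+ size s * \int[mu]_x (complex.Im (v x) * g x).
Proof.
move=> uv g tg; have := uv _ (rtest_test_fun tg).
have cd x : cdpart s (fun y => (g y)%:C) x = (dpart s g x)%:C.
  rewrite /cdpart (_ : complex.Re (R:=R) \o _ = g)// (_ : complex.Im (R:=R) \o _ = (fun=> 0))//.
  by rewrite dpart_cst0.
have mC (c : R[i]) (a : R) : c * a%:C = (complex.Re c * a) +i* (complex.Im c * a).
  by case: c => b d; apply/eqP; rewrite eq_complex/= !mulr0 subr0 add0r !eqxx.
rewrite /cintegral.
under eq_Rintegral do rewrite cd mC/=.
rewrite [X in _ +i* X](_ : _ = \int[mu]_x (complex.Im (u x) * dpart s g x)); last first.
  by apply: eq_Rintegral => x _; rewrite cd mC.
rewrite [X in _ = _ * (X +i* _)](_ : _ = \int[mu]_x (complex.Re (v x) * g x)); last first.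
  by apply: eq_Rintegral => x _; rewrite mC.
rewrite [X in _ = _ * (_ +i* X)](_ : _ = \int[mu]_x (complex.Im (v x) * g x)); last first.
  by apply: eq_Rintegral => x _; rewrite mC.
(* The sign lives in [R[i]] on one side and in [R] on the other; splitting by parity makes it 1 or
   -1 in both and the components can be compared. *)
rewrite -signr_odd -[in X in _ -> X]signr_odd; case: (odd _).
  by rewrite !expr1 !mulN1r => /eqP; rewrite eq_complex/= => /andP[/eqP-> /eqP->].
by rewrite !expr0 !mul1r => -[-> ->].
Qed.

(** A product with a complex test function splits into four real integrals; local integrability
    allows them to be taken apart. *)
Lemma weak_deriv_intro s u v : locint (re u) -> locint (im u) -> locint (re v) ->
  locint (im v) ->
  (forall g, rtest g -> \int[mu]_x (complex.Re (u x) * dpart s g x) =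
    (-1) ^+ size s * \int[mu]_x (complex.Re (v x) * g x) /\
  \int[mu]_x (complex.Im (u x) * dpart s g x) =
    (-1) ^+ size s * \int[mu]_x (complex.Im (v x) * g x)) ->
  weak_deriv setT s u v.
Proof.
move=> lru liu lrv liv H f tf; have [tr ti] := test_fun_rtest tf.
have td g : rtest g -> rtest (dpart s g).
  by elim: s {H} => [//|i s IH] tg /=; exact: (rtest_pd i (IH tg)).
have K (a b : E -> R) g h : locint a -> locint b -> rtest g -> rtest h ->
    \int[mu]_x (a x * g x - b x * h x) = \int[mu]_x (a x * g x) - \int[mu]_x (b x * h x) /\
    \int[mu]_x (a x * h x + b x * g x) = \int[mu]_x (a x * h x) + \int[mu]_x (b x * g x).
  move=> la lb tg th; split.
    by rewrite RintegralB//; [exact: locint_mul_rtest la tg|exact: locint_mul_rtest lb th].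
  by rewrite RintegralD//; [exact: locint_mul_rtest la th|exact: locint_mul_rtest lb tg].
have mC (c d : R[i]) : c * d = (complex.Re c * complex.Re d - complex.Im c * complex.Im d) +i*
    (complex.Re c * complex.Im d + complex.Im c * complex.Re d).
  by case: c => ? ?; case: d.
have CI (w : E -> R[i]) (q : E -> R[i]) : locint (re w) -> locint (im w) ->
    rtest (re q) -> rtest (im q) -> cintegral setT (fun x => w x * q x) =
    (\int[mu]_x (complex.Re (w x) * complex.Re (q x)) -
     \int[mu]_x (complex.Im (w x) * complex.Im (q x))) +i*
    (\int[mu]_x (complex.Re (w x) * complex.Im (q x)) +
     \int[mu]_x (complex.Im (w x) * complex.Re (q x))).
  move=> lr li qr qi; have [E1 E2] := K _ _ _ _ lr li qr qi.
  rewrite /cintegral -E1 -E2; congr (_ +i* _); apply: eq_Rintegral => x _; by rewrite mC.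
rewrite !CI//; last 2 first.
- exact: td.
- exact: td.
rewrite /cdpart/= (H _ tr).1 (H _ tr).2 (H _ ti).1 (H _ ti).2.
rewrite -signr_odd -[in X in _ = X]signr_odd; case: (odd _).
  by rewrite !expr1 !mulN1r; apply/eqP; rewrite eq_complex/= !opprB !opprD !opprK addrC !eqxx.
by rewrite !expr0 !mul1r.
Qed.

End complex_sobolev.

Section sobolev_real_parts.
Local Open Scope complex_scope.
Context {R : realType} {N : nat}.
Local Notation E := 'rV[R]_N.
Local Notation mu := (lebesgue_rV N : {sigma_finite_measure set E -> \bar R}).
Implicit Types (x y z : E) (u v w : E -> R[i]) (f g h k phi : E -> R) (i j : 'I_N) (p alpha : R).
Implicit Types (ws : 'I_N -> E -> R) (wss : 'I_N -> 'I_N -> E -> R).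
Local Notation re u := (fun x => complex.Re (u x)).
Local Notation im u := (fun x => complex.Im (u x)).

Lemma W1_sobolev p u ws ws' : 1 <= p -> W1 p (re u) ws -> W1 p (im u) ws' ->
  sobolev 1 p setT u.
Proof.
move=> p1 [Lr Hr] [Li Hi].
have lL h : Lpr p h -> locint h by exact: Lpr_locint.
split; first by apply/(Lp_setTP _ p1).
case=> [_|i [_|//]].
  exists u; first by apply/(Lp_setTP _ p1).
  apply: weak_deriv_intro; [exact: lL|exact: lL|exact: lL|exact: lL|].
  by move=> g tg; rewrite /= expr0 !mul1r.
exists (fun x => ws i x +i* ws' i x).
  by apply/(Lp_setTP _ p1); split; [exact: (Hr i).1|exact: (Hi i).1].
apply: weak_deriv_intro; [exact: lL|exact: lL|exact: lL (Hr i).1|exact: lL (Hi i).1|].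
by move=> g tg; rewrite /= expr1 !mulN1r; split; [exact: (Hr i).2|exact: (Hi i).2].
Qed.

(** In [dpart [:: i; j]] the derivative [j] acts first on the test function; with this order the
    weak derivative for [[:: i; j]] is the [j]-th derivative of the [i]-th one, without appeal to
    the symmetry of second derivatives. *)
Lemma sobolev2P p u : 1 <= p -> sobolev 2 p setT u <->
  (exists ws wss, W2 p (re u) ws wss) /\ (exists ws wss, W2 p (im u) ws wss).
Proof.
move=> p1; have lL h : Lpr p h -> locint h by exact: Lpr_locint.
split=> [[Lu Hu]|[[ws [wss [Hr Hrr]]] [ws' [wss' [Hi Hii]]]]].
  have /(Lp_setTP _ p1)[Lr Li] := Lu.
  have /choice[v Hv] : forall i, exists v : E -> R[i], Lp p setT v /\ weak_deriv setT [:: i] u v.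
    by move=> i; have [v Lv uv] := Hu [:: i] isT; exists v.
  have /choice[w Hw] : forall ij : 'I_N * 'I_N, exists w : E -> R[i],
      Lp p setT w /\ weak_deriv setT [:: ij.1; ij.2] u w.
    by move=> ij; have [w Lw uw] := Hu [:: ij.1; ij.2] isT; exists w.
  have Lv i : Lpr p (re (v i)) /\ Lpr p (im (v i)) by apply/(Lp_setTP _ p1); have [] := Hv i.
  have Lw i j : Lpr p (re (w (i, j))) /\ Lpr p (im (w (i, j))).
    by apply/(Lp_setTP _ p1); have [] := Hw (i, j).
  have Dv i g : rtest g -> \int[mu]_x (complex.Re (u x) * pd i g x) =
        - (\int[mu]_x (complex.Re (v i x) * g x)) /\
      \int[mu]_x (complex.Im (u x) * pd i g x) = - (\int[mu]_x (complex.Im (v i x) * g x)).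
    by move=> tg; have := weak_deriv_elim (Hv i).2 tg; rewrite /= expr1 !mulN1r.
  have Dw i j g : rtest g -> \int[mu]_x (complex.Re (u x) * pd i (pd j g) x) =
        \int[mu]_x (complex.Re (w (i, j) x) * g x) /\
      \int[mu]_x (complex.Im (u x) * pd i (pd j g) x) = \int[mu]_x (complex.Im (w (i, j) x) * g x).
    by move=> tg; have := weak_deriv_elim (Hw (i, j)).2 tg; rewrite /= sqrrN expr1n !mul1r.
  split.
    exists (fun i => re (v i)), (fun i j => re (w (i, j))); split.
      split; [exact: Lr|move=> i; split; [exact: (Lv i).1|move=> g tg; exact: (Dv i g tg).1]].
    move=> i; split; first exact: (Lv i).1.
    move=> j; split; first exact: (Lw i j).1.
    move=> g tg; rewrite -(Dw i j g tg).1 (Dv i _ (rtest_pd j tg)).1 opprK.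
    by [].
  exists (fun i => im (v i)), (fun i j => im (w (i, j))); split.
    split; [exact: Li|move=> i; split; [exact: (Lv i).2|move=> g tg; exact: (Dv i g tg).2]].
  move=> i; split; first exact: (Lv i).2.
  move=> j; split; first exact: (Lw i j).2.
  move=> g tg; rewrite -(Dw i j g tg).2 (Dv i _ (rtest_pd j tg)).2 opprK.
  by [].
have [Lu Hu] := W1_sobolev p1 Hr Hi; split; first exact: Lu.
case=> [_|i [_|j [_|//]]]; [exact: (Hu [::] isT)|exact: (Hu [:: i] isT)|].
exists (fun x => wss i j x +i* wss' i j x).
  by apply/(Lp_setTP _ p1); split; [exact: ((Hrr i).2 j).1|exact: ((Hii i).2 j).1].
apply: weak_deriv_intro; [exact: lL Hr.1|exact: lL Hi.1|exact: lL ((Hrr i).2 j).1|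
  exact: lL ((Hii i).2 j).1|].
move=> g tg; have tj := rtest_pd j tg; rewrite /= sqrrN expr1n !mul1r.
split.
  by rewrite [LHS]((Hr.2 i).2 _ tj) ((Hrr i).2 j).2// opprK.
by rewrite [LHS]((Hi.2 i).2 _ tj) ((Hii i).2 j).2// opprK.
Qed.

Lemma sobolev2D p u v : 1 <= p -> sobolev 2 p setT u -> sobolev 2 p setT v ->
  sobolev 2 p setT (fun x => u x + v x).
Proof.
move=> p1 /(sobolev2P _ p1)[[ws [wss H]] [ws' [wss' H']]].
move=> /(sobolev2P _ p1)[[vs [vss K]] [vs' [vss' K']]].
apply/(sobolev2P _ p1); split.
  have := W2D p1 H K; rewrite (_ : (fun x => _ + _) = (re (fun x => u x + v x))).
    by move=> W; exists (fun i x => ws i x + vs i x), (fun i j x => wss i j x + vss i j x).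
  by apply/funext => x; case: (u x) => ? ?; case: (v x).
have := W2D p1 H' K'; rewrite (_ : (fun x => _ + _) = (im (fun x => u x + v x))).
  by move=> W; exists (fun i x => ws' i x + vs' i x), (fun i j x => wss' i j x + vss' i j x).
by apply/funext => x; case: (u x) => ? ?; case: (v x).
Qed.

Lemma rtest_sobolev2 p u : 1 <= p -> rtest (re u) -> rtest (im u) -> sobolev 2 p setT u.
Proof.
move=> p1 tr ti; apply/(sobolev2P _ p1); split.
  by exists (fun i => pd i (re u)), (fun i j => pd j (pd i (re u))); exact: rtest_W2.
by exists (fun i => pd i (im u)), (fun i j => pd j (pd i (im u))); exact: rtest_W2.
Qed.

Lemma rtest1_multiplier alpha f : rtest f -> singular_multiplier alpha (fun x => 1 + f x).
Proof.
move=> tf; have [C C0 HC] := rtest_bounded tf.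
split; first by apply: smooth_onS (smooth_onD (@openT _) (smooth_on_cst 1) tf.1).
have P1 i : pd i (fun x => 1 + f x) = pd i f.
  apply/funext => x; rewrite (pdD i (C1_at_cst 1 x) (smooth_on_C1 tf.1 I)).
  by rewrite pd_cst add0r.
have /choice[K HK] : forall i, exists K : R, 0 <= K /\ forall x, `|pd i f x| <= K.
  by move=> i; have [K K0 H] := rtest_bounded (rtest_pd i tf); exists K.
have /choice[L HL] : forall ij : 'I_N * 'I_N, exists K : R, 0 <= K /\ forall x, `|pd ij.2 (pd ij.1 f) x| <= K.
  by move=> ij; have [K' K0 H] := rtest_bounded (rtest_pd ij.2 (rtest_pd ij.1 tf)); exists K'.
have K0 : 0 <= \sum_i K i by apply: sumr_ge0 => i _; have [] := HK i.
have L0 : 0 <= \sum_i L i by apply: sumr_ge0 => i _; have [] := HL i.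
exists (1 + C + \sum_i K i + \sum_i L i); first by rewrite !addr_ge0.
move=> x _; split=> [|i|i j].
- have := ler_normD 1 (f x); rewrite normr1; have := HC x; lra.
- rewrite P1; have hx := hw_ge0 (1 - alpha) 1 x.
  apply: (@le_trans _ _ (\sum_i K i)).
    by rewrite (bigD1 i)//= (le_trans ((HK i).2 x))// lerDl sumr_ge0// => j _; have [] := HK j.
  rewrite -[leLHS]mulr1; apply: ler_pM => //; lra.
- rewrite P1; have hx := hw_ge0 (- alpha) 1 x.
  apply: (@le_trans _ _ (\sum_i L i)).
    rewrite (bigD1 (i, j))//= (le_trans ((HL (i, j)).2 x))// lerDl sumr_ge0// => ij _.
    by have [] := HL ij.
  rewrite -[leLHS]mulr1; apply: ler_pM => //; lra.
Qed.

(** [phi] is cut down to 0 near the origin. Since it is 1 near infinity, subtracting 1 leaves a test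
    function, so all derivatives are bounded. *)
Lemma cutoff_multiplier k phi (M d : R) : plateau k -> smooth_on [set x | x != 0] phi ->
  (forall x, M < `|x| -> phi x = 1) -> 0 < d ->
  exists2 g, singular_multiplier 0 g & forall x, d <= `|x| -> g x = phi x.
Proof.
move=> [tk k1] sphi phiM d0; have [r kr] := tk.2.
pose a := (`|r| + 1) / d; have a0 : 0 < a by rewrite divr_gt0// ltr_wpDl.
have tka : rtest (fun x => k (a *: x)) by exact: rtest_scale a0 tk.
have kfar x : d <= `|x| -> k (a *: x) = 0.
  move=> dx; apply: kr; rewrite normrZ gtr0_norm// /a mulrAC ler_pdivlMr//.
  apply: (@le_trans _ _ ((`|r| + 1) * d)); last by rewrite ler_wpM2l// addr_ge0.
  by rewrite ler_wpM2r ?(ltW d0)// (le_trans (ler_norm _))// lerDl.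
pose q x := phi x * (1 + -1 * k (a *: x)) + -1.
have tq : rtest q.
  split; last first.
    exists (Num.max d (M + 1)) => x; rewrite ge_max => /andP[dx Mx].
    by rewrite /q kfar// phiM ?mulr0 ?addr0 ?mulr1 ?subrr//; lra.
  have oN : open [set x : E | x != 0] by exact: open_rV_neq0.
  have oB : open [set x : E | `|x| < a^-1].
    rewrite (_ : [set x : E | _] = ball 0 a^-1); first by apply: ball_open; rewrite invr_gt0.
    by apply/seteqP; split=> x; rewrite -ball_normE/= sub0r normrN.
  apply: (@smooth_onS _ _ _ ([set x : E | x != 0] `|` [set x : E | `|x| < a^-1])).
    move=> x _; have [->|x0] := eqVneq x 0; [right; rewrite /= normr0 invr_gt0//|by left].
  apply: smooth_onU.
    apply: smooth_onD; [exact: oN| |exact: smooth_on_cst].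
    apply: smooth_onM; [exact: oN|exact: sphi|].
    apply: smooth_onD; [exact: oN|exact: smooth_on_cst|].
    apply: smooth_onM; [exact: oN|exact: smooth_on_cst|exact: smooth_onS tka.1].
  apply: (@eq_smooth_on _ _ _ (fun=> -1) q oB) (smooth_on_cst _) => x /= xa.
  rewrite /q k1 ?mulr1 ?subrr ?mulr0 ?add0r//.
  by rewrite normrZ gtr0_norm// mulrC -ltr_pdivlMr// div1r.
exists (fun x => 1 + q x); first exact: rtest1_multiplier.
by move=> x dx; rewrite /q kfar// mulr0 addr0 mulr1 addrC subrK.
Qed.

Lemma mul_realC (a : R) (c : R[i]) :
  complex.Re (a%:C * c) = a * complex.Re c /\ complex.Im (a%:C * c) = a * complex.Im c.
Proof. by case: c => b d /=; rewrite !mul0r subr0 addr0. Qed.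

Lemma sobolev2_multiplier k p alpha g u : plateau k -> (1 < N)%N -> 1 <= p ->
  singular_multiplier alpha g -> alpha < 2 -> (alpha - 1) * p < N%:R ->
  sobolev 2 p setT u ->
  (forall ws wss, W2 p (re u) ws wss -> (wint p (hw (- (alpha * p)) 1) (re u) < +oo)%E) ->
  (forall ws wss, W2 p (im u) ws wss -> (wint p (hw (- (alpha * p)) 1) (im u) < +oo)%E) ->
  sobolev 2 p setT (fun x => (g x)%:C * u x).
Proof.
move=> pk N1 p1 sg al2 alN /(sobolev2P _ p1)[[ws [wss H]] [ws' [wss' H']]] /(_ _ _ H) hr /(_ _ _ H') hi.
apply/(sobolev2P _ p1); split; do 2 eexists.
  rewrite (_ : (fun x => complex.Re ((g x)%:C * u x)) = (fun x => g x * complex.Re (u x))); last first.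
    by apply/funext => x; rewrite (mul_realC _ _).1.
  exact: (multiplier_W2 pk N1 p1 sg al2 alN H hr).
rewrite (_ : (fun x => complex.Im ((g x)%:C * u x)) = (fun x => g x * complex.Im (u x))); last first.
  by apply/funext => x; rewrite (mul_realC _ _).2.
exact: (multiplier_W2 pk N1 p1 sg al2 alN H' hi).
Qed.

(* Away from the origin [phi] may be replaced by a smooth multiplier with bounded
   derivatives, so the first condition in [dom_S] follows from the second. *)
Lemma dom_SP k p phi (M : R) u : plateau k -> (1 < N)%N -> 1 <= p ->
  smooth_on [set x | x != 0] phi -> (forall x, M < `|x| -> phi x = 1) ->
  (forall x, phi x != 0) ->
  dom_S p phi u <-> sobolev 2 p setT (fun x => u x / (phi x)%:C).
Proof.
move=> pk N1 p1 sphi phiM phi0; split=> [[]//|Hw]; split=> // e e0.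
(* Outside the Euclidean ball of radius [e] the sup norm is at least [e / N]. *)
have d0 : 0 < e / N%:R by rewrite divr_gt0// ltr0n ltnW.
have [g sg gphi] := cutoff_multiplier pk sphi phiM d0.
have oO : open (~` eball e : set E)° by exact: open_interior.
have alN : (0 - 1) * p < N%:R :> R.
  by rewrite sub0r mulN1r (lt_le_trans _ (ler0n _ _))// oppr_lt0 (lt_le_trans ltr01).
have h0 (v : E -> R) ws wss : W2 p v ws wss -> (wint p (hw (- (0 * p)) 1) v < +oo)%E.
  by move=> [[Lv _] _]; rewrite mul0r oppr0; exact: wint_hw_Lpr.
have := sobolev2_multiplier pk N1 p1 sg (ltr0n R 2) alN Hw (h0 _) (h0 _).
move=> /(sobolev_restrict (open_measurable_rV oO)); apply: eq_sobolev => x /interior_subset.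
rewrite /eball/= => /negP; rewrite -leNgt => ex.
rewrite gphi; last first.
  by rewrite ler_pdivrMr ?ltr0n 1?ltnW// (le_trans ex)// mulrC enorm_le_norm.
rewrite mulrCA mulfV ?mulr1//.
by rewrite eq_complex/= negb_and phi0.
Qed.

End sobolev_real_parts.

(** * Point values and the domain of the operator *)

Section point_values.
Local Open Scope complex_scope.
Context {R : realType} {N : nat}.
Local Notation E := 'rV[R]_N.
Local Notation mu := (lebesgue_rV N : {sigma_finite_measure set E -> \bar R}).
Implicit Types (x y z : E) (u v w : E -> R[i]) (f g h k phi : E -> R) (p alpha : R).
Local Notation re u := (fun x => complex.Re (u x)).
Local Notation im u := (fun x => complex.Im (u x)).

Lemma ccontinuousD u v : ccontinuous u -> ccontinuous v -> ccontinuous (fun x => u x + v x).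
Proof.
move=> [ru iu] [rv iv]; split.
  rewrite (_ : _ \o _ = (fun x => complex.Re (u x) + complex.Re (v x))).
    by move=> x; apply: (continuousD (ru x) (rv x)).
  by apply/funext => x /=; case: (u x); case: (v x).
rewrite (_ : _ \o _ = (fun x => complex.Im (u x) + complex.Im (v x))).
  by move=> x; apply: (continuousD (iu x) (iv x)).
by apply/funext => x /=; case: (u x); case: (v x).
Qed.

Lemma ccontinuousM u v : ccontinuous u -> ccontinuous v -> ccontinuous (fun x => u x * v x).
Proof.
move=> [ru iu] [rv iv]; split.
  rewrite (_ : _ \o _ = (fun x => complex.Re (u x) * complex.Re (v x) -
      complex.Im (u x) * complex.Im (v x))).
    by move=> x; apply: (continuousB (continuousM (ru x) (rv x)) (continuousM (iu x) (iv x))).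
  by apply/funext => x /=; case: (u x); case: (v x).
rewrite (_ : _ \o _ = (fun x => complex.Re (u x) * complex.Im (v x) +
    complex.Im (u x) * complex.Re (v x))).
  by move=> x; apply: (continuousD (continuousM (ru x) (iv x)) (continuousM (iu x) (rv x))).
by apply/funext => x /=; case: (u x); case: (v x).
Qed.

Lemma ccontinuous_cst (a : R[i]) : ccontinuous (fun _ : E => a).
Proof. by split=> x; exact: cst_continuous. Qed.

Lemma ccontinuous_real g : continuous g -> ccontinuous (fun x => (g x)%:C).
Proof. by move=> cg; split=> x; [exact: cg|exact: cst_continuous]. Qed.

Lemma sobolev2_point_value k p u : plateau k -> 1 <= p -> N%:R < 2 * p ->
  sobolev 2 p setT u -> exists a, point_value u 0 a.
Proof.
move=> pk p1 Np /(sobolev2P _ p1)[[ws [wss [[Lr Hr] Hrr]]] [ws' [wss' [[Li Hi] Hii]]]].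
have [a ca ua] := sobolev_continuous pk p1 Np (Lpr_locint p1 Lr) (fun i => (Hr i).1)
  (fun i => (Hr i).2) (fun i j => ((Hrr i).2 j).1) (fun i j => ((Hrr i).2 j).2).
have [b cb ub] := sobolev_continuous pk p1 Np (Lpr_locint p1 Li) (fun i => (Hi i).1)
  (fun i => (Hi i).2) (fun i j => ((Hii i).2 j).1) (fun i j => ((Hii i).2 j).2).
exists (a 0 +i* b 0), (fun x => a x +i* b x); split; first by split.
split=> //; apply: filterS2 ua ub => x <- <-.
by case: (u x).
Qed.

Lemma sobolev2_multiplier_vanishing k p alpha g u : plateau k -> (1 < N)%N -> 1 <= p ->
  singular_multiplier alpha g -> 0 <= alpha < 2 -> N%:R <= alpha * p ->
  (alpha - 1) * p < N%:R -> sobolev 2 p setT u -> point_value u 0 0 ->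
  sobolev 2 p setT (fun x => (g x)%:C * u x).
Proof.
move=> pk N1 p1 sg al02 Nal alN Hu [v [[cr ci] [uv v0]]]; have /andP[_ al2] := al02.
apply: (sobolev2_multiplier pk N1 p1 sg al2 alN Hu) => ws wss W.
  apply: (hardy_second_vanishing pk N1 p1 W al02 Nal alN cr).
    by rewrite /= v0.
  by apply: filterS uv => x ->.
apply: (hardy_second_vanishing pk N1 p1 W al02 Nal alN ci).
  by rewrite /= v0.
by apply: filterS uv => x ->.
Qed.

Lemma sobolev1_multiplier k p alpha g u : plateau k -> (1 < N)%N -> 1 <= p ->
  singular_multiplier alpha g -> alpha < 2 -> (alpha - 1) * p < N%:R ->
  sobolev 2 p setT u -> sobolev 1 p setT (fun x => (g x)%:C * u x).
Proof.
move=> pk N1 p1 sg al2 alN /(sobolev2P _ p1)[[ws [wss [H _]]] [ws' [wss' [H' _]]]].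
apply: (W1_sobolev p1).
  rewrite (_ : (fun x => complex.Re ((g x)%:C * u x)) = (fun x => g x * complex.Re (u x))).
    exact: (multiplier_W1 pk N1 p1 sg al2 alN H).
  by apply/funext => x; rewrite (mul_realC _ _).1.
rewrite (_ : (fun x => complex.Im ((g x)%:C * u x)) = (fun x => g x * complex.Im (u x))).
  exact: (multiplier_W1 pk N1 p1 sg al2 alN H').
by apply/funext => x; rewrite (mul_realC _ _).2.
Qed.

(** [eta] is 1 on the Euclidean unit ball, a plateau on the sup-norm one; the Euclidean norm is at
    most [N] times the sup norm, whence the scale. *)
Lemma test_fun_plateau (eta : E -> R[i]) : (0 < N)%N -> test_fun setT eta ->
  (forall x, eball 1 x -> eta x = 1) ->
  plateau (fun x => complex.Re (eta (N%:R^-1 *: x))).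
Proof.
move=> N0 te eta1; have n0 : 0 < N%:R^-1 :> R by rewrite invr_gt0 ltr0n.
split.
  have := rtest_affine 0 n0 (test_fun_rtest te).1.
  by congr rtest; apply/funext => x; rewrite addr0.
move=> x x1; rewrite eta1// /eball/= (le_lt_trans (enorm_le_norm _))//.
by rewrite normrZ gtr0_norm// mulrA mulfV ?mul1r// gt_eqF// ltr0n.
Qed.

End point_values.

Local Open Scope complex_scope.

Theorem theorem6p4 (R : realType) (N m : nat) (alpha c p : R)
    (phi : 'rV[R]_N -> R) (eta : 'rV[R]_N -> R[i]) :
  (2 <= N)%N -> 0 < alpha < 2 -> 1 < p -> alpha < N%:R / p + 1 ->
  alpha / (2 - alpha) <= m%:R < 2 / (2 - alpha) ->
  is_phi alpha c m phi ->
  test_fun setT eta -> (forall x, eball 1 x -> eta x = 1) ->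
  (alpha < N%:R / p -> dom_S p phi = sobolev 2 p setT) /\
  (N%:R / p <= alpha ->
     [/\ dom_S p phi `<=` sobolev 1 p setT,
         dom_S p phi =
           [set u | exists a u1,
              [/\ sobolev 2 p setT u1, point_value u1 0 0 &
                  u = fun x => a * (eta x * (phi x)%:C) + u1 x]]
       & forall u a u1, sobolev 2 p setT u1 -> point_value u1 0 0 ->
           u = (fun x => a * (eta x * (phi x)%:C) + u1 x) ->
           point_value u 0 a]).
Proof.
move=> N1 al02 /ltW p1 alNp _ hphi te eta1.
have N0 : (0 < N)%N by exact: ltnW.
have p0 : 0 < p by apply: lt_le_trans p1.
have pk := test_fun_plateau N0 te eta1.
have /andP[al0 al2] := al02.
have al02' : 0 <= alpha < 2 by rewrite (ltW al0).
have alN : (alpha - 1) * p < N%:R by rewrite -ltr_pdivlMr// ltrBlDr.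
have [sphi _ phi12 _ [M phiM]] := hphi.
have phi_ge x : 1 / 2 <= phi x by have /andP[] := phi12 x.
have phi0 x : phi x != 0 by rewrite gt_eqF// (lt_le_trans _ (phi_ge x)).
have phiC x : (phi x)%:C != 0 by rewrite eq_complex/= negb_and phi0.
have sp := is_phi_multiplier pk al02 hphi.
have sV := singular_multiplierV (ltW al2) sp phi_ge.
have cphi := is_phi_continuous al2 hphi.
have phi00 : phi 0 = 1 by exact: is_phi0 al2 hphi.
have eta0 : eta 0 = 1.
  by apply: eta1; rewrite /eball/= (le_lt_trans (enorm_le_norm _))// normr0 mulr0.
have phiMn x : M < `|x| -> phi x = 1.
  by move=> Mx; apply: phiM; apply: lt_le_trans (norm_le_enorm x).
have domP u : dom_S p phi u <-> sobolev 2 p setT (fun x => u x / (phi x)%:C).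
  exact: (dom_SP _ pk N1 p1 sphi phiMn phi0).
have divE (u : 'rV[R]_N -> R[i]) x : u x / (phi x)%:C = ((phi x)^-1)%:C * u x.
  by rewrite mulrC; congr (_ * _); rewrite -fmorphV.
have mulK (u : 'rV[R]_N -> R[i]) x : (phi x)%:C * (u x / (phi x)%:C) = u x.
  by rewrite mulrC divfK.
split=> [alsub|alsup].
  have alp : alpha * p < N%:R by rewrite -ltr_pdivlMr.
  have mult g (u : 'rV[R]_N -> R[i]) : singular_multiplier alpha g -> sobolev 2 p setT u ->
      sobolev 2 p setT (fun x => (g x)%:C * u x).
    move=> sg Hu; apply: (sobolev2_multiplier pk N1 p1 sg al2 alN Hu) => ws wss W.
      exact: (hardy_second pk N1 p1 W al02' alp).
    exact: (hardy_second pk N1 p1 W al02' alp).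
  apply/seteqP; split=> u.
    move=> /domP /(mult _ _ sp); apply: eq_sobolev => x _; exact: mulK.
  by move=> Hu; apply/domP; apply: eq_sobolev (mult _ _ sV Hu) => x _; rewrite divE.
have Nal : N%:R <= alpha * p by rewrite -ler_pdivrMr.
(* The bound [alpha < 2] places [p] in the range where point values exist. *)
have N2p : N%:R < 2 * p by apply: (le_lt_trans Nal); rewrite ltr_pM2r.
have [tr ti] := test_fun_rtest te.
have ceta : ccontinuous eta by split; exact: rtest_continuous.
have Seta (a : R[i]) : sobolev 2 p setT (fun x => a * eta x).
  case: a => a b; have rM (d : R) (h : 'rV[R]_N -> R) : rtest h -> rtest (fun x => d * h x).
    by apply: rtestM; exact: smooth_on_cst.
  apply: (rtest_sobolev2 p1).
    have := rtestD (rM a _ tr) (rM (- b) _ ti); congr rtest.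
    by apply/funext => x; case: (eta x) => ? ? /=; rewrite mulNr.
  have := rtestD (rM a _ ti) (rM b _ tr); congr rtest.
  by apply/funext => x; case: (eta x).
have pointv u a u1 : point_value u1 0 0 ->
    u = (fun x => a * (eta x * (phi x)%:C) + u1 x) -> point_value u 0 a.
  move=> [v [cv [u1v v0]]] ->; exists (fun x => a * (eta x * (phi x)%:C) + v x); split.
    apply: ccontinuousD cv; apply: ccontinuousM; first exact: ccontinuous_cst.
    by apply: ccontinuousM ceta _; exact: ccontinuous_real.
  split; first by apply: filterS u1v => x ->.
  by rewrite v0 addr0 eta0 phi00 mulr1 mulr1.
split.
- move=> u /domP /(sobolev1_multiplier pk N1 p1 sp al2 alN).
  by apply: eq_sobolev => x _; exact: mulK.
- apply/seteqP; split=> u.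
    move=> /domP Hw; have [a [w0 [cw [ww w0a]]]] := sobolev2_point_value pk p1 N2p Hw.
    (* Subtracting [a * eta] cancels the value at 0. Multiplication by [phi] then turns [a * eta]
       into the singular part of [u] and the remainder [w1] into [u1]. *)
    pose w1 x := u x / (phi x)%:C + - a * eta x.
    have Hw1 : sobolev 2 p setT w1 by exact: sobolev2D p1 Hw (Seta (- a)).
    have pw1 : point_value w1 0 0.
      exists (fun x => w0 x + - a * eta x); split.
        apply: ccontinuousD cw _; apply: ccontinuousM ceta; exact: ccontinuous_cst.
      split; first by apply: filterS ww => x; rewrite /w1 => ->.
      by rewrite w0a eta0 mulr1 subrr.
    exists a, (fun x => (phi x)%:C * w1 x); split.
    + exact: (sobolev2_multiplier_vanishing pk N1 p1 sp al02' Nal alN Hw1 pw1).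
    + have [v [cv [wv v0]]] := pw1; exists (fun x => (phi x)%:C * v x); split.
        by apply: ccontinuousM cv; exact: ccontinuous_real.
      split; first by apply: filterS wv => x ->.
      by rewrite v0 mulr0.
    + apply/funext => x; rewrite /w1 mulrDr mulK addrCA.
      by rewrite [X in _ + X](_ : _ = 0) ?addr0//; ring.
  (* Divided by [phi], [u] becomes [a * eta] plus the quotient of [u1]; the vanishing of [u1] at 0
     gives access to the inside Hardy inequality for the latter. *)
  move=> [a [u1 [Hu1 pu1 uE]]]; apply/domP.
  apply: eq_sobolev (sobolev2D p1 (Seta a)
    (sobolev2_multiplier_vanishing pk N1 p1 sV al02' Nal alN Hu1 pu1)) => x _.
  by rewrite uE mulrDl -divE; congr (_ + _); rewrite mulrA mulfK.
- by move=> u a u1 _ pu1 uE; exact: pointv pu1 uE.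
Qed.
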